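(* Let $R$ be a commutative artinian ring, $\Lambda$ an Artin $R$-algebra, $d\geq 1$ an integer, and $\mathcal{M}$ a $d$-cluster-tilting subcategory of $\operatorname{mod}\Lambda$. Then for each indecomposable non-projective $\Lambda$-module $N\in\mathcal{M}$ there exists a $d$-almost split sequence in $\mathcal{M}$ of the form $$0\to\tau_dN\to M^1\to\cdots\to M^d\to N\to 0.$$ Dually, for each indecomposable non-injective $\Lambda$-module $L\in\mathcal{M}$ there exists a $d$-almost split sequence in $\mathcal{M}$ of the form $$0\to L\to M^1\to\cdots\to M^d\to\tau_d^-L\to 0.$$
   Context: $\operatorname{mod}\Lambda$ is the category of finite length right $\Lambda$-modules. All subcategories of $\operatorname{mod}\Lambda$ are full and closed under (finite) direct sums and direct summands. $D=\operatorname{Hom}_R(-,I)\colon\operatorname{mod}\Lambda\to\operatorname{mod}\Lambda^{\mathrm{op}}$ is the standard duality, where $I$ is the injective envelope of the direct sum of representatives of the isomorphism classes of simple $R$-modules. A functorially finite (i.e. contravariantly and covariantly finite) subcategory $\mathcal{M}$ of $\operatorname{mod}\Lambda$ is $d$-cluster-tilting if $$\mathcal{M}=\{X\mid \operatorname{Ext}^k_\Lambda(X,\mathcal{M})=0\ \forall k\in\{1,\dots,d-1\}\}=\{Y\mid \operatorname{Ext}^k_\Lambda(\mathcal{M},Y)=0\ \forall k\in\{1,\dots,d-1\}\}$$ with $X,Y$ ranging over $\operatorname{mod}\Lambda$. A $d$-exact sequence in $\mathcal{M}$ is a complex $L\to M^1\to\cdots\to M^d\to N$ in $\mathcal{M}$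 such that for every $X\in\mathcal{M}$ both induced sequences $0\to\operatorname{Hom}_\Lambda(X,L)\to\operatorname{Hom}_\Lambda(X,M^1)\to\cdots\to\operatorname{Hom}_\Lambda(X,M^d)\to\operatorname{Hom}_\Lambda(X,N)$ and $0\to\operatorname{Hom}_\Lambda(N,X)\to\operatorname{Hom}_\Lambda(M^d,X)\to\cdots\to\operatorname{Hom}_\Lambda(M^1,X)\to\operatorname{Hom}_\Lambda(L,X)$ are exact. A morphism $g\colon M\to N$ in $\mathcal{M}$ is right almost split in $\mathcal{M}$ if it is not a split epimorphism and every morphism $V\to N$ in $\mathcal{M}$ which is not a split epimorphism factors through $g$; left almost split is defined dually. A morphism $f\colon L\to M$ is right minimal if every $g\colon L\to L$ with $f\circ g=f$ is an isomorphism; left minimal is defined dually. The Jacobson radical of $\operatorname{mod}\Lambda$ is the two-sided ideal of morphisms $f\colon M\to N$ such that $1_N-f\circ g$ is invertible for all $g\colon N\to M$. A $d$-exact sequence $0\to L\xrightarrow{f}M^1\to\cdots\to M^d\xrightarrow{g}N\to 0$ in $\mathcal{M}$ is a $d$-almost split sequence in $\mathcal{M}$ if $f$ is left minimal and left almost split in $\mathcal{M}$, $g$ is right minimal and right almost split in $\mathcal{M}$, and for each $i\in\{1,\dots,d-1\}$ the morphism $M^i\to M^{i+1}$ lies in the Jacobson radical of $\operatorname{mod}\Lambda$. $\operatorname{Tr}_d=\operatorname{Tr}\Omega^{d-1}$, where $\operatorname{Tr}$ is the Auslander–Bridger transpose and $\Omega$ the syzygy (computed from minimal projective presentations/covers);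 $\tau_d=D\operatorname{Tr}_d$ and $\tau_d^-=\operatorname{Tr}_dD$. *)

(* Defs.v *)
From mathcomp Require Export all_boot all_order all_algebra.
From mathcomp Require Export classical_sets.
Set Implicit Arguments.
Unset Strict Implicit.
Unset Printing Implicit Defensive.
Import GRing.Theory.
Local Open Scope classical_set_scope.
Local Open Scope ring_scope.

(* Right modules over a ring Lam are encoded as left modules over its converse
   ring Lam^c, so everything below is written for left modules over a general
   ring A and used for both A := Lam^c and A := Lam. *)

Definition onto (X Y : Type) (f : X -> Y) : Prop := forall y, exists x, f x = y.

Definition exact_at (A : pzRingType) (X Y Z : lmodType A)
    (f : {linear X -> Y}) (g : {linear Y -> Z}) : Prop :=
  forall y, g y = 0 <-> exists x, f x = y.

Definition isomorphic (A : pzRingType) (X Y : lmodType A) : Prop :=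
  exists f : {linear X -> Y}, bijective f.

Definition zero_module (A : pzRingType) (X : lmodType A) : Prop :=
  forall x : X, x = 0.

Definition submodule (A : pzRingType) (X : lmodType A) (U : set X) : Prop :=
  U 0 /\ forall (a : A) (x y : X), U x -> U y -> U (a *: x + y).

Definition simple_module (A : pzRingType) (X : lmodType A) : Prop :=
  ~ zero_module X /\
  forall U : set X, submodule U -> U = [set 0] \/ U = setT.

(* U is a maximal proper submodule of V, i.e. V / U is simple *)
Definition simple_quotient (A : pzRingType) (X : lmodType A) (U V : set X) :
    Prop :=
  U `<` V /\
  forall W : set X, submodule W -> U `<=` W -> W `<=` V -> W = U \/ W = V.

Definition finite_length (A : pzRingType) (X : lmodType A) : Prop :=
  exists (n : nat) (S : nat -> set X),
    [/\ forall i, (i <= n)%N -> submodule (S i),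
        S 0%N = [set 0], S n = setT
      & forall i, (i < n)%N -> simple_quotient (S i) (S i.+1)].

Definition indecomposable (A : pzRingType) (X : lmodType A) : Prop :=
  ~ zero_module X /\
  forall (Y Z : lmodType A) (f : {linear X -> (Y * Z)%type}),
    bijective f -> zero_module Y \/ zero_module Z.

Definition projective_module (A : pzRingType) (P : lmodType A) : Prop :=
  forall (X Y : lmodType A) (g : {linear X -> Y}) (f : {linear P -> Y}),
    onto g -> exists h : {linear P -> X}, forall x, g (h x) = f x.

Definition injective_module (A : pzRingType) (E : lmodType A) : Prop :=
  forall (X Y : lmodType A) (g : {linear X -> Y}) (f : {linear X -> E}),
    injective g -> exists h : {linear Y -> E}, forall x, h (g x) = f x.

Definition artinian_module (A : pzRingType) (X : lmodType A) : Prop :=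
  forall U : nat -> set X,
    (forall i, submodule (U i)) -> (forall i, U i.+1 `<=` U i) ->
    exists n, forall m, (n <= m)%N -> U m = U n.

Definition artin_algebra (R : comNzRingType) (Lam : algType R) : Prop :=
  artinian_module (R^o : lmodType R) /\
  exists (n : nat) (s : 'I_n -> Lam),
    forall x : Lam, exists c : 'I_n -> R, x = \sum_i c i *: s i.

Definition projective_resolution (A : pzRingType) (X : lmodType A)
    (P : nat -> lmodType A) (del : forall i, {linear P i.+1 -> P i})
    (eps : {linear P 0%N -> X}) : Prop :=
  [/\ forall i, projective_module (P i), onto eps, exact_at (del 0%N) eps
    & forall i, exact_at (del i.+1) (del i)].

(* Ext^k(X, Y) = 0: for a projective resolution P of X, the complex Hom(P, Y)
   has zero cohomology in degree k. *)
Definition Ext_vanishes (A : pzRingType) (k : nat) (X Y : lmodType A) : Prop :=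
  forall (P : nat -> lmodType A) (del : forall i, {linear P i.+1 -> P i})
    (eps : {linear P 0%N -> X}), projective_resolution del eps ->
  match k with
  | 0%N => forall f : {linear P 0%N -> Y},
      (forall x, f (del 0%N x) = 0) -> forall x, f x = 0
  | j.+1 => forall f : {linear P j.+1 -> Y},
      (forall x, f (del j.+1 x) = 0) ->
      exists h : {linear P j -> Y}, forall x, f x = h (del j x)
  end.

(* A full subcategory is given by its class of objects; closure under
   isomorphism is the case of a split monomorphism that is bijective. *)
Definition subcategory (A : pzRingType) (M : lmodType A -> Prop) : Prop :=
  [/\ forall X, M X -> finite_length X,
      forall X, zero_module X -> M X,
      forall X Y, M X -> M Y -> M (X * Y)%type
    & forall (X Y : lmodType A) (i : {linear X -> Y}) (p : {linear Y -> X}),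
        M Y -> (forall x, p (i x) = x) -> M X].

Definition contravariantly_finite (A : pzRingType) (M : lmodType A -> Prop) :
    Prop :=
  forall X : lmodType A, finite_length X ->
  exists (V : lmodType A) (f : {linear V -> X}), M V /\
    forall (W : lmodType A) (g : {linear W -> X}), M W ->
      exists h : {linear W -> V}, forall x, f (h x) = g x.

Definition covariantly_finite (A : pzRingType) (M : lmodType A -> Prop) :
    Prop :=
  forall X : lmodType A, finite_length X ->
  exists (V : lmodType A) (f : {linear X -> V}), M V /\
    forall (W : lmodType A) (g : {linear X -> W}), M W ->
      exists h : {linear V -> W}, forall x, h (f x) = g x.

Definition cluster_tilting (A : pzRingType) (d : nat)
    (M : lmodType A -> Prop) : Prop :=
  [/\ subcategory M, contravariantly_finite M, covariantly_finite M,
      forall X, M X <-> (finite_length X /\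
        forall k Y, (0 < k < d)%N -> M Y -> Ext_vanishes k X Y)
    & forall Y, M Y <-> (finite_length Y /\
        forall k X, (0 < k < d)%N -> M X -> Ext_vanishes k X Y)].

(* C 0 -> C 1 -> ... -> C d -> C d.+1; the terms C i with i > d.+1 and the maps
   del i with i > d are irrelevant. *)
Definition d_exact (A : pzRingType) (M : lmodType A -> Prop) (d : nat)
    (C : nat -> lmodType A) (del : forall i, {linear C i -> C i.+1}) : Prop :=
  [/\ forall i, (i <= d.+1)%N -> M (C i),
      forall i x, (i < d)%N -> del i.+1 (del i x) = 0,
      forall X, M X ->
        (forall h : {linear X -> C 0%N},
           (forall x, del 0%N (h x) = 0) -> forall x, h x = 0) /\
        (forall i (h : {linear X -> C i.+1}), (i < d)%N ->
           (forall x, del i.+1 (h x) = 0) ->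
           exists h' : {linear X -> C i}, forall x, del i (h' x) = h x)
    & forall X, M X ->
        (forall h : {linear C d.+1 -> X},
           (forall x, h (del d x) = 0) -> forall x, h x = 0) /\
        (forall i (h : {linear C i.+1 -> X}), (i < d)%N ->
           (forall x, h (del i x) = 0) ->
           exists h' : {linear C i.+2 -> X}, forall x, h' (del i.+1 x) = h x)].

Definition split_epi (A : pzRingType) (X Y : lmodType A)
    (g : {linear X -> Y}) : Prop :=
  exists s : {linear Y -> X}, forall y, g (s y) = y.

Definition split_mono (A : pzRingType) (X Y : lmodType A)
    (f : {linear X -> Y}) : Prop :=
  exists r : {linear Y -> X}, forall x, r (f x) = x.

Definition right_almost_split (A : pzRingType) (M : lmodType A -> Prop)
    (X N : lmodType A) (g : {linear X -> N}) : Prop :=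
  ~ split_epi g /\
  forall (V : lmodType A) (h : {linear V -> N}), M V -> ~ split_epi h ->
    exists k : {linear V -> X}, forall x, g (k x) = h x.

Definition left_almost_split (A : pzRingType) (M : lmodType A -> Prop)
    (L X : lmodType A) (f : {linear L -> X}) : Prop :=
  ~ split_mono f /\
  forall (V : lmodType A) (h : {linear L -> V}), M V -> ~ split_mono h ->
    exists k : {linear X -> V}, forall x, k (f x) = h x.

Definition right_minimal (A : pzRingType) (X Y : lmodType A)
    (f : {linear X -> Y}) : Prop :=
  forall g : {linear X -> X}, (forall x, f (g x) = f x) -> bijective g.

Definition left_minimal (A : pzRingType) (X Y : lmodType A)
    (f : {linear X -> Y}) : Prop :=
  forall g : {linear Y -> Y}, (forall x, g (f x) = f x) -> bijective g.

Definition in_radical (A : pzRingType) (X Y : lmodType A)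
    (f : {linear X -> Y}) : Prop :=
  forall g : {linear Y -> X}, bijective (fun y : Y => y - f (g y)).

Definition d_almost_split (A : pzRingType) (M : lmodType A -> Prop) (d : nat)
    (C : nat -> lmodType A) (del : forall i, {linear C i -> C i.+1}) : Prop :=
  [/\ d_exact M d del,
      left_minimal (del 0%N) /\ left_almost_split M (del 0%N),
      right_minimal (del d) /\ right_almost_split M (del d)
    & forall i, (0 < i < d)%N -> in_radical (del i)].

(* Syzygies, transposes and duals are determined only up to isomorphism, so
   each is a relation between a module and its possible values. *)

(* The kernel of p is superfluous: U + ker p = P only for U = P. *)
Definition superfluous_kernel (A : pzRingType) (P X : lmodType A)
    (p : {linear P -> X}) : Prop :=
  forall U : set P, submodule U ->
    (forall x, exists u v, [/\ U u, p v = 0 & x = u + v]) -> U = setT.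

Definition projective_cover (A : pzRingType) (P X : lmodType A)
    (p : {linear P -> X}) : Prop :=
  [/\ projective_module P, onto p & superfluous_kernel p].

Definition is_syzygy (A : pzRingType) (X K : lmodType A) : Prop :=
  exists (P : lmodType A) (p : {linear P -> X}) (i : {linear K -> P}),
    [/\ projective_cover p, injective i & exact_at i p].

Fixpoint is_nth_syzygy (A : pzRingType) (n : nat) (X K : lmodType A) : Prop :=
  match n with
  | 0%N => isomorphic X K
  | m.+1 => exists K' : lmodType A, is_nth_syzygy m X K' /\ is_syzygy K' K
  end.

(* As p1 and its corestriction to ker p0 have the same kernel, the second line
   says that P1 -> ker p0 is a projective cover. *)
Definition minimal_presentation (A : pzRingType) (P1 P0 X : lmodType A)
    (p1 : {linear P1 -> P0}) (p0 : {linear P0 -> X}) : Prop :=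
  projective_cover p0 /\
  [/\ projective_module P1, exact_at p1 p0 & superfluous_kernel p1].

(* In the next definitions B is the opposite ring of A and op : B -> A is the
   identity on elements, which allows both (A, B) = (Lam^c, Lam) and
   (A, B) = (Lam, Lam^c) without forming Lam^c^c. *)

(* phi identifies Q with Hom_A(P, A), where B acts by (b f)(x) = f(x) b. *)
Definition is_star (A B : pzRingType) (op : B -> A)
    (P : lmodType A) (Q : lmodType B) (phi : Q -> {linear P -> A^o}) : Prop :=
  [/\ forall q q', (forall x, phi q x = phi q' x) -> q = q',
      forall f : {linear P -> A^o}, exists q, forall x, phi q x = f x,
      forall q q' x, phi (q + q') x = phi q x + phi q' x
    & forall b q x, phi (b *: q) x = (phi q x : A) * op b].

Definition is_transpose (A B : pzRingType) (op : B -> A)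
    (X : lmodType A) (T : lmodType B) : Prop :=
  exists (P1 P0 : lmodType A) (p1 : {linear P1 -> P0}) (p0 : {linear P0 -> X}),
  minimal_presentation p1 p0 /\
  exists (Q0 Q1 : lmodType B)
    (phi0 : Q0 -> {linear P0 -> A^o}) (phi1 : Q1 -> {linear P1 -> A^o})
    (p1s : {linear Q0 -> Q1}) (c : {linear Q1 -> T}),
  [/\ is_star op phi0, is_star op phi1,
      forall q x, phi1 (p1s q) x = phi0 q (p1 x),
      exact_at p1s c & onto c].

Definition injective_envelope (A : pzRingType) (S E : lmodType A)
    (j : {linear S -> E}) : Prop :=
  [/\ injective_module E, injective j
    & forall U : set E, submodule U ->
        (forall s, U (j s) -> j s = 0) -> U = [set 0]].

(* S is the direct sum of a set of representatives of the isomorphism classes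
   of simple modules; over an artinian commutative ring there are finitely many
   of them. *)
Definition sum_of_simples (A : pzRingType) (S : lmodType A) : Prop :=
  exists (n : nat) (T : 'I_n -> lmodType A)
    (inj : forall i, {linear T i -> S}) (pr : forall i, {linear S -> T i}),
  [/\ forall i, simple_module (T i),
      forall i j, isomorphic (T i) (T j) -> i = j,
      forall X, simple_module X -> exists i, isomorphic X (T i)
    & [/\ forall i x, pr i (inj i x) = x,
          forall i j x, i != j -> pr j (inj i x) = 0
        & forall s, s = \sum_i inj i (pr i s)]].

Definition standard_injective (R : comNzRingType) (E : lmodType R) : Prop :=
  exists (S : lmodType R) (j : {linear S -> E}),
    sum_of_simples S /\ injective_envelope j.

(* Y is Hom_R(X, E), where R acts on X through iota : R -> A and B acts by
   (b f)(x) = f(b x). *)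
Definition is_dual (R : comNzRingType) (E : lmodType R) (A B : pzRingType)
    (iota : R -> A) (op : B -> A) (X : lmodType A) (Y : lmodType B) : Prop :=
  let Rlinear (f : X -> E) :=
    forall (r : R) (x y : X), f (iota r *: x + y) = r *: f x + f y in
  exists phi : Y -> X -> E,
  [/\ forall q, Rlinear (phi q),
      forall q q', (forall x, phi q x = phi q' x) -> q = q',
      forall f, Rlinear f -> exists q, forall x, phi q x = f x,
      forall q q' x, phi (q + q') x = phi q x + phi q' x
    & forall b q x, phi (b *: q) x = phi q (op b *: x)].

(* T is tau_d N = D Tr Omega^(d-1) N. *)
Definition is_tau (R : comNzRingType) (Lam : algType R) (E : lmodType R)
    (d : nat) (N T : lmodType Lam^c) : Prop :=
  exists (K : lmodType Lam^c) (TrK : lmodType Lam),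
  [/\ is_nth_syzygy d.-1 N K,
      is_transpose (fun a : Lam => a : Lam^c) K TrK
    & is_dual E (fun r : R => r%:A : Lam) (fun a : Lam^c => a : Lam) TrK T].

(* T is tau_d^- L = Tr Omega^(d-1) D L. *)
Definition is_tau_inv (R : comNzRingType) (Lam : algType R) (E : lmodType R)
    (d : nat) (L T : lmodType Lam^c) : Prop :=
  exists DL K : lmodType Lam,
  [/\ is_dual E (fun r : R => r%:A : Lam^c) (fun a : Lam => a : Lam^c) L DL,
      is_nth_syzygy d.-1 DL K
    & is_transpose (fun a : Lam^c => a : Lam) K T].

(* Main.v *)
(* Let P be a minimal projective resolution of N and let J be the Nakayama
   functor applied to P.  As Ext^i(N, A) = 0 for 0 < i < d, the complex
   J_d -> ... -> J_0 is exact at its inner terms, so it coresolves the kernel T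
   of J_d -> J_(d-1), which is tau_d N and which lies in M by balance of Ext.
   A functional eta on End(N) that kills the radical but not the identity is
   induced by a map psi : N -> J_0; a map h : V -> N lifts along the pullback of
   psi to J_1 -> J_0 if and only if eta vanishes on all h g, i.e. unless h is a
   split epimorphism.  Replacing the terms of the pulled back extension by
   M-approximations yields an exact sequence W in M from T to N whose last map
   is right almost split in M.
   A right minimal version of that map, followed by successive minimal
   M-approximations of kernels, gives a sequence C with all differentials in
   the radical.  Comparing C with W shows that the left end of C is isomorphic
   to T, the composite endomorphisms of the ends being invertible because
   differentials in the radical, respectively nilpotency, force it.
   The first map of C is left almost split since pushing C out along h : L -> V
   either splits, and then h factors, or lifts to C_1, and then h is a split
   monomorphism.
   The second assertion is the first one for the opposite algebra and the
   category of all Y with D Y in M, dualised. *)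
Require Import Defs.
From HB Require Import structures.
From mathcomp Require Import all_boot all_order all_algebra.
From mathcomp Require Import boolp classical_sets zify.
Set Implicit Arguments.
Unset Strict Implicit.
Unset Printing Implicit Defensive.
Import GRing.Theory.
Local Open Scope classical_set_scope.
Local Open Scope ring_scope.

(** Neither of the two sequences suffices alone: W has the prescribed left end but is not minimal,
    while C is minimal but its left end is unknown; hence the comparison. Such an identification
    usually rests on Ext^d as a bifunctor and on the Auslander-Reiten formula. Here a class of
    degree d is kept as a map from N to the right end of a coresolution of T, its splitting is moved
    between the two ends by chain homotopies, and the formula is replaced by the fact that a map V
    -> J_i is the same as an E-valued functional on Hom(P_i, V). Tensor products never occur. Finite
    length is used through a strictly increasing integer function on submodules, from which minimal
    and maximal submodules are read off. The construction is carried out for rings A and B with an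
    explicit anti-isomorphism and central maps from R, so that the second assertion can apply it
    with A and B exchanged. Indices descend, with N at 0 and the left end at d+1, because
    resolutions and approximations grow to the left; they are turned around only at the end. *)

Definition lin (A : pzRingType) (X Y : lmodType A) (f : X -> Y)
    (fL : linear f) : {linear X -> Y} :=
  HB.pack f (GRing.isLinear.Build A X Y *:%R f fL).

(** * Submodules and quotients as module types *)

Record submod (A : pzRingType) (X : lmodType A) :=
  Submod { submod_set : set X; submodP : submodule submod_set }.

Section SubmoduleType.
Variables (A : pzRingType) (X : lmodType A) (U : submod X).

Definition mem_submod : {pred X} := fun x => `[< submod_set U x >].

Lemma mem_submod_closed : submod_closed mem_submod.
Proof.
have [U0 UL] := submodP U; split; first exact/asboolP.
by move=> a x y /asboolP Ux /asboolP Uy; apply/asboolP/UL.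
Qed.

HB.instance Definition _ := GRing.isSubmodClosed.Build A X mem_submod
  (GRing.submod_closed_semi mem_submod_closed).

Definition submod_type := {x : X | x \in mem_submod}.
HB.instance Definition _ := SubType.copy submod_type {x : X | x \in mem_submod}.
HB.instance Definition _ := [Choice of submod_type by <:].
HB.instance Definition _ := [SubChoice_isSubLmodule of submod_type by <:].

Definition submod_incl : {linear submod_type -> X} := (val : {linear submod_type -> X}).

Lemma submod_incl_inj : injective submod_incl. Proof. exact: val_inj. Qed.

Lemma submod_inclP (x : submod_type) : submod_set U (submod_incl x).
Proof. exact/asboolP/(valP x). Qed.

Lemma submod_incl_exists (x : X) : submod_set U x -> exists y, submod_incl y = x.
Proof. by move=> /asboolP Ux; exists (exist _ x Ux). Qed.

End SubmoduleType.

Lemma submodule_type (A : pzRingType) (X : lmodType A) (U : set X) :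
  submodule U -> exists (S : lmodType A) (i : {linear S -> X}),
    injective i /\ forall x, U x <-> exists y, i y = x.
Proof.
move=> hU; exists (submod_type (Submod hU)), (submod_incl (Submod hU)).
split; first exact: submod_incl_inj.
move=> x; split; first exact: (@submod_incl_exists _ _ (Submod hU)).
by move=> [y <-]; exact: (@submod_inclP _ _ (Submod hU)) y.
Qed.

Section QuotientType.
Variables (A : pzRingType) (X : lmodType A) (U : submod X).

(** An element chosen from the coset of x; the default x is never reached, since x lies in its own
    coset. The quotient consists of the fixed points of this map, so equality in it is equality in
    X. *)
Definition coset_repr (x : X) : X := xget x [set y | submod_set U (x - y)].

Lemma submod0 : submod_set U 0. Proof. by case: (submodP U). Qed.

Lemma submodZD a x y :
  submod_set U x -> submod_set U y -> submod_set U (a *: x + y).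
Proof. by case: (submodP U) => _ UL; exact: UL. Qed.

Lemma coset_reprP x : submod_set U (x - coset_repr x).
Proof.
rewrite /coset_repr; case: xgetP => [y _ //|/(_ x)] [].
by rewrite /= subrr; exact: submod0.
Qed.

Lemma submodB x y : submod_set U x -> submod_set U y -> submod_set U (x - y).
Proof. by move=> Ux Uy; rewrite addrC -scaleN1r; exact: submodZD. Qed.

Lemma submodN x : submod_set U x -> submod_set U (- x).
Proof. by move=> Ux; rewrite -sub0r; apply: submodB => //; exact: submod0. Qed.

Lemma submodD x y : submod_set U x -> submod_set U y -> submod_set U (x + y).
Proof. by move=> Ux Uy; rewrite -[x]scale1r; exact: submodZD. Qed.

Lemma submodZ a x : submod_set U x -> submod_set U (a *: x).
Proof.
by move=> Ux; rewrite -[_ *: _]addr0; apply: submodZD => //; exact: submod0.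
Qed.

Lemma coset_repr_eq x y : submod_set U (x - y) -> coset_repr x = coset_repr y.
Proof.
move=> Uxy; rewrite /coset_repr.
have -> : [set z | submod_set U (x - z)] = [set z | submod_set U (y - z)].
  apply/seteqP; split=> z /= Uz.
    have -> : y - z = (x - z) - (x - y) by rewrite opprB [RHS]addrC addrA subrK.
    exact: submodB.
  have -> : x - z = (x - y) + (y - z) by rewrite [RHS]addrA subrK.
  exact: submodD.
rewrite /xget; case: pselect => // -[]; exists y.
by apply/asboolP; rewrite /= subrr; exact: submod0.
Qed.

Lemma coset_repr_id x : coset_repr (coset_repr x) = coset_repr x.
Proof.
by apply/coset_repr_eq; rewrite -opprB; apply/submodN/coset_reprP.
Qed.

Definition quot_type := {x : X | coset_repr x == x}.
HB.instance Definition _ := SubType.copy quot_type {x : X | coset_repr x == x}.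
HB.instance Definition _ := [Choice of quot_type by <:].

Definition quot_pi (x : X) : quot_type :=
  exist _ (coset_repr x) (introT eqP (coset_repr_id x)).

Lemma quot_pi_eq x y : submod_set U (x - y) -> quot_pi x = quot_pi y.
Proof. by move=> Uxy; apply: val_inj => /=; exact: coset_repr_eq. Qed.

Lemma val_quot_pi (q : quot_type) : quot_pi (val q) = q.
Proof. by apply: val_inj => /=; exact/eqP/(valP q). Qed.

Lemma val_quot_piP x : submod_set U (val (quot_pi x) - x).
Proof. by rewrite -opprB; apply/submodN/coset_reprP. Qed.

Definition quot_add (p q : quot_type) := quot_pi (val p + val q).
Definition quot_opp (p : quot_type) := quot_pi (- val p).
Definition quot_scale (a : A) (p : quot_type) := quot_pi (a *: val p).

Lemma quot_addE x y : quot_add (quot_pi x) (quot_pi y) = quot_pi (x + y).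
Proof.
apply: quot_pi_eq; rewrite opprD addrACA; apply: submodD; exact: val_quot_piP.
Qed.
Lemma quot_oppE x : quot_opp (quot_pi x) = quot_pi (- x).
Proof. by apply: quot_pi_eq; rewrite -opprD; apply/submodN/val_quot_piP. Qed.
Lemma quot_scaleE a x : quot_scale a (quot_pi x) = quot_pi (a *: x).
Proof. by apply: quot_pi_eq; rewrite -scalerBr; apply/submodZ/val_quot_piP. Qed.

Lemma quot_ind (P : quot_type -> Prop) :
  (forall x, P (quot_pi x)) -> forall q, P q.
Proof. by move=> h q; rewrite -[q]val_quot_pi; exact: h. Qed.

Lemma quot_addA : associative quot_add.
Proof.
by elim/quot_ind=> x; elim/quot_ind=> y; elim/quot_ind=> z; rewrite !quot_addE addrA.
Qed.
Lemma quot_addC : commutative quot_add.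
Proof. by elim/quot_ind=> x; elim/quot_ind=> y; rewrite !quot_addE addrC. Qed.
Lemma quot_add0 : left_id (quot_pi 0) quot_add.
Proof. by elim/quot_ind=> x; rewrite quot_addE add0r. Qed.
Lemma quot_addN : left_inverse (quot_pi 0) quot_opp quot_add.
Proof. by elim/quot_ind=> x; rewrite quot_oppE quot_addE addNr. Qed.
HB.instance Definition _ :=
  GRing.isZmodule.Build quot_type quot_addA quot_addC quot_add0 quot_addN.

Lemma quot_plusE (p q : quot_type) : p + q = quot_add p q. Proof. by []. Qed.

Lemma quot_scaleA a b v : quot_scale a (quot_scale b v) = quot_scale (a * b) v.
Proof. by elim/quot_ind: v => x; rewrite !quot_scaleE scalerA. Qed.
Lemma quot_scale1 : left_id 1 quot_scale.
Proof. by elim/quot_ind=> x; rewrite !quot_scaleE scale1r. Qed.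
Lemma quot_scaleDr : right_distributive quot_scale +%R.
Proof.
move=> a; elim/quot_ind=> x; elim/quot_ind=> y.
by rewrite !quot_plusE quot_addE !quot_scaleE quot_addE scalerDr.
Qed.
Lemma quot_scaleDl v : {morph quot_scale^~ v : a b / a + b}.
Proof.
move=> a b; elim/quot_ind: v => x.
by rewrite quot_plusE !quot_scaleE quot_addE scalerDl.
Qed.
HB.instance Definition _ := GRing.Zmodule_isLmodule.Build A quot_type
  quot_scaleA quot_scale1 quot_scaleDr quot_scaleDl.

Lemma quot_pi_linear : linear quot_pi.
Proof.
by move=> a x y; rewrite quot_plusE -[a *: quot_pi x]/(quot_scale a _) quot_scaleE quot_addE.
Qed.

End QuotientType.

Lemma quotient_type (A : pzRingType) (X : lmodType A) (U : set X) :
  submodule U -> exists (Q : lmodType A) (p : {linear X -> Q}),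
    onto p /\ forall x, p x = 0 <-> U x.
Proof.
move=> hU; exists (quot_type (Submod hU)), (lin (@quot_pi_linear _ _ (Submod hU))).
split=> [q|x /=]; first by exists (val q); exact: val_quot_pi.
split=> [p0|Ux]; last by apply: quot_pi_eq; rewrite /= subr0.
have := coset_reprP (Submod hU) x.
have /(congr1 val) /= -> := p0.
have := coset_reprP (Submod hU) 0; rewrite /= sub0r => h0 hx.
rewrite -[x](subrK (coset_repr (Submod hU) 0)).
by apply: (submodD (U := Submod hU)) => //; rewrite -[coset_repr _ _]opprK; apply: (submodN (U:= Submod hU)).
Qed.

(** * Factorisation of linear maps; kernels, images and cokernels *)

Section Factor.
Variable A : pzRingType.
Implicit Types X Y Z J P : lmodType A.

Lemma linear_inj X Y (f : {linear X -> Y}) :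
  (forall x, f x = 0 -> x = 0) -> injective f.
Proof.
by move=> h x y fxy; apply/eqP; rewrite -subr_eq0; apply/eqP/h; rewrite linearB fxy subrr.
Qed.

Lemma injective_eq0 X Y (f : {linear X -> Y}) x : injective f -> f x = 0 -> x = 0.
Proof. by move=> fI fx0; apply: fI; rewrite fx0 linear0. Qed.

Lemma injective_lift X Y Z (m : {linear Y -> Z}) (f : {linear X -> Z}) :
  injective m -> (forall x, exists y, m y = f x) ->
  exists k : {linear X -> Y}, forall x, m (k x) = f x.
Proof.
move=> mI /choice[k kP].
have kL : linear k by move=> a x y; apply: mI; rewrite linearP !kP linearP.
by exists (lin kL).
Qed.

Lemma onto_factor X Y Z (e : {linear X -> Y}) (f : {linear X -> Z}) :
  onto e -> (forall x, e x = 0 -> f x = 0) ->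
  exists k : {linear Y -> Z}, forall x, k (e x) = f x.
Proof.
move=> /choice[s sP] h.
have eq_f x y : e x = e y -> f x = f y.
  move=> exy; apply/eqP; rewrite -subr_eq0 -linearB; apply/eqP/h.
  by rewrite linearB exy subrr.
have kL : linear (f \o s).
  by move=> a x y; rewrite /= -linearP; apply: eq_f; rewrite linearP !sP.
by exists (lin kL) => x /=; apply: eq_f; rewrite sP.
Qed.

Lemma onto_inj_bij X Y (f : {linear X -> Y}) : onto f -> injective f -> bijective f.
Proof.
move=> /choice[s sP] fI; exists s => // x; by apply: fI; rewrite sP.
Qed.

Lemma bij_onto X Y (f : X -> Y) : bijective f -> onto f.
Proof. by move=> [g fK gK] y; exists (g y). Qed.

Lemma bij_inverse X Y (f : {linear X -> Y}) : bijective f ->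
  exists g : {linear Y -> X}, (forall x, g (f x) = x) /\ (forall y, f (g y) = y).
Proof.
move=> [g fK gK]; have gL : linear g.
  by move=> a x y; apply: (bij_inj (Bijective fK gK)); rewrite linearP !gK.
by exists (lin gL).
Qed.

Lemma kernel_submodule X Y (f : {linear X -> Y}) : submodule [set x | f x = 0].
Proof.
by split=> [|a x y /= fx fy]; rewrite /= ?linear0 // linearP fx fy scaler0 addr0.
Qed.

Lemma image_submodule X Y (f : {linear X -> Y}) (U : set X) :
  submodule U -> submodule [set y | exists2 x, U x & f x = y].
Proof.
move=> [U0 UL]; split=> [|a _ _ [x Ux <-] [y Uy <-]].
  by exists 0; rewrite ?linear0.
by exists (a *: x + y); [exact: UL|rewrite linearP].
Qed.

Lemma preimage_submodule X Y (f : {linear X -> Y}) (U : set Y) :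
  submodule U -> submodule [set x | U (f x)].
Proof.
by move=> [U0 UL]; split=> [|a x y /= Ux Uy]; rewrite /= ?linear0 // linearP; exact: UL.
Qed.

Lemma setI_submodule X (U V : set X) : submodule U -> submodule V ->
  submodule (U `&` V).
Proof.
move=> [U0 UL] [V0 VL]; split=> // a x y [Ux Vx] [Uy Vy].
by split; [exact: UL|exact: VL].
Qed.

Lemma submodule0 X : submodule [set (0 : X)].
Proof. by split=> // a x y /= -> ->; rewrite scaler0 addr0. Qed.

Lemma submoduleT X : submodule [set: X].
Proof. by []. Qed.

Lemma kernel_type X Y (f : {linear X -> Y}) :
  exists (K : lmodType A) (i : {linear K -> X}), injective i /\ exact_at i f.
Proof. exact/submodule_type/kernel_submodule. Qed.

Lemma image_type X Y (f : {linear X -> Y}) :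
  exists (I : lmodType A) (e : {linear X -> I}) (m : {linear I -> Y}),
    [/\ onto e, injective m & forall x, m (e x) = f x].
Proof.
have [I [m [mI mP]]] := submodule_type (image_submodule f (submoduleT X)).
have [|e eP] := @injective_lift _ _ _ m f mI.
  by move=> x; apply/mP; exists x.
exists I, e, m; split=> // y.
by have /mP[x _ xy] : exists y', m y' = m y by [exists y]; exists x; apply: mI; rewrite eP.
Qed.

Lemma cokernel_type X Y (f : {linear X -> Y}) :
  exists (C : lmodType A) (c : {linear Y -> C}), onto c /\ exact_at f c.
Proof.
have [C [c [cO cP]]] := quotient_type (image_submodule f (submoduleT X)).
exists C, c; split=> // y; rewrite cP /=; split=> [[x _ <-]|[x <-]]; by exists x.
Qed.

(** Here p need not be injective: f descends to the image of p and is then extended along the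
    inclusion of that image. *)
Lemma injective_factor X Y J (p : {linear X -> Y}) (f : {linear X -> J}) :
  injective_module J -> (forall x, p x = 0 -> f x = 0) ->
  exists k : {linear Y -> J}, forall x, k (p x) = f x.
Proof.
move=> JI h; have [I [e [m [eO mI mP]]]] := image_type p.
have [|f' f'P] := onto_factor (f := f) eO.
  by move=> x ex0; apply: h; rewrite -mP ex0 linear0.
have [k kP] := JI _ _ m f' mI.
by exists k => x; rewrite -mP kP f'P.
Qed.

Lemma projective_factor P X Y (p : {linear X -> Y}) (f : {linear P -> Y}) :
  projective_module P -> (forall x, exists y, p y = f x) ->
  exists k : {linear P -> X}, forall x, p (k x) = f x.
Proof.
move=> PP h; have [I [e [m [eO mI mP]]]] := image_type p.
have [|f' f'P] := injective_lift (f := f) mI.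
  by move=> x; have [y <-] := h x; exists (e y).
have [k kP] := PP _ _ e f' eO.
by exists k => x; rewrite -mP kP f'P.
Qed.

(** If u inverts 1 - g f, then 1 + f u g inverts 1 - f g. This moves the radical condition from one
    side of a map to the other. *)
Lemma comp_bij_inv X Y (f : {linear X -> Y}) (g : {linear Y -> X}) :
  bijective (fun x => x - g (f x)) -> bijective (fun y => y - f (g y)).
Proof.
move=> hb.
have [u [uK Ku]] := bij_inverse (f := (idfun \- (g \o f) : {linear _ -> _})) hb.
rewrite /= in uK Ku.
exists (fun y => y + f (u (g y))) => y.
  have -> : g (y - f (g y)) = g y - g (f (g y)) by rewrite linearB.
  by rewrite uK subrK.
have E : g y = u (g y) - g (f (u (g y))) by rewrite -[LHS]Ku.
have -> : g (y + f (u (g y))) = u (g y) by rewrite linearD [X in X + _]E subrK.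
by rewrite addrK.
Qed.

End Factor.

Lemma dep_choice (T : nat -> Type) (Q : forall i, T i -> T i.+1 -> Prop) (t0 : T 0%N) :
  (forall i x, exists y, Q i x y) ->
  exists f : forall i, T i, f 0%N = t0 /\ forall i, Q i (f i) (f i.+1).
Proof.
move=> h; have g i (x : T i) : {y | Q i x y} by apply/cid/h.
pose f := fix f i : T i := match i with 0%N => t0 | j.+1 => projT1 (g j (f j)) end.
by exists f; split=> // i; exact: (projT2 (g i (f i))).
Qed.

Lemma dep_update (T : nat -> Type) (f : forall i, T i) n (x : T n) :
  exists g : forall i, T i, g n = x /\ forall i, i <> n -> g i = f i.
Proof.
pose g i : T i := match pselect (n = i) with
  | left e => eq_rect n T x i e | right _ => f i end.
exists g; rewrite /g; split; first by case: pselect => // e; rewrite (Prop_irrelevance e erefl).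
by move=> i ni; case: pselect => // e; case: ni.
Qed.

(** The terms are chosen from index n down to 0; [d0] only fills the positions above n. *)
Lemma dep_choice_down (T : nat -> Type) (Q : forall i, T i -> T i.+1 -> Prop)
    (d0 : forall i, T i) n (t : T n) :
  (forall i y, (i < n)%N -> exists x, Q i x y) ->
  exists f : forall i, T i, f n = t /\ forall i, (i < n)%N -> Q i (f i) (f i.+1).
Proof.
elim: n t => [|n IH] t h.
  by have [f [f0 _]] := dep_update d0 t; exists f.
have [x Qx] := h n t (ltnSn _).
have [f [fn fP]] := IH x (fun i y lin => h i y (ltnW lin)).
have [g [gn gP]] := dep_update f t.
exists g; split=> // i; rewrite ltnS leq_eqVlt => /orP[/eqP ->|lin].
  by rewrite gn gP ?fn //; lia.
rewrite !gP; [exact: fP|move: lin|move: lin]; lia.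
Qed.

(** Finite length in the form used throughout; the length itself is such a function. It passes to
    submodules, quotients and extensions by explicit formulas, without Jordan-Holder. The version
    relative to W allows induction along a filtration inside one fixed module. *)
Definition ranked_in (A : pzRingType) (X : lmodType A) (W : set X) : Prop :=
  exists rho : set X -> nat, forall U V, submodule U -> submodule V ->
    V `<=` W -> U `<` V -> (rho U < rho V)%N.

Definition ranked (A : pzRingType) (X : lmodType A) : Prop :=
  ranked_in [set: X].

(** * Finite length as the existence of a rank on submodules *)

Section Ranked.
Variable A : pzRingType.
Implicit Types X Y Z K : lmodType A.

Lemma submodule_opp X (U : set X) x : submodule U -> U x -> U (- x).
Proof. by move=> [U0 UL] Ux; rewrite -[- x]addr0 -scaleN1r; exact: UL. Qed.

Lemma submodule_add X (U : set X) x y : submodule U -> U x -> U y -> U (x + y).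
Proof. by move=> [U0 UL] Ux Uy; rewrite -[x]scale1r; exact: UL. Qed.

Lemma submodule_sub X (U : set X) x y : submodule U -> U x -> U y -> U (x - y).
Proof. by move=> hU Ux Uy; apply: submodule_add => //; exact: submodule_opp. Qed.

Lemma submodule_scale X (U : set X) a x : submodule U -> U x -> U (a *: x).
Proof. by move=> [U0 UL] Ux; rewrite -[_ *: _]addr0; exact: UL. Qed.

Lemma submodule_sum X (U : set X) I (r : seq I) (F : I -> X) :
  submodule U -> (forall i, U (F i)) -> U (\sum_(i <- r) F i).
Proof.
move=> hU hF; elim/big_ind: _ => //; first by case: hU.
by move=> x y; exact: submodule_add.
Qed.

Lemma ranked_in_mono X (rho : set X -> nat) (W : set X) :
  (forall U V, submodule U -> submodule V -> V `<=` W -> U `<` V ->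
    (rho U < rho V)%N) ->
  forall U V, submodule U -> submodule V -> V `<=` W -> U `<=` V ->
    (rho U <= rho V)%N /\ (rho U = rho V -> V `<=` U).
Proof.
move=> h U V hU hV VW UV; have [VU|nVU] := pselect (V `<=` U).
  have -> : U = V by exact/seteqP.
  by split=> // _; exact: subset_refl.
by have lt := h U V hU hV VW (conj UV nVU); split; [exact: ltnW|lia].
Qed.

Lemma ranked_in_sub X (W W' : set X) : W `<=` W' -> ranked_in W' -> ranked_in W.
Proof.
move=> WW [rho h]; exists rho => U V hU hV VW; apply: h => //.
exact: subset_trans WW.
Qed.

(** The rank of U is that of its part in ker g plus that of its image. If both agree for U inside V,
    then U = V: an element of V differs from one of U with the same image by an element of the
    kernel. *)
Lemma ranked_in_ext X Y (g : {linear X -> Y}) (W : set X) :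
  submodule W -> ranked_in [set y | exists2 x, W x & g x = y] ->
  ranked_in (W `&` [set x | g x = 0]) -> ranked_in W.
Proof.
move=> hW [rY hY] [rK hK]; set Ker := [set x | g x = 0] in hK.
have hKer : submodule Ker by exact: kernel_submodule.
pose img U := [set y | exists2 x, U x & g x = y].
exists (fun U => rK (U `&` Ker) + rY (img U))%N => U V hU hV VW [UV nVU] /=.
have [] := ranked_in_mono hK (setI_submodule hU hKer) (setI_submodule hV hKer).
- by move=> x [Vx gx]; split=> //; exact: VW.
- by move=> x [Ux gx]; split=> //; exact: UV.
have [] := ranked_in_mono hY (image_submodule g hU) (image_submodule g hV).
- by move=> _ [x Ux <-]; exists x => //; exact: VW.
- by move=> _ [x Ux <-]; exists x => //; exact: UV.
rewrite -/(img U) -/(img V) => le2 eq2 le1 eq1.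
rewrite ltn_neqAle leq_add // andbT; apply/eqP => e; apply: nVU => x Vx.
have [x' Ux' gx'] : img U (g x) by apply: (eq2 _ (g x)); [lia|exists x].
have [Uxx' _] : (U `&` Ker) (x - x').
  apply: (eq1 _ (x - x')); first lia.
  split; last by rewrite /Ker /= linearB gx' subrr.
  by apply: submodule_sub => //; exact: UV.
by rewrite -[x](subrK x'); exact: submodule_add.
Qed.

Lemma ranked_inj X Y (i : {linear X -> Y}) : injective i -> ranked Y -> ranked X.
Proof.
move=> iI [rho h]; exists (fun U => rho [set y | exists2 x, U x & i x = y]).
move=> U V hU hV _ [UV nVU]; apply: h => //; try exact: image_submodule.
split=> [_ [x Ux <-]|VU]; first by exists x => //; exact: UV.
by apply: nVU => x Vx; have [|x' Ux' /iI <-] := VU (i x); first by exists x.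
Qed.

Lemma ranked_onto X Y (p : {linear X -> Y}) : onto p -> ranked X -> ranked Y.
Proof.
move=> pO [rho h]; exists (fun U => rho [set x | U (p x)]).
move=> U V hU hV _ [UV nVU]; apply: h => //; try exact: preimage_submodule.
split=> [x /=|VU]; first exact: UV.
by apply: nVU => y Vy; have [x xy] := pO y; rewrite -xy; apply: VU; rewrite /= xy.
Qed.

Lemma ranked_ext K X Y (i : {linear K -> X}) (p : {linear X -> Y}) :
  exact_at i p -> ranked K -> ranked Y -> ranked X.
Proof.
move=> ip [rK hK] hY.
apply: (@ranked_in_ext _ _ p) => //; first exact: (ranked_in_sub _ hY).
exists (fun U => rK [set x | U (i x)]) => U V hU hV VW [UV nVU].
apply: hK => //; try exact: preimage_submodule.
split=> [x /=|VU]; first exact: UV.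
apply: nVU => x Vx; have [_ /ip[k kx]] := VW _ Vx.
by rewrite -kx; apply: VU; rewrite /= kx.
Qed.

Lemma ranked_prod X Y : ranked X -> ranked Y -> ranked (X * Y)%type.
Proof.
move=> hX hY.
have h1L : linear (fun x : X => (x, 0 : Y)).
  by move=> a x y; congr pair; rewrite /= ?scaler0 ?addr0.
apply: (@ranked_ext _ _ _ (lin h1L) (snd : {linear _ -> _})) => // -[x y].
split=> /= [->|[z [_ <-]]] //; by exists x.
Qed.

Lemma ranked_zero X : zero_module X -> ranked X.
Proof.
move=> X0; exists (fun=> 0%N) => U V [U0 _] _ _ [_ []] x _.
by rewrite (X0 x).
Qed.

(** Beyond its intersection with S, a submodule of S' is measured by one bit: whether it lies in S.
    If it does not, its sum with S is all of S', the quotient being simple. *)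
Lemma ranked_in_simple X (S S' : set X) : submodule S -> submodule S' ->
  ranked_in S -> simple_quotient S S' -> ranked_in S'.
Proof.
move=> hS hS' [rho h] [[SS nSS] hmax].
pose top (U : set X) := `[< U `<=` S >].
exists (fun U => rho (U `&` S) + ~~ top U)%N => U V hU hV VS [UV nVU].
have [] := ranked_in_mono h (setI_submodule hU hS) (setI_submodule hV hS).
- by move=> x [].
- by move=> x [Ux ?]; split=> //; exact: UV.
move=> le1 eq1.
have le2 : (~~ top U <= ~~ top V)%N.
  rewrite /top; case: (asboolP (V `<=` S)) => [VSi|_]; last by case: (~~ _).
  by rewrite (_ : `[< _ >] = true) //; apply/asboolP; exact: (subset_trans UV).
rewrite ltn_neqAle leq_add // andbT; apply/eqP => /= e; apply: nVU => x Vx.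
have {}eq1 : V `&` S `<=` U `&` S by apply: eq1; lia.
have tt : top U = top V by move: le2 e le1; case: (top U); case: (top V) => /=; lia.
have [/asboolP VSi|/asboolP nVSi] := boolP (top V).
  by have [] // := eq1 x; split=> //; exact: VSi.
move: nVSi => /asboolPn; rewrite -/(top V) -tt => /asboolPn nUSi.
pose W := [set z | exists u s, [/\ U u, S s & z = u + s]].
have hW : submodule W.
  have [U0 UL] := hU; have [s0 sL] := hS; split.
    by exists 0, 0; split=> //; rewrite addr0.
  move=> a _ _ [u [s [Uu Ss ->]]] [v [t [Uv St ->]]].
  exists (a *: u + v), (a *: s + t); split; [exact: UL|exact: sL|].
  by rewrite scalerDr addrACA.
have SW : S `<=` W by move=> z Sz; exists 0, z; split; rewrite ?add0r //; case: hU.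
have WS1 : W `<=` S'.
  move=> _ [u [s [Uu Ss ->]]]; apply: submodule_add; [exact: hS'| |exact: SS].
  exact/VS/UV.
have [WS|WS] := hmax W hW SW WS1.
  exfalso; apply: nUSi => u Uu; rewrite -WS; exists u, 0; split; rewrite ?addr0 //.
  by case: hS.
have [u [s [Uu Ss xE]]] : W x by rewrite WS; exact: VS.
rewrite xE; apply: submodule_add => //.
have [] // := eq1 s; split=> //.
have -> : s = x - u by rewrite xE addrC addKr.
by apply: submodule_sub => //; exact: UV.
Qed.

Lemma finite_length_ranked X : finite_length X -> ranked X.
Proof.
move=> [n [S [hS S0 Sn hq]]].
suff h i : (i <= n)%N -> ranked_in (S i) by rewrite /ranked -Sn; exact: h.
elim: i => [_|i IH lin].
  exists (fun=> 0%N) => U V [U0 _] _ VS [_ []] x /VS; rewrite S0 /= => ->.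
  exact: U0.
apply: ranked_in_simple (hq _ lin); [exact/hS/ltnW|exact: hS|exact/IH/ltnW].
Qed.

Lemma ranked_min X (P : set X -> Prop) : ranked X ->
  (exists2 U, submodule U & P U) ->
  exists U, [/\ submodule U, P U & forall V, submodule V -> P V -> V `<=` U -> U `<=` V].
Proof.
move=> [rho h] [U0 hU0 PU0].
pose Q n := `[< exists U, [/\ submodule U, P U & rho U = n] >].
have exQ : exists n, Q n by exists (rho U0); apply/asboolP; exists U0.
have [n /asboolP[U [hU PU rU]] nmin] := ex_minnP exQ.
exists U; split=> // V hV PV VU; apply: contrapT => UV.
have : (rho V < rho U)%N by apply: h.
by rewrite rU ltnNge nmin //; apply/asboolP; exists V.
Qed.

Lemma ranked_max X (P : set X -> Prop) : ranked X ->
  (exists2 U, submodule U & P U) ->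
  exists U, [/\ submodule U, P U & forall V, submodule V -> P V -> U `<=` V -> V `<=` U].
Proof.
move=> [rho h] [U0 hU0 PU0].
pose Q n := `[< exists U, [/\ submodule U, P U & rho U = n] >].
have exQ : exists n, Q n by exists (rho U0); apply/asboolP; exists U0.
have bQ n : Q n -> (n <= rho setT)%N.
  move=> /asboolP[U [hU _ <-]].
  by have [] := ranked_in_mono h hU (@submoduleT _ X).
have [n /asboolP[U [hU PU rU]] nmax] := ex_maxnP exQ bQ.
exists U; split=> // V hV PV UV; apply: contrapT => VU.
have : (rho U < rho V)%N by apply: h.
by rewrite rU ltnNge nmax //; apply/asboolP; exists V.
Qed.

(** A maximal submodule U among those with a composition series is everything: otherwise a minimal
    submodule strictly above U would prolong the series. *)
Lemma ranked_finite_length X : ranked X -> finite_length X.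
Proof.
move=> hX; have [rho h] := hX.
pose chain (U : set X) := exists n (S : nat -> set X),
  [/\ forall i, (i <= n)%N -> submodule (S i), S 0%N = [set 0], S n = U
    & forall i, (i < n)%N -> simple_quotient (S i) (S i.+1)].
have [|U [hU [n [S [hS S0 Sn hq]]] Umax]] := @ranked_max _ chain hX.
  exists [set 0]; first exact: submodule0.
  by exists 0%N, (fun=> [set 0]); split=> // i _; exact: submodule0.
have [UT|nUT] := pselect (setT `<=` U).
  by exists n, S; split=> //; rewrite Sn; apply/seteqP; split.
have [|V [hV UV Vmin]] := @ranked_min _ (fun V => U `<` V) hX.
  by exists setT => //; split.
have VU : V `<=` U; last by case: UV.
apply: Umax => //; last by case: UV.
exists n.+1, (fun i => if (i <= n)%N then S i else V); split.
- by move=> i _; case: leqP => // /hS.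
- by rewrite S0.
- by rewrite ltnn.
move=> i /= lei; have := lei; rewrite {1}ltnS {1}leq_eqVlt => /orP[/eqP->|lin]; last first.
  by rewrite (ltnW lin) lin; exact: hq.
rewrite leqnn ltnn Sn; split=> // W hW UW WV.
have [WU|nWU] := pselect (W `<=` U); [left|right]; apply/seteqP; split=> //.
exact: Vmin.
Qed.

End Ranked.

Fixpoint spanned (A : pzRingType) (X : lmodType A) (s : seq X) : set X :=
  if s is x :: s' then [set y | exists a w, spanned s' w /\ y = a *: x + w]
  else [set 0].

Definition finitely_generated (A : pzRingType) (X : lmodType A) : Prop :=
  exists s : seq X, forall x, spanned s x.

Section Generated.
Variable A : pzRingType.
Implicit Types X Y Z : lmodType A.

Lemma span_submodule X (s : seq X) : submodule (spanned s).
Proof.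
elim: s => [|x s [IH0 IHL]] /=; first exact: submodule0.
split; first by exists 0, 0; rewrite scale0r addr0.
move=> a _ _ [b [u [su ->]]] [c [v [sv ->]]].
exists (a * b + c), (a *: u + v); split; first exact: IHL.
by rewrite scalerDr scalerA addrACA -scalerDl.
Qed.

Lemma span_mem X (s : seq X) : {in s, forall x, spanned s x}.
Proof.
elim: s => // x s IH y; rewrite inE => /orP[/eqP->|/IH sy].
  by exists 1, 0; rewrite scale1r addr0; split=> //; case: (span_submodule s).
by exists 0, y; rewrite scale0r add0r.
Qed.

Lemma span_ord X (s : seq X) x : spanned s x ->
  exists c : 'I_(size s) -> A, x = \sum_i c i *: s`_i.
Proof.
elim: s x => [|y s IH] x /=; first by move=> ->; exists (fun=> 0); rewrite big_ord0.
move=> [a [w [/IH[c ->] ->]]].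
exists (fun i => oapp c a (unlift ord0 i)); rewrite big_ord_recl unlift_none.
by congr (_ + _); apply: eq_bigr => i _; rewrite liftK.
Qed.

Lemma finitely_generated_ord X n (s : 'I_n -> X) :
  (forall x, exists c : 'I_n -> A, x = \sum_i c i *: s i) -> finitely_generated X.
Proof.
move=> h; exists [seq s i | i <- enum 'I_n] => x; have [c ->] := h x.
apply: submodule_sum; first exact: span_submodule.
move=> i; apply: submodule_scale; first exact: span_submodule.
by apply/span_mem/map_f; rewrite mem_enum.
Qed.

(** By leading coefficients: [I U] is the left ideal of those a for which some a x + w, with w in
    the span of s, lies in U. If U inside V has the same leading coefficients and the same part in
    that span, then U = V. *)
Lemma ranked_span X (s : seq X) : ranked (A^o : lmodType A) -> ranked_in (spanned s).
Proof.
move=> [rA hA]; elim: s => [|x s [rho h]].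
  exists (fun=> 0%N) => U V [U0 _] _ VS [_ []] y /VS /= ->; exact: U0.
have [s0 sL] := span_submodule s.
pose I (U : set X) : set A^o := [set a | exists w, spanned s w /\ U (a *: x + w)].
have hI U : submodule U -> submodule (I U).
  move=> [U0 UL]; split; first by exists 0; rewrite scale0r addr0.
  move=> a b c [v [sv Uv]] [w [sw Uw]]; exists (a *: v + w); split; first exact: sL.
  rewrite [X in U X](_ : _ = a *: ((b : A) *: x + v) + ((c : A) *: x + w)).
    exact: UL.
  by rewrite scalerDl scalerDr scalerA addrACA.
exists (fun U => rho (U `&` spanned s) + rA (I U))%N => U V hU hV VS [UV nVU] /=.
have hs := span_submodule s.
have [] := ranked_in_mono h (setI_submodule hU hs) (setI_submodule hV hs).
- by move=> y [].
- by move=> y [Uy ?]; split=> //; exact: UV.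
have [] := ranked_in_mono hA (hI _ hU) (hI _ hV).
- by [].
- by move=> a [w [sw Uw]]; exists w; split=> //; exact: UV.
move=> le1 eq1 le2 eq2.
rewrite ltn_neqAle leq_add // andbT; apply/eqP => e; apply: nVU => y Vy.
have [a [w [sw yE]]] := VS _ Vy.
have [w' [sw' Uw']] : I U a.
  by apply: (eq1 _ a); [lia|exists w; split=> //; rewrite -yE].
have [Uww' _] : (U `&` spanned s) (w - w').
  apply: (eq2 _ (w - w')); first lia.
  split; last exact: submodule_sub.
  have -> : w - w' = y - (a *: x + w') by rewrite yE opprD addrACA subrr add0r.
  by apply: submodule_sub => //; exact: UV.
have -> : y = (a *: x + w') + (w - w') by rewrite yE -addrA [w' + _]addrC subrK.
exact: submodule_add.
Qed.

Lemma finitely_generated_ranked X : ranked (A^o : lmodType A) ->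
  finitely_generated X -> ranked X.
Proof.
move=> hA [s hs]; have := ranked_span s hA.
by rewrite (_ : spanned s = setT) //; apply/seteqP; split.
Qed.

Lemma ranked_finitely_generated X : ranked X -> finitely_generated X.
Proof.
move=> hX; have [|U [hU [s sU] Umax]] :=
    @ranked_max _ _ (fun U => exists s : seq X, spanned s = U) hX.
  by exists [set 0]; [exact: submodule0|exists [::]].
exists s => x; rewrite sU.
apply: (Umax (spanned (x :: s))) => //; first exact: span_submodule.
- by exists (x :: s).
- by rewrite -sU => y sy; exists 0, y; rewrite scale0r add0r.
- by apply: span_mem; rewrite inE eqxx.
Qed.

(** * Endomorphisms of modules of finite length *)

Lemma linear_iter X (e : {linear X -> X}) n : linear (iter n e).
Proof. by elim: n => [|n IH] a x y //=; rewrite IH linearP. Qed.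

Lemma iter_linear0 X (e : {linear X -> X}) n : iter n e 0 = 0.
Proof. exact: (linear0 (lin (linear_iter e n))). Qed.

(** The images of the powers of e become stable, and e^n can be cancelled from e^n y = e^(n+1) x. *)
Lemma ranked_inj_onto X (e : {linear X -> X}) : ranked X -> injective e -> onto e.
Proof.
move=> hX eI; pose it n := lin (linear_iter e n).
pose img n := [set y | exists x, it n x = y].
have himg n : submodule (img n).
  split; first by exists 0; rewrite linear0.
  by move=> a _ _ [x <-] [y <-]; exists (a *: x + y); rewrite linearP.
have [|U [_ [n Un] Umin]] := @ranked_min _ _ (fun U => exists n, img n = U) hX.
  by exists (img 0%N); [exact: himg|exists 0%N].
move=> y; have : img n.+1 (it n y).
  apply: Umin; [exact: himg|by exists n.+1| |by rewrite -Un; exists y].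
  by move=> _ [x <-]; rewrite -Un; exists (e x); rewrite /= -iterSr.
move=> [x]; rewrite /= -iterS iterSr => exy; exists x.
elim: n {Un} exy => [|n IH] //= /eI; exact: IH.
Qed.

Lemma ranked_inj_bij X (e : {linear X -> X}) : ranked X -> injective e -> bijective e.
Proof. by move=> hX eI; apply: onto_inj_bij => //; exact: ranked_inj_onto. Qed.

Lemma ranked_onto_bij X (e : {linear X -> X}) : ranked X -> onto e -> bijective e.
Proof.
move=> hX eO; apply: onto_inj_bij => //; apply: linear_inj => x ex0.
pose it n := lin (linear_iter e n).
pose ker n := [set y | it n y = 0].
have hker n : submodule (ker n) by exact: kernel_submodule.
have [|U [_ [n Un] Umax]] := @ranked_max _ _ (fun U => exists n, ker n = U) hX.
  by exists (ker 0%N); [exact: hker|exists 0%N].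
have [y yx] : exists y, it n y = x.
  elim: n {Un} => [|n [y <-]]; first by exists x.
  by have [z <-] := eO y; exists z; rewrite /= -iterSr.
have : U y.
  apply: (Umax (ker n.+1)); [exact: hker|by exists n.+1| |].
    by move=> z; rewrite -Un /ker /= => ->; rewrite linear0.
  by rewrite /ker /=; rewrite /= in yx; rewrite yx.
by rewrite -Un /ker /= => <-; rewrite -yx.
Qed.

Lemma fitting X (e : {linear X -> X}) : ranked X -> exists n,
  [/\ (0 < n)%N, forall x, iter n e (iter n e x) = 0 -> iter n e x = 0
    & forall x, exists y, iter n e (iter n e y) = iter n e x].
Proof.
move=> hX; pose it n := lin (linear_iter e n).
pose ker n := [set y | it n y = 0].
have hker n : submodule (ker n) by exact: kernel_submodule.
have [|U [_ [n Un] Umax]] := @ranked_max _ _ (fun U => exists n, ker n = U) hX.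
  by exists (ker 0%N); [exact: hker|exists 0%N].
pose img n := [set y | exists x, it n x = y].
have himg k : submodule (img k).
  split; first by exists 0; rewrite linear0.
  by move=> a _ _ [x <-] [y <-]; exists (a *: x + y); rewrite linearP.
have [|V [_ [m Vm] Vmin]] := @ranked_min _ _ (fun U => exists n, img n = U) hX.
  by exists (img 0%N); [exact: himg|exists 0%N].
have kerS k x : (n <= k)%N -> iter k e x = 0 -> iter n e x = 0.
  move=> nk kx; have : U x; last by rewrite -Un.
  apply: (Umax (ker k)) => //; first by exists k.
  move=> z; rewrite -Un /ker /= => nz; rewrite -(subnK nk) iterD nz.
  by rewrite iter_linear0.
have imgS k x : (m <= k)%N -> exists y, iter k e y = iter m e x.
  move=> mk; have : img k (it m x); last by [].
  apply: (Vmin (img k)) => //; [by exists k| |by rewrite -Vm; exists x].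
  move=> _ [z <-]; rewrite -Vm; exists (iter (k - m) e z).
  by rewrite /= -iterD subnKC.
(* Large enough for the kernels, stable from n on, and for the images, stable from m on; the
   successor makes the exponent positive, so that one factor e can be split off later. *)
exists (n + m).+1; split=> // x.
  rewrite -iterD => h; rewrite (_ : (n + m).+1 = (m.+1 + n)%N); last by lia.
  rewrite iterD (kerS _ _ _ h); last by lia.
  by rewrite iter_linear0.
have [y yP] := imgS (m + (n + m).+1)%N x (leq_addr _ _).
exists y; rewrite (_ : (n + m).+1 = (n.+1 + m)%N); last by lia.
rewrite [in RHS]iterD -yP -!iterD; congr (iter _ e y); lia.
Qed.

(** Fitting: X is the direct sum of the kernel and the image of a power of e, so one of them
    vanishes. If the kernel does, e is injective and hence bijective. *)
Lemma indecomposable_nilpotent X (e : {linear X -> X}) :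
  ranked X -> indecomposable X -> ~ bijective e ->
  exists n, forall x, iter n e x = 0.
Proof.
move=> hX [nX0 hdec] nb; have [n [n0 nker nimg]] := fitting e hX.
pose f := lin (linear_iter e n).
have [K [i [iI iP]]] := kernel_type f.
have [I [p [m [pO mI mP]]]] := image_type f.
have sI : injective (p \o m : {linear _ -> _}).
  apply: linear_inj => z /=; have [x <-] := pO z; rewrite mP => h.
  apply: mI; rewrite linear0 mP; apply: nker.
  by have := mP (f x); rewrite h linear0.
have [|q qP] := injective_lift (m := m) (f := f) mI.
  by move=> x; exists (p x); rewrite mP.
have sO : onto (p \o m : {linear _ -> _}).
  move=> z; have [x <-] := pO z; have [y yP] := nimg x.
  exists (p y); apply: mI; rewrite /= !mP; exact: yP.
have [u [uK Ku']] := bij_inverse (onto_inj_bij sO sI).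
have Ku z : p (m (u z)) = z by exact: Ku'.
(* Since f = m p and u inverts p m, the map m u p is an idempotent with the image of f, and [pr] is
   the complementary idempotent, with values in the kernel of f. *)
pose pr : {linear X -> X} := idfun \- (m \o u \o p).
have [|k kP] := injective_lift (m := i) (f := pr) iI.
  move=> x; apply/iP; have -> : f (pr x) = f x - f (m (u (p x))) by rewrite -linearB.
  by rewrite -!mP (Ku (p x)) subrr.
have fL : linear (fun x => (k x, p x)) by move=> a x y; rewrite !linearP.
have fB : bijective (lin fL).
  apply: onto_inj_bij => [[y z]|].
    exists (i y + m (u z)).
    have py : p (i y) = 0.
      by apply: mI; rewrite mP linear0; apply/iP; exists y.
    congr pair; last by rewrite linearD py Ku add0r.
    apply: iI; rewrite kP /pr /= linearD py Ku add0r addrK //.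
  apply: linear_inj => x /= [kx px].
  have prE : pr x = x - m (u (p x)) by [].
  by have := kP x; rewrite kx linear0 prE px !linear0 addr0.
have [K0|I0] := hdec _ _ _ fB.
  exfalso; apply: nb; apply: ranked_inj_bij => //; apply: linear_inj => x ex0.
  have [y <-] : exists y, i y = x.
    by apply/iP; rewrite /f /= -(prednK n0) iterSr ex0 iter_linear0.
  by rewrite (K0 y) linear0.
by exists n => x; rewrite -[iter n e x]/(f x) -mP (I0 (p x)) linear0.
Qed.
End Generated.

(** * Right minimal versions and projective covers *)

Section Covers.
Variable A : pzRingType.
Implicit Types X Y Z N P : lmodType A.

Lemma nilpotent_one_sub X (e : {linear X -> X}) n : ranked X ->
  (forall x, iter n e x = 0) -> bijective (fun x => x - e x).
Proof.
move=> hX en; apply: (ranked_inj_bij (e := (idfun \- e : {linear X -> X})) hX).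
apply: linear_inj => x /= /eqP; rewrite subr_eq0 => /eqP ex.
by rewrite -(en x); elim: n {en} => //= n <-.
Qed.

(** The endomorphism ring is local: if u inverts e + f, then u e is nilpotent, so 1 - u e = u f is
    invertible and f is injective. *)
Lemma indecomposable_add X (e f : {linear X -> X}) : ranked X ->
  indecomposable X -> ~ bijective e -> ~ bijective f ->
  ~ bijective (fun x => e x + f x).
Proof.
move=> hX hI ne nf hb; apply: nf.
have [u [uK Ku]] := bij_inverse (f := (e \+ f : {linear X -> X})) hb.
have [|n un] := indecomposable_nilpotent (e := (u \o e : {linear X -> X})) hX hI.
  move=> ue; apply: ne; apply: ranked_inj_bij => // x y exy.
  by apply: (bij_inj ue); rewrite /= exy.
have := nilpotent_one_sub hX un => h.
apply: ranked_inj_bij => //; apply: linear_inj => x fx0.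
have: x - u (e x) = 0.
  have := uK x; rewrite /= fx0 addr0 => ->; exact: subrr.
have [v vK _] := h; move=> xu.
have h0 : 0 - u (e 0) = 0 :> X by rewrite !linear0 addr0.
by apply: (can_inj vK); rewrite /= xu h0.
Qed.

(** Choose e with g e = g and image X' as small as possible. Then e acts invertibly on X', which
    gives the retraction, and an endomorphism y of X' with g i y = g i extends to an endomorphism of
    X of the same kind with image inside X', so y is onto. *)
Lemma right_minimal_version X N (g : {linear X -> N}) : ranked X ->
  exists X' (i : {linear X' -> X}) (r : {linear X -> X'}),
  [/\ forall x, r (i x) = x, forall x, g (i (r x)) = g x
    & right_minimal (g \o i : {linear X' -> N})].
Proof.
move=> hX.
pose im (e : {linear X -> X}) := [set y | exists x, e x = y].
have him e : submodule (im e).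
  split; first by exists 0; rewrite linear0.
  by move=> a _ _ [x <-] [y <-]; exists (a *: x + y); rewrite linearP.
have [|U [_ [e ge <-] Umin]] := @ranked_min _ _
    (fun U => exists2 e : {linear X -> X}, (forall x, g (e x) = g x) & im e = U) hX.
  by exists (im idfun); [exact: him|exists idfun].
have [X' [p [i [pO iI iP]]]] := image_type e.
have sO : onto (p \o i : {linear _ -> _}).
  move=> z; have [x xz] := pO z.
  have [x' x'P] : im (e \o e) (e x).
    apply: (Umin (im (e \o e))); [exact: him| | |by exists x].
      by exists (e \o e) => // y /=; rewrite !ge.
    by move=> _ [y <-]; exists (e y).
  exists (p x'); apply: iI; rewrite /= !iP -xz iP; exact: x'P.
have hX' : ranked X' by exact: (ranked_inj iI).
have [u [uK Ku]] := bij_inverse (ranked_onto_bij hX' sO).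
exists X', i, (u \o p); split.
- by move=> x; exact: uK.
- move=> x /=; have pe : p (i (u (p x))) = p x by exact: Ku.
  by rewrite -ge -iP pe iP ge.
move=> y yP; apply: ranked_onto_bij => // z.
have [x xz] : im (i \o y \o u \o p) (i z).
  apply: (Umin (im (i \o y \o u \o p))); first exact: him.
  - exists (i \o y \o u \o p) => // x /=.
    transitivity (g (i (u (p x)))); first exact: (yP (u (p x))).
    have pe : p (i (u (p x))) = p x by exact: Ku.
    by rewrite -ge -iP pe iP ge.
  - by move=> _ [x <-]; have [w wE] := pO (y (u (p x))); exists w; rewrite -iP wE.
  - by have [w <-] := pO z; exists w; rewrite iP.
by exists (u (p x)); apply: iI.
Qed.

Definition combination X n (s : 'I_n -> X) (v : 'rV[A]_n) : X :=
  \sum_i v ord0 i *: s i.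

Lemma combination_linear X n (s : 'I_n -> X) : linear (combination s).
Proof.
move=> a v w; rewrite /combination scaler_sumr -big_split /=.
by apply: eq_bigr => i _; rewrite !mxE scalerDl scalerA.
Qed.

Lemma free_projective n : projective_module ('rV[A]_n : lmodType A).
Proof.
move=> X Y g f gO; have [s sP] := choice (fun i => gO (f (delta_mx 0 i))).
exists (lin (combination_linear s)) => v /=.
rewrite {2}[v]row_sum_delta !linear_sum; apply: eq_bigr => i _.
by rewrite !linearZ sP.
Qed.

Lemma free_finitely_generated n : finitely_generated ('rV[A]_n : lmodType A).
Proof.
apply: (@finitely_generated_ord _ _ n (fun i => delta_mx 0 i)) => v.
by exists (fun i => v 0 i); exact: row_sum_delta.
Qed.

Lemma free_onto X : finitely_generated X ->
  exists n (s : 'I_n -> X), onto (combination s).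
Proof.
move=> [s hs]; exists (size s), (fun i => s`_i) => x.
have [c ->] := span_ord (hs x); exists (\row_i c i).
by apply: eq_bigr => i _; rewrite mxE.
Qed.

Lemma projective_retract P Y (i : {linear Y -> P}) (r : {linear P -> Y}) :
  (forall y, r (i y) = y) -> projective_module P -> projective_module Y.
Proof.
move=> ri hP X Z g f gO; have [h hE] := hP _ _ g (f \o r) gO.
by exists (h \o i) => y /=; rewrite hE /= ri.
Qed.

Lemma injective_retract P Y (i : {linear Y -> P}) (r : {linear P -> Y}) :
  (forall y, r (i y) = y) -> injective_module P -> injective_module Y.
Proof.
move=> ri hP X Z g f gI; have [h hE] := hP _ _ g (i \o f) gI.
by exists (r \o h) => y /=; rewrite hE /= ri.
Qed.

(** If U + ker p = P, then p lifts through U to an endomorphism e of P with p e = p and image in U;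
    minimality makes e onto. *)
Lemma right_minimal_superfluous P X (p : {linear P -> X}) :
  projective_module P -> onto p -> right_minimal p -> superfluous_kernel p.
Proof.
move=> hP pO pm U hU hUp; have [S [i [iI iP]]] := submodule_type hU.
have [k kP] : exists k : {linear P -> S}, forall x, (p \o i) (k x) = p x.
  apply: (hP _ _ (p \o i : {linear S -> X}) p) => y; have [x <-] := pO y.
  have [u [v [/iP[s <-] pv ->]]] := hUp x.
  by exists s; rewrite /= linearD pv addr0.
have eb : bijective (i \o k : {linear P -> P}) by apply: pm => x; exact: kP.
apply/seteqP; split=> // x _; have [y <-] := bij_onto eb x.
by apply/iP; exists (k y).
Qed.

Lemma regular_projective : projective_module (A^o : lmodType A).
Proof.
move=> X Y g f gO; have [x xE] := gO (f 1).
have hL : linear (fun a : A^o => (a : A) *: x) by move=> a b c; rewrite scalerDl scalerA.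
exists (lin hL) => a /=; rewrite linearZ_LR xE -(linearZ_LR f).
by congr (f _); exact: mulr1.
Qed.

Lemma regular_finitely_generated : finitely_generated (A^o : lmodType A).
Proof.
by exists [:: 1] => a; exists a, 0; split=> //; rewrite addr0; exact: esym (mulr1 _).
Qed.

Lemma projective_cover_exists X : ranked (A^o : lmodType A) -> ranked X ->
  exists P (p : {linear P -> X}), ranked P /\ projective_cover p.
Proof.
move=> hA hX; have [n [s sO]] := free_onto (ranked_finitely_generated hX).
have hF := finitely_generated_ranked hA (free_finitely_generated n).
have [P [i [r [ri gir gm]]]] := right_minimal_version (lin (combination_linear s)) hF.
exists P, ((lin (combination_linear s)) \o i); split.
  by apply: (ranked_inj (i := i)) => //; exact: (can_inj ri).
have hP : projective_module P by exact: (projective_retract ri (@free_projective n)).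
have pO : onto (lin (combination_linear s) \o i : {linear P -> X}).
  by move=> x; have [v <-] := sO x; exists (r v); exact: gir.
by split=> //; exact: right_minimal_superfluous.
Qed.

End Covers.

(** * Commutative artinian rings *)

Lemma artinian_min (A : pzRingType) (X : lmodType A) (P : set X -> Prop) :
  artinian_module X -> (exists2 U, submodule U & P U) ->
  exists U, [/\ submodule U, P U & forall V, submodule V -> P V -> V `<=` U -> U `<=` V].
Proof.
move=> hX [U0 hU0 PU0]; apply: contrapT => /forallNP nmin.
pose T (_ : nat) := {U : set X | submodule U /\ P U}.
pose Q i (U V : T i) := sval V `<` sval U.
have [|f [_ fQ]] := @dep_choice T Q (exist _ U0 (conj hU0 PU0)).
  move=> i [U [hU PU]]; apply: contrapT => /forallNP nV; apply: (nmin U).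
  split=> // V hV PV VU; apply: contrapT => UV.
  by apply: (nV (exist _ V (conj hV PV))).
have [n nP] := hX (fun i => sval (f i)) (fun i => (svalP (f i)).1) (fun i => (fQ i).1).
by case: (fQ n) => _; rewrite (nP n.+1) //; apply; exact: subset_refl.
Qed.

Lemma span_ranked_in (A : pzRingType) (X : lmodType A) (s : seq X) :
  (forall x s', x \in s -> ~ spanned s' x -> simple_quotient (spanned s') (spanned (x :: s'))) ->
  ranked_in (spanned s).
Proof.
elim: s => [|x s IH] hs.
  exists (fun=> 0%N) => U V [U0 _] _ VS [_ []] y /VS /= ->; exact: U0.
have {}IH : ranked_in (spanned s).
  by apply: IH => y s' sy; apply: hs; rewrite inE sy orbT.
have [sx|nsx] := pselect (spanned s x).
  apply: (ranked_in_sub _ IH) => _ /= [a [w [sw ->]]].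
  by case: (span_submodule s) => _; exact.
apply: (ranked_in_simple _ _ IH (hs _ _ (mem_head _ _) nsx)); exact: span_submodule.
Qed.

(* If R had infinite length, a minimal ideal I of infinite length would, by the
   extension R -> R multiplying by r, satisfy rI = I or rI = 0 for all r; then
   I is a vector space over the field R / ann I, and an infinite linearly
   independent sequence in I contradicts the descending chain condition. *)
Lemma artinian_ranked (R : comNzRingType) :
  artinian_module (R^o : lmodType R) -> ranked (R^o : lmodType R).
Proof.
move=> hR; apply: contrapT => nR.
have [|I [hI nI Imin]] := @artinian_min _ _ (fun U => ~ ranked_in U) hR.
  by exists setT.
have rankedV V : submodule V -> V `<=` I -> ~ I `<=` V -> ranked_in V.
  by move=> hV VI nIV; apply: contrapT => nV; apply: nIV; exact: Imin.
pose p := [set r : R | forall x : R^o, I x -> r *: x = 0].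
have IL : forall a x y, I x -> I y -> I (a *: x + y) by case: hI.
have mulL (r : R) : linear (fun x : R^o => r *: x : R^o).
  by move=> a x y; rewrite scalerDr !scalerA mulrC.
pose rI r : set R^o := [set y | exists2 x, I x & lin (mulL r) x = y].
have hrI r : submodule (rI r) by exact: image_submodule.
have rIP r : ~ p r -> I `<=` rI r.
  move=> npr; apply: contrapT => nIr; apply: nI.
  have rII : rI r `<=` I.
    by move=> _ [x Ix <-] /=; apply: submodule_scale.
  apply: (ranked_in_ext (g := lin (mulL r))) => //; first exact: (rankedV _ (hrI r) rII nIr).
  apply: rankedV => [|x []|h] //.
    by apply: setI_submodule => //; exact: kernel_submodule.
  by apply: npr => x Ix; have [_] := h x Ix.
have inv r : ~ p r -> exists s, p (1 - r * s).
  (* The ideals r^n R + p become stable, so r^n = r^(n+1) t + q with q in p; as r^n maps I onto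
     itself, t inverts r on I. *)
  move=> npr; pose U n : set R^o := [set y | exists t q, p q /\ y = r ^+ n * t + q].
  have [||n nP] := hR U.
  - move=> n; split; first by exists 0, 0; rewrite mulr0 addr0; split=> // x; rewrite scale0r.
    move=> a _ _ [t [q [pq ->]]] [t' [q' [pq' ->]]].
    exists (a * t + t'), (a * q + q'); split.
      by move=> x Ix; rewrite scalerDl -scalerA pq // pq' // scaler0 addr0.
    by rewrite -[a *: _]/(a * _) !mulrDr mulrCA addrACA.
  - move=> n _ [t [q [pq ->]]]; exists (r * t), q; split=> //.
    by rewrite exprSr mulrA.
  have : U n (r ^+ n) by exists 1, 0; rewrite mulr1 addr0; split=> // x; rewrite scale0r.
  rewrite -(nP n.+1) // => -[t [q [pq e]]]; exists t => x Ix.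
  have [y Iy <-] : exists2 y : R^o, I y & r ^+ n *: y = x.
    elim: n x Ix {nP e} => [|n IH] x Ix; first by exists x; rewrite ?scale1r.
    have [y Iy <-] := IH _ Ix; have [z Iz <-] := rIP _ npr y Iy.
    by exists z; rewrite //= exprSr scalerA.
  rewrite scalerA mulrBl mul1r {1}e exprS mulrAC addrAC subrr add0r.
  exact: pq.
have spanI (s : seq R^o) : {in s, forall x, I x} -> spanned s `<=` I.
  elim: s => [|x s IH] hs y /=; first by move=> ->; case: hI.
  move=> [a [w [sw ->]]]; apply: IL; first by apply: hs; rewrite mem_head.
  by apply: IH => // z sz; apply: hs; rewrite inE sz orbT.
have inspan (s : seq R^o) a x w : I x -> ~ p a -> spanned s (a *: x + w) -> spanned s w -> spanned s x.
  move=> Ix /inv[b pb] h sw.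
  have hs := span_submodule s.
  have -> : x = b *: (a *: x + w) - b *: w.
    rewrite scalerDr addrK scalerA mulrC; apply/eqP; rewrite -subr_eq0.
    by rewrite -[X in X - _]scale1r -scalerBl pb.
  by apply: submodule_sub => //; exact: submodule_scale.
have notspan (s : seq R^o) : {in s, forall x, I x} -> exists x, I x /\ ~ spanned s x.
  move=> hs; apply: contrapT => /forallNP h; apply: nI.
  have -> : I = spanned s.
    apply/seteqP; split=> [x Ix|]; last exact: spanI.
    by apply: contrapT => nsx; apply: (h x).
  apply: span_ranked_in => x s' sx nsx; split.
    split; first by move=> y sy; exists 0, y; rewrite scale0r add0r.
    by move=> /(_ x) h'; apply/nsx/h'/span_mem/mem_head.
  move=> W hW sW Ws; have [Wx|nWx] := pselect (W x).
    right; apply/seteqP; split=> // _ [a [w [sw ->]]].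
    by case: (hW) => _; apply=> //; exact: sW.
  left; apply/seteqP; split=> // y Wy.
  have [a [w [sw yE]]] := Ws y Wy.
  have [pa|npa] := pselect (p a).
    by rewrite yE pa ?add0r //; exact: hs.
  exfalso; apply: nWx; have [b pb] := inv _ npa.
  have -> : x = b *: (y - w).
    rewrite yE addrK scalerA mulrC; apply/eqP; rewrite -subr_eq0.
    by rewrite -[X in X - _]scale1r -scalerBl pb //; exact: hs.
  by apply: submodule_scale => //; apply: submodule_sub => //; exact: sW.
pose T (n : nat) := {s : seq R^o | {in s, forall x, I x}}.
pose Q n (s t : T n) := exists x, [/\ I x, ~ spanned (sval s) x & sval t = x :: sval s].
have nilI : {in [::], forall x : R^o, I x} by [].
have [|f [f0 fQ]] := @dep_choice T Q (exist _ [::] nilI).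
  move=> n [s hs]; have [x [Ix nsx]] := notspan s hs.
  have hs' : {in x :: s, forall x, I x}.
    by move=> y; rewrite inE => /orP[/eqP->//|]; exact: hs.
  by exists (exist _ (x :: s) hs'), x.
have [x xP] := choice fQ.
(* [L n m] lists x_n, ..., x_(n+m-1), the last one first, and [V n] below is the span of all x_k
   with k >= n. By independence x_n does not lie in [V n.+1]. *)
pose fix L n m := if m is m'.+1 then x (n + m')%N :: L n m' else [::].
have fL n : sval (f n) = L 0%N n.
  by elim: n => [|n IH] /=; [rewrite f0|have [_ _ ->] := xP n; rewrite IH].
have Lcat k m : L 0%N (k + m)%N = L k m ++ L 0%N k.
  by elim: m => [|m IH]; rewrite ?addn0 // addnS /= IH.
have span_cat s t : spanned s `<=` spanned (s ++ t).
  elim: s => [|y s IH] z; first by move=> ->; case: (span_submodule t).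
  by move=> [a [w [sw ->]]]; exists a, w; split=> //; exact: IH.
have span_cat' s t : spanned t `<=` spanned (s ++ t).
  elim: s => [|y s IH] z // tz; exists 0, z; rewrite scale0r add0r.
  by split=> //; exact: IH.
have disj k m y : spanned (L 0%N k) y -> spanned (L k m) y -> y = 0.
  elim: m y => [|m IH] y //= sy [a [w [sw yE]]].
  have [Ix nsx _] := xP (k + m)%N.
  have [pa|npa] := pselect (p a).
    by apply: IH => //; rewrite yE pa // add0r.
  exfalso; apply: nsx; rewrite fL Lcat; apply: (inspan _ a _ w) => //.
  - by rewrite -yE; exact: span_cat'.
  - exact: span_cat.
pose V n : set R^o := [set y | exists m, spanned (L n m) y].
have Lmono n m m' : (m <= m')%N -> spanned (L n m) `<=` spanned (L n m').
  move=> /subnKC <-; elim: (m' - m)%N => [|j IH]; first by rewrite addn0.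
  by rewrite addnS => y /IH sy; exists 0, y; rewrite scale0r add0r.
have LS n m : spanned (L n.+1 m) `<=` spanned (L n m.+1).
  elim: m => [|m IH]; first by move=> y ->; case: (span_submodule (L n 1)).
  move=> _ [a [w [sw ->]]]; exists a, w; rewrite addSnnS.
  by split=> //; exact: IH.
have [||n nP] := hR V.
- move=> n; split; first by exists 0%N.
  move=> a y z [m ym] [m' zm]; exists (maxn m m').
  by case: (span_submodule (L n (maxn m m'))) => _; apply;
    [apply: Lmono ym|apply: Lmono zm]; lia.
- by move=> n y [m ym]; exists m.+1; exact: LS.
have [Ix nsx _] := xP n; apply: nsx.
have : V n (x n).
  by exists 1%N; exists 1, 0; rewrite addn0 scale1r addr0.
rewrite -(nP n.+1) // => -[m /(disj n.+1) ->]; first by case: (span_submodule (sval (f n))).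
by exists 1, 0; rewrite scale1r addr0; split=> //; case: (span_submodule (L 0%N n)).
Qed.

Lemma linear_ext (A : pzRingType) (X Y : lmodType A) (f g : {linear X -> Y}) :
  f =1 g -> f = g.
Proof.
case: f g => [f cf] [g cg] /= /funext fg; move: cf cg; rewrite fg => cf cg.
by congr (GRing.Linear.Pack _); case: cf cg => [[a] [b]] [[c] [e]];
  rewrite (Prop_irrelevance a c) (Prop_irrelevance b e).
Qed.

(** A map with central image instead of an algebra structure, so that Lambda, its converse and R
    itself can all take the place of A. *)
Record central_map (R : comNzRingType) (A : pzRingType) := CentralMap {
  cmap :> R -> A;
  cmap1 : cmap 1 = 1;
  cmapD : {morph cmap : r s / r + s};
  cmapM : {morph cmap : r s / r * s};
  cmapC : forall r a, cmap r * a = a * cmap r }.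

Definition restr (R : comNzRingType) (A : pzRingType) (iota : central_map R A)
  (X : lmodType A) : Type := X.

Section Restriction.
Variables (R : comNzRingType) (A : pzRingType) (iota : central_map R A).
Variable X : lmodType A.

Notation restr := (restr iota X).
HB.instance Definition _ := GRing.Zmodule.copy restr X.

Definition restr_scale (r : R) (x : restr) : restr := iota r *: (x : X).
Lemma restr_scaleA r s v : restr_scale r (restr_scale s v) = restr_scale (r * s) v.
Proof. by rewrite /restr_scale scalerA cmapM. Qed.
Lemma restr_scale1 : left_id 1 restr_scale.
Proof. by move=> v; rewrite /restr_scale cmap1 scale1r. Qed.
Lemma restr_scaleDr : right_distributive restr_scale +%R.
Proof. by move=> r v w; rewrite /restr_scale scalerDr. Qed.
Lemma restr_scaleDl v : {morph restr_scale^~ v : a b / a + b}.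
Proof. by move=> r s; rewrite /restr_scale cmapD scalerDl. Qed.
HB.instance Definition _ := GRing.Zmodule_isLmodule.Build R restr
  restr_scaleA restr_scale1 restr_scaleDr restr_scaleDl.

Lemma restr_scaleE (r : R) (x : restr) : r *: x = iota r *: (x : X) :> X.
Proof. by []. Qed.

End Restriction.

(* An action of a ring B on Hom_A(X, Y); all Hom groups below (Hom_R(X, E),
   Hom_A(P, A), Hom_A(X, Y) over R) become modules through one. *)
Record hom_action (A B : pzRingType) (X Y : lmodType A) := HomAction {
  hact :> B -> {linear X -> Y} -> {linear X -> Y};
  hactM : forall a b f x, hact a (hact b f) x = hact (a * b) f x;
  hact1 : forall f x, hact 1 f x = f x;
  hactDr : forall a (f g h : {linear X -> Y}), (forall x, h x = f x + g x) ->
    forall x, hact a h x = hact a f x + hact a g x;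
  hactDl : forall a b f x, hact (a + b) f x = hact a f x + hact b f x }.

Definition hom_mod (A B : pzRingType) (X Y : lmodType A)
  (t : hom_action B X Y) : Type := {linear X -> Y}.

Section HomModule.
Variables (A B : pzRingType) (X Y : lmodType A) (t : hom_action B X Y).

Notation hom_mod := (hom_mod t).
HB.instance Definition _ := gen_eqMixin hom_mod.
HB.instance Definition _ := gen_choiceMixin hom_mod.

Definition hom_add (f g : hom_mod) : hom_mod := f \+ g.
Definition hom_opp (f : hom_mod) : hom_mod := \- f.
Definition hom_zero : hom_mod := \0.
Lemma hom_addA : associative hom_add.
Proof. by move=> f g h; apply: linear_ext => x /=; rewrite addrA. Qed.
Lemma hom_addC : commutative hom_add.
Proof. by move=> f g; apply: linear_ext => x /=; rewrite addrC. Qed.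
Lemma hom_add0 : left_id hom_zero hom_add.
Proof. by move=> f; apply: linear_ext => x /=; rewrite add0r. Qed.
Lemma hom_addN : left_inverse hom_zero hom_opp hom_add.
Proof. by move=> f; apply: linear_ext => x /=; rewrite addNr. Qed.
HB.instance Definition _ :=
  GRing.isZmodule.Build hom_mod hom_addA hom_addC hom_add0 hom_addN.

Definition hom_scale (b : B) (f : hom_mod) : hom_mod := t b f.
Lemma hom_scaleA a b v : hom_scale a (hom_scale b v) = hom_scale (a * b) v.
Proof. by apply: linear_ext => x; rewrite /hom_scale hactM. Qed.
Lemma hom_scale1 : left_id 1 hom_scale.
Proof. by move=> f; apply: linear_ext => x; rewrite /hom_scale hact1. Qed.
Lemma hom_scaleDr : right_distributive hom_scale +%R.
Proof. by move=> b f g; apply: linear_ext => x; exact: hactDr. Qed.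
Lemma hom_scaleDl v : {morph hom_scale^~ v : a b / a + b}.
Proof. by move=> a b; apply: linear_ext => x; exact: hactDl. Qed.
HB.instance Definition _ := GRing.Zmodule_isLmodule.Build B hom_mod
  hom_scaleA hom_scale1 hom_scaleDr hom_scaleDl.

Lemma hom_addE (f g : hom_mod) x : (f + g) x = f x + g x. Proof. by []. Qed.
Lemma hom_scaleE b (f : hom_mod) x : (b *: f) x = t b f x. Proof. by []. Qed.
Lemma hom_zeroE x : (0 : hom_mod) x = 0. Proof. by []. Qed.
End HomModule.


(** The quotient by a maximal proper submodule is simple. The induction runs on the rank of the
    whole module, which drops when the rank is transported to K. *)
Lemma ranked_ind (A : pzRingType) (P : lmodType A -> Prop) :
  (forall X, zero_module X -> P X) ->
  (forall (K X S : lmodType A) (i : {linear K -> X}) (p : {linear X -> S}),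
     injective i -> onto p -> exact_at i p -> simple_module S -> P K -> P X) ->
  forall X, ranked X -> P X.
Proof.
move=> P0 PS X [rho h]; move: {2}(rho setT) (leqnn (rho setT)) => n.
elim: n X rho h => [|n IH] X rho h le_n.
  apply: P0 => x; apply: contrapT => nx.
  have : (rho [set (0%R : X)] < rho setT)%N.
    apply: h => //; first exact: submodule0.
    by split=> // h0; apply: nx; exact: h0.
  by rewrite ltnNge (leq_trans le_n).
have [X0|nX0] := pselect (zero_module X); first exact: P0.
have [||U [hU nU Umax]] := @ranked_max _ X (fun U => U `<` setT).
- by exists rho.
- exists [set 0]; first exact: submodule0.
  by split=> // h0; apply: nX0 => x; exact: h0.
have [K [i [iI iP]]] := submodule_type hU.
have [S [p [pO pP]]] := quotient_type hU.
apply: (PS K X S i p) => //; first by move=> y; rewrite pP.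
  split=> [S0|W hW].
    by case: nU => _; apply=> x _; apply/pP; exact: S0.
  have hpW := preimage_submodule p hW.
  have [pWT|npWT] := pselect (setT `<=` [set x | W (p x)]).
    by right; apply/seteqP; split=> // s _; have [x <-] := pO s; exact: pWT.
  left; apply/seteqP; split=> [s Ws|s ->]; last by case: hW.
  have [x xs] := pO s; rewrite -xs; apply/pP.
  apply: (Umax _ hpW) => [||/=]; rewrite ?xs //.
  by move=> y /pP /= ->; case: hW.
apply: (IH K (fun W => rho [set y | exists2 x, W x & i x = y])).
  move=> V W hV hW _ [VW nWV]; apply: h => //; try exact: image_submodule.
  split=> [_ [x Vx <-]|WV]; first by exists x => //; exact: VW.
  by apply: nWV => x Wx; have [|x' Vx' /iI <-] := WV (i x); first by exists x.
rewrite -ltnS; apply: leq_trans le_n; apply: h => //; first exact: image_submodule.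
case: nU => _ nU; split=> // h0; apply: nU => x xT.
by have [y _ <-] := h0 x xT; apply/iP; exists y.
Qed.

(** Schur's lemma. *)
Lemma simple_map_bij (A : pzRingType) (S T : lmodType A) (f : {linear S -> T}) :
  simple_module S -> simple_module T -> (exists x, f x <> 0) -> bijective f.
Proof.
move=> [_ hS] [_ hT] [x fx]; apply: onto_inj_bij.
  have [im0|imT] := hT _ (image_submodule f (submoduleT S)).
    by exfalso; apply: fx; have : [set (0 : T)] (f x) by rewrite -im0; exists x.
  move=> y; have [z _ zy] : [set y | exists2 x, setT x & f x = y] y by rewrite imT.
  by exists z.
apply: linear_inj => y fy0.
have [k0|kT] := hS _ (kernel_submodule f).
  by have : [set (0 : S)] y by rewrite -k0.
by exfalso; apply: fx; have : [set x | f x = 0] x by rewrite kT.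
Qed.

(** * The standard injective module as an injective cogenerator *)

Section StandardInjective.
Variables (R : comNzRingType) (E : lmodType R).
Hypothesis hE : standard_injective E.

Lemma standard_injective_module : injective_module E.
Proof. by have [S [j [_ []]]] := hE. Qed.

(** By essentiality a map from S to E lands in the sum of simples, and there in the one summand
    isomorphic to S, because no isomorphism class is repeated. As S is cyclic over a commutative
    ring, two maps into this summand, the second nonzero, differ by a scalar. *)
Lemma simple_to_standard (S : lmodType R) (f f0 : {linear S -> E}) :
  simple_module S -> (exists x, f0 x <> 0) ->
  exists r, forall x, f x = r *: f0 x.
Proof.
move=> hS [x0 nx0]; have [nS0 hSs] := hS.
have [Sum [j [[n [T [inj [pr [hT Tinj _ [prK _ sumE]]]]]] [_ jI ess]]]] := hE.
have factor (g : {linear S -> E}) : exists g' : {linear S -> Sum}, forall x, j (g' x) = g x.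
  apply: injective_lift => // x.
  have [gx0|gx] := pselect (g x = 0); first by exists 0; rewrite linear0.
  pose U := [set x | [set z | exists s, j s = z] (g x)].
  have hU : submodule U.
    apply: (@preimage_submodule _ _ _ g); split; first by exists 0; rewrite linear0.
    by move=> a _ _ [s <-] [t <-]; exists (a *: s + t); rewrite linearP.
  have [U0|UT] := hSs U hU; last by have : U x by rewrite UT.
  exfalso; apply: gx.
  have : [set y | exists2 x, setT x & g x = y] = [set 0].
    apply: ess; first exact/image_submodule/submoduleT.
    move=> s [y _ gy]; have : [set (0 : S)] y by rewrite -U0; exists s.
    by move=> /= y0; rewrite -gy y0 linear0.
  by move=> e; have : [set (0 : E)] (g x) by rewrite -e; exists x.
have [g gE] := factor f; have [g0 g0E] := factor f0.
have [i ni] : exists i, pr i (g0 x0) <> 0.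
  apply: contrapT => /forallNP h; apply: nx0; rewrite -g0E (sumE (g0 x0)).
  by rewrite big1 ?linear0 // => i _; have /contrapT -> := h i; rewrite linear0.
have b0 : bijective (pr i \o g0 : {linear S -> T i}).
  by apply: simple_map_bij => //; exists x0.
have only_i (g' : {linear S -> Sum}) x : g' x = inj i (pr i (g' x)).
  rewrite {1}(sumE (g' x)) (bigD1 i) //= big1 ?addr0 // => k ki.
  have [->|nk] := pselect (pr k (g' x) = 0); first by rewrite linear0.
  exfalso; move/eqP: ki; apply; apply: Tinj.
  have bk : bijective (pr k \o g' : {linear S -> T k}).
    by apply: simple_map_bij => //; exists x.
  have [u [uK Ku]] := bij_inverse bk.
  exists ((pr i \o g0) \o u : {linear _ -> _}).
  by apply: bij_comp => //; exists (pr k \o g').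
have cyc y : exists r, y = r *: x0.
  pose U := [set y | exists r, y = r *: x0].
  have hU : submodule U.
    split; first by exists 0; rewrite scale0r.
    by move=> a _ _ [r ->] [s ->]; exists (a * r + s); rewrite scalerDl scalerA.
  have [U0|UT] := hSs U hU; last by have : U y by rewrite UT.
  exfalso; apply: nx0.
  have /= -> : [set (0 : S)] x0 by rewrite -U0; exists 1; rewrite scale1r.
  by rewrite linear0.
have [y yP] := bij_onto b0 (pr i (g x0)).
have [r rE] := cyc y; exists r => x; have [s ->] := cyc x.
pose q : {linear T i -> E} := j \o inj i.
have fE : f x0 = q (pr i (g x0)) by rewrite /q /= -only_i gE.
have f0E : f0 x0 = q (pr i (g0 x0)) by rewrite /q /= -only_i g0E.
have e : pr i (g x0) = r *: pr i (g0 x0).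
  by rewrite -yP rE; exact: (linearZ_LR (pr i \o g0 : {linear S -> T i})).
have {}e : f x0 = r *: f0 x0 by rewrite fE e f0E; exact: (linearZ_LR q).
by rewrite (linearZ_LR f) (linearZ_LR f0) e !scalerA mulrC.
Qed.

Hypothesis hR : ranked (R^o : lmodType R).

(** The cyclic module R v has a simple quotient, given by a maximal ideal containing the annihilator
    of v. This quotient embeds in E, and the resulting map R v -> E, nonzero at v, extends to V. *)
Lemma cogenerator (V : lmodType R) (v : V) : v <> 0 ->
  exists f : {linear V -> E}, f v <> 0.
Proof.
move=> nv; have cL : linear (fun r : R^o => (r : R) *: v).
  by move=> a r s; rewrite scalerDl scalerA.
have [C [e [m [eO mI mP]]]] := image_type (lin cL).
have [|U [hU [kU nU] Umax]] := @ranked_max _ _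
    (fun U : set R^o => (forall r, e r = 0 -> U r) /\ ~ U 1) hR.
  exists [set r | e r = 0]; first exact: kernel_submodule.
  split=> // /= e1; apply: nv; have /= := mP 1.
  by rewrite e1 linear0 scale1r.
have [Q [q [qO qP]]] := quotient_type hU.
have hQ : simple_module Q.
  split; first by move=> Q0; apply/nU/qP; exact: Q0.
  move=> W hW; have hqW := preimage_submodule q hW.
  have [W1|nW1] := pselect (W (q 1)).
    right; apply/seteqP; split=> // z _; have [r <-] := qO z.
    have -> : q r = r *: q 1 by rewrite -(linearZ_LR q); congr (q _); exact: (esym (mulr1 r)).
    exact: submodule_scale.
  left; apply/seteqP; split=> [s Ws|s ->]; last by case: hW.
  have [x xs] := qO s; rewrite -xs; apply/qP.
  apply: (Umax _ hqW); rewrite /= ?xs //.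
    by split=> // r /kU /qP ->; case: hW.
  by move=> y /qP /= ->; case: hW.
have [Sum [j [[n [T [inj [pr [hT _ Tall [prK _ _]]]]]] [_ jI _]]]] := hE.
have [i [f fB]] := Tall Q hQ.
have [c cP] : exists c : {linear C -> Q}, forall r, c (e r) = q r.
  by apply: onto_factor => // r /kU /qP.
have [k kP] := standard_injective_module (j \o inj i \o f \o c : {linear C -> E}) mI.
exists k; have -> : v = m (e 1) by rewrite mP /= scale1r.
rewrite kP /= cP => /eqP; rewrite -(linear0 j) => /eqP /jI /(congr1 (pr i)).
rewrite prK linear0 => /(injective_eq0 (bij_inj fB)) /qP; exact: nU.
Qed.

End StandardInjective.

(** * Duality *)

Section ScalarAction.
Variables (R : comNzRingType) (A : pzRingType) (iota : central_map R A).
Variables X Y : lmodType A.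

Lemma scalar_linear r (f : {linear X -> Y}) : linear (fun x => iota r *: f x).
Proof.
by move=> a x y; rewrite linearP scalerDr !scalerA cmapC.
Qed.

Definition scalar_action : hom_action R X Y.
Proof.
apply: (@HomAction A R X Y (fun r f => lin (scalar_linear r f))) => /=.
- by move=> r s f x; rewrite scalerA cmapM.
- by move=> f x; rewrite cmap1 scale1r.
- by move=> r f g h hE x; rewrite hE scalerDr.
- by move=> r s f x; rewrite cmapD scalerDl.
Defined.

Lemma scalar_actionE r f x : scalar_action r f x = iota r *: f x.
Proof. by []. Qed.

End ScalarAction.

Definition id_central (R : comNzRingType) : central_map R R.
Proof. by apply: (@CentralMap R R id) => // r a; rewrite mulrC. Defined.

Notation homR iota X Y := (hom_mod (scalar_action iota X Y)).

Section HomMaps.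
Variables (R : comNzRingType) (A : pzRingType) (iota : central_map R A).

Lemma precomp_linear (X Y Z : lmodType A) (f : {linear X -> Y}) :
  linear (fun h : homR iota Y Z => (h \o f : {linear X -> Z}) : homR iota X Z).
Proof. by move=> r h k; apply: linear_ext. Qed.

Definition precomp X Y Z f := lin (@precomp_linear X Y Z f).

Lemma postcomp_linear (X Y Z : lmodType A) (f : {linear Y -> Z}) :
  linear (fun h : homR iota X Y => (f \o h : {linear X -> Z}) : homR iota X Z).
Proof. by move=> r h k; apply: linear_ext => x; exact: linearP. Qed.

Definition postcomp X Y Z f := lin (@postcomp_linear X Y Z f).

End HomMaps.

Section Reflexivity.
Variables (R : comNzRingType) (E : lmodType R).
Hypothesis hE : standard_injective E.
Hypothesis hR : ranked (R^o : lmodType R).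

Definition dualR (V : lmodType R) : lmodType R := homR (id_central R) V E.

(** The dual of S is generated by one functional f0, so F is determined by F(f0). The rule r x0 |->
    r F(f0) defines a map S -> E, which is c f0 for some scalar c, and F is evaluation at c x0. *)
Lemma simple_reflexive (S : lmodType R) : simple_module S ->
  (forall F : {linear dualR S -> E}, exists s, forall f : dualR S, F f = f s) /\
  ranked (dualR S).
Proof.
move=> hS; have [nS0 _] := hS.
have [x0 nx0] : exists x : S, x <> 0.
  by apply: contrapT => /forallNP h; apply: nS0 => x; apply: contrapT => /h.
have [f0 f0x] := cogenerator hE hR nx0.
have mult (f : {linear S -> E}) := @simple_to_standard _ _ hE S f f0 hS (ex_intro _ x0 f0x).
split; last first.
  have cL : linear (fun r : R^o => (r : R) *: (f0 : dualR S)).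
    by move=> a r s; rewrite scalerDl scalerA.
  apply: (ranked_onto (p := lin cL)) hR => f; have [r rE] := mult f.
  by exists r; apply: linear_ext => x; rewrite rE.
move=> F.
have c1L : linear (fun r : R^o => (r : R) *: x0).
  by move=> a r s; rewrite scalerDl scalerA.
have c2L : linear (fun r : R^o => (r : R) *: F (f0 : dualR S)).
  by move=> a r s; rewrite scalerDl scalerA.
have c1O : onto (lin c1L).
  move=> y; have [_ hSs] := hS.
  have [U0|UT] := hSs _ (image_submodule (lin c1L) (submoduleT _)).
    exfalso; apply: nx0; have : [set (0 : S)] x0; last by [].
    by rewrite -U0; exists 1; rewrite //= scale1r.
  by have [r _ <-] : [set y | exists2 x, setT x & lin c1L x = y] y by [rewrite UT]; exists r.
have [|g gE] := onto_factor (f := lin c2L) c1O.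
  move=> r /= rx; rewrite -(linearZ_LR F).
  suff -> : (r : R) *: (f0 : dualR S) = 0 by rewrite linear0.
  apply: linear_ext => y; have [s <-] := c1O y.
  rewrite hom_scaleE scalar_actionE /= -(linearZ_LR f0) /= scalerA mulrC.
  by rewrite -scalerA rx scaler0 linear0.
have [r rE] := mult g; exists (r *: x0) => f; have [s sE] := mult f.
have -> : f = s *: (f0 : dualR S) by apply: linear_ext => x; rewrite sE.
have -> : F (s *: (f0 : dualR S)) = s *: F (f0 : dualR S) by rewrite (linearZ_LR F).
rewrite hom_scaleE scalar_actionE /=; congr (_ *: _).
by have := gE 1; rewrite /= !scale1r => <-; rewrite rE (linearZ_LR f0).
Qed.

(** Induction along 0 -> K -> X -> S -> 0: x is chosen to be right on the functionals coming from S;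
    the error F(f) - f(x) then depends only on f restricted to K, where it is evaluation at some
    k. *)
Lemma dual_reflexive (V : lmodType R) : ranked V ->
  (forall F : {linear dualR V -> E}, exists v, forall f : dualR V, F f = f v) /\
  ranked (dualR V).
Proof.
move: V; apply: ranked_ind => [V V0|K X S i p iI pO ip hS [Krefl Krk]].
  have D0 (f : dualR V) : f = 0.
    by apply: linear_ext => v; rewrite (V0 v) linear0 hom_zeroE.
  split=> [F|]; last exact: ranked_zero.
  by exists 0 => f; rewrite (linear0 (f : {linear V -> E})) (D0 f) (linear0 F).
have [Srefl Srk] := simple_reflexive hS.
pose pD := precomp (id_central R) E p; pose iD := precomp (id_central R) E i.
have ex : exact_at pD iD.
  move=> f; split=> [fi0|[h <-]]; last first.
    apply: linear_ext => k /=.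
    by have -> : p (i k) = 0 by [apply/ip; exists k]; rewrite linear0.
  have [|h hE'] := onto_factor (f := f) pO.
    by move=> x /ip[k <-]; exact: (congr1 (fun h : dualR K => h k) fi0).
  by exists h; apply: linear_ext => x; exact: hE'.
split; last exact: ranked_ext ex Srk Krk.
move=> F; have [s sE] := Srefl (F \o pD); have [x xs] := pO s.
have evL : linear (fun f : dualR X => F f - f x).
  move=> a f g; rewrite linearP hom_addE hom_scaleE scalar_actionE.
  by rewrite scalerBr opprD addrACA.
have iO : onto iD.
  move=> f; have [h hE'] := standard_injective_module hE f iI.
  by exists h; apply: linear_ext => k; exact: hE'.
have [|G GE] := onto_factor (f := lin evL) iO.
  by move=> f /ex[h <-] /=; have /= -> := sE h; rewrite -xs subrr.
have [k kE] := Krefl G; exists (x + i k) => f.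
have := GE f; rewrite kE /= => e.
by rewrite linearD e addrC subrK.
Qed.

End Reflexivity.

Section RestrictionOfScalars.
Variables (R : comNzRingType) (A : pzRingType) (iota : central_map R A).
Implicit Types X Y : lmodType A.

Lemma restr_linear X Y (f : {linear X -> Y}) :
  linear (f : restr iota X -> restr iota Y).
Proof. by move=> r x y; rewrite restr_scaleE linearP. Qed.
Definition restr_map X Y f := lin (@restr_linear X Y f).

Lemma ranked_of_restr X : ranked (restr iota X) -> ranked X.
Proof.
move=> [rho h]; exists rho => U V hU hV; apply: h.
- by case: hU => U0 UL; split=> // r x y; exact: UL.
- by case: hV => V0 VL; split=> // r x y; exact: VL.
Qed.

Hypothesis hA : ranked (restr iota A^o).

Lemma ranked_restr_free n : ranked (restr iota 'rV[A]_n).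
Proof.
elim: n => [|n IH].
  by apply: ranked_zero => v; apply/matrixP => i [].
pose inc (v : 'rV[A]_n) : 'rV[A]_n.+1 := \row_j (oapp (v ord0) 0 (unlift ord0 j)).
have incL : linear (inc : ('rV[A]_n : lmodType A) -> ('rV[A]_n.+1 : lmodType A)).
  move=> a v w; apply/rowP => j; rewrite !mxE.
  by case: unliftP => [k _|_] /=; rewrite ?mxE // mulr0 addr0.
have hdL : linear ((fun v => v ord0 ord0) : ('rV[A]_n.+1 : lmodType A) -> A^o).
  by move=> a v w; rewrite !mxE.
apply: (ranked_ext (i := restr_map (lin incL)) (p := restr_map (lin hdL))) IH hA.
move=> v; split=> [/= v0|[w <-]]; last by rewrite /= mxE unlift_none.
exists (\row_j v ord0 (lift ord0 j)); apply/rowP => j; rewrite mxE.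
by case: unliftP => [k ->|->] /=; rewrite ?mxE ?v0.
Qed.

Lemma ranked_restr X : ranked X -> ranked (restr iota X).
Proof.
move=> /ranked_finitely_generated/free_onto[n [s sO]].
apply: (ranked_onto (p := restr_map (lin (combination_linear s)))); first exact: sO.
exact: ranked_restr_free.
Qed.

Lemma ranked_ring : ranked (A^o : lmodType A).
Proof. exact: ranked_of_restr. Qed.

(** The maps vanishing on the first few generators filter the Hom group; evaluation at the next
    generator embeds each successive quotient in Y. *)
Lemma ranked_homR X Y : ranked X -> ranked Y -> ranked (homR iota X Y).
Proof.
move=> /ranked_finitely_generated[s hs] hY.
pose W (t : seq X) : set (homR iota X Y) := [set f | {in t, forall x, f x = 0}].
have hW t : submodule (W t).
  split=> // r f g fW gW x tx; rewrite hom_addE hom_scaleE scalar_actionE.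
  by rewrite fW // gW // scaler0 addr0.
have evL x : linear (fun f : homR iota X Y => f x : restr iota Y) by [].
have base : ranked_in (W s).
  exists (fun=> 0%N) => U V [U0 _] _ VW [_ []] f /VW fs.
  have -> : f = 0; last exact: U0.
  apply: linear_ext => x; elim: s x {hs VW} (hs x) fs => [|y s IH] x /=.
    by move=> -> _; rewrite linear0.
  move=> [a [w [sw ->]]] fs; rewrite linearP fs ?mem_head // scaler0 add0r.
  by rewrite (IH w sw) // => z sz; apply: fs; rewrite inE sz orbT.
suff : ranked_in (W [::]) by apply: ranked_in_sub.
elim: s {hs} base => // x s IH base; apply: IH.
apply: (ranked_in_ext (g := lin (evL x))) => //.
  apply: ranked_in_sub (ranked_restr hY) => //.
apply: ranked_in_sub base => f [fs fx] y; rewrite inE => /orP[/eqP ->//|]; exact: fs.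
Qed.

End RestrictionOfScalars.

(** Keeping the anti-isomorphism as data allows it to be reversed by [opp_sym], so that one
    construction gives both directions of the duality. *)
Record opp_iso (B A : pzRingType) := OppIso {
  oop :> B -> A;
  oinv : A -> B;
  oopK : cancel oop oinv;
  oinvK : cancel oinv oop;
  oop1 : oop 1 = 1;
  oopD : {morph oop : a b / a + b};
  oopM : forall a b, oop (a * b) = oop b * oop a }.

Definition opp_sym (B A : pzRingType) (op : opp_iso B A) : opp_iso A B.
Proof.
apply: (@OppIso A B (oinv op) op) => [a|b||a b|a b]; rewrite ?oopK ?oinvK //;
  by apply: (can_inj (oopK op)); rewrite ?oopD ?oopM ?oinvK ?oop1.
Defined.

Section DualAction.
Variables (R : comNzRingType) (E : lmodType R) (A B : pzRingType).
Variables (iotaA : central_map R A) (op : opp_iso B A) (X : lmodType A).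

Lemma dual_linear (b : B) (f : {linear restr iotaA X -> E}) :
  linear (fun x : restr iotaA X => f (op b *: (x : X) : X)).
Proof.
move=> r x y; rewrite -linearP restr_scaleE.
by congr (f _); rewrite scalerDr restr_scaleE !scalerA cmapC.
Qed.

Definition dual_action : hom_action B (restr iotaA X) E.
Proof.
apply: (@HomAction R B _ _ (fun b f => lin (dual_linear b f))) => /=.
- by move=> a b f x; rewrite scalerA -oopM.
- by move=> f x; rewrite oop1 scale1r.
- by move=> b f g h hE x; rewrite hE.
- move=> a b f x; rewrite oopD scalerDl.
  exact: (linearD f (op a *: (x : X) : restr iotaA X) (op b *: (x : X) : restr iotaA X)).
Defined.

Definition dual : lmodType B := hom_mod dual_action.

Lemma dual_scaleE (b : B) (f : dual) (x : X) : (b *: f) x = f (op b *: x).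
Proof. by []. Qed.

Lemma dual_is_dual : is_dual E iotaA op X dual.
Proof.
exists (fun (f : dual) (x : X) => f x); split=> //.
- by move=> f r x y; exact: (linearP f r (x : restr iotaA X) y).
- by move=> f g; exact: (@linear_ext R (restr iotaA X) E f g).
by move=> f fL; exists (lin (fL : linear (f : restr iotaA X -> E))).
Qed.

End DualAction.

Section Duality.
Variables (R : comNzRingType) (E : lmodType R).
Hypothesis hE : standard_injective E.
Hypothesis hR : ranked (R^o : lmodType R).
Variables (A B : pzRingType) (iotaA : central_map R A) (iotaB : central_map R B).
Variable op : opp_iso B A.
Hypothesis iotaAB : forall r, op (iotaB r) = iotaA r.
Hypothesis hA : ranked (restr iotaA A^o).

Notation D := (dual E iotaA op).
Notation D' := (dual E iotaB (opp_sym op)).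
Implicit Types X Y Z : lmodType A.

Lemma dual_map_linear X Y (f : {linear X -> Y}) :
  linear (fun h : D Y => (h \o restr_map iotaA f : {linear restr iotaA X -> E}) : D X).
Proof.
move=> b h k; apply: linear_ext => x.
exact: (congr1 (fun z : Y => h z + k (f x) : E) (esym (linearZ_LR f (op b) x))).
Qed.

Definition dual_map X Y (f : {linear X -> Y}) : {linear D Y -> D X} :=
  lin (dual_map_linear f).

Lemma dual_mapE X Y (f : {linear X -> Y}) (h : D Y) x : dual_map f h x = h (f x).
Proof. by []. Qed.

Lemma dual_onto X Y (f : {linear X -> Y}) : injective f -> onto (dual_map f).
Proof.
move=> fI h; have [k kE] := standard_injective_module hE (g := restr_map iotaA f) h fI.
by exists k; exact: linear_ext.
Qed.

Lemma dual_inj X Y (f : {linear X -> Y}) : onto f -> injective (dual_map f).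
Proof.
move=> fO; apply: linear_inj => h h0; apply: linear_ext => y.
by have [x <-] := fO y; exact: (congr1 (fun k : D X => k x) h0).
Qed.

Lemma dual_exact X Y Z (f : {linear X -> Y}) (g : {linear Y -> Z}) :
  exact_at f g -> exact_at (dual_map g) (dual_map f).
Proof.
move=> fg h; split=> [h0|[k <-]]; last first.
  apply: linear_ext => x /=; have -> : g (f x) = 0 by apply/fg; exists x.
  exact: (linear0 k).
have [|k kE] := @injective_factor _ _ _ _ (restr_map iotaA g) h
    (standard_injective_module hE).
  by move=> y /fg[x <-]; exact: (congr1 (fun k : D X => k x) h0).
by exists k; exact: linear_ext.
Qed.

(** A B-submodule of D X is in particular an R-submodule, so the rank of the R-dual serves. *)
Lemma dual_ranked X : ranked X -> ranked (D X).
Proof.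
move=> /(ranked_restr hA)/(dual_reflexive hE hR)[_ [rho h]].
exists rho => U V hU hV; apply: h.
- case: hU => U0 UL; split=> // r f g Uf Ug.
  have -> : r *: f + g = (iotaB r *: (f : D X) + (g : D X) : D X).
    apply: linear_ext => x; rewrite !hom_addE dual_scaleE iotaAB hom_scaleE /=.
    by rewrite -linearZ_LR.
  exact: UL.
- case: hV => V0 VL; split=> // r f g Vf Vg.
  have -> : r *: f + g = (iotaB r *: (f : D X) + (g : D X) : D X).
    apply: linear_ext => x; rewrite !hom_addE dual_scaleE iotaAB hom_scaleE /=.
    by rewrite -linearZ_LR.
  exact: VL.
Qed.

Lemma dual_scalar X r (f : D X) x : (iotaB r *: f) x = r *: (f x : E).
Proof.
rewrite dual_scaleE iotaAB.
exact: (linearZ_LR (f : {linear restr iotaA X -> E}) r (x : restr iotaA X)).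
Qed.

Lemma eval_linear1 X (x : X) : linear (fun f : restr iotaB (D X) => f x).
Proof.
move=> r f g; exact: (congr1 (fun z : E => z + g x) (dual_scalar r f x)).
Qed.

Lemma eval_linear X : linear (fun x : X => lin (eval_linear1 x) : D' (D X)).
Proof.
move=> a x y; apply: linear_ext => f.
transitivity (f (a *: x) + f y : E).
  exact: (linearD (f : {linear restr iotaA X -> E}) (a *: x : restr iotaA X)).
by congr (_ + _); rewrite -{1}[a](oinvK op).
Qed.

Definition eval X : {linear X -> D' (D X)} := lin (@eval_linear X).

Lemma dual_separates X (x : X) : (forall f : D X, f x = 0) -> x = 0.
Proof.
move=> h; apply: contrapT => nx.
by have [f fx] := cogenerator hE hR (V := restr iotaA X) nx; apply: fx; exact: h.
Qed.

Lemma eval_inj X : injective (eval X).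
Proof.
apply: linear_inj => x ex0; apply: dual_separates => f.
exact: (congr1 (fun F : D' (D X) => F f) ex0).
Qed.

Lemma eval_bij X : ranked X -> bijective (eval X).
Proof.
move=> hX; apply: onto_inj_bij; last exact: eval_inj.
move=> F; have [refl _] := dual_reflexive hE hR (ranked_restr hA hX).
have FL : linear (F : dualR E (restr iotaA X) -> E).
  move=> r f g; rewrite -(linearP F r (f : restr iotaB (D X)) g); congr (F _).
  apply: linear_ext => x.
  exact: (congr1 (fun z : E => z + g x) (esym (dual_scalar r f x))).
have [x xE] := refl (lin FL); exists x; apply: linear_ext => f; exact/esym/xE.
Qed.

Lemma flip_linear1 X (Y : lmodType B) (h : {linear X -> D' Y}) (y : Y) :
  linear (fun x : restr iotaA X => (h x : D' Y) y).
Proof.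
move=> r x x'; rewrite restr_scaleE linearP.
have e : oinv op (iotaA r) = iotaB r by rewrite -iotaAB oopK.
have := linearZ_LR (h x : {linear restr iotaB Y -> E}) r (y : restr iotaB Y).
by rewrite restr_scaleE -e => /(congr1 (fun z : E => z + h x' y)).
Qed.

Lemma flip_linear X (Y : lmodType B) (h : {linear X -> D' Y}) :
  linear (fun y : Y => lin (flip_linear1 h y) : D X).
Proof.
move=> b y y'; apply: linear_ext => x.
transitivity (h x (b *: y) + h x y' : E).
  exact: (linearD (h x : {linear restr iotaB Y -> E}) (b *: y : restr iotaB Y)).
have := linearZ_LR h (op b) x => /(congr1 (fun k : D' Y => k y + h x y' : E)).
by rewrite dual_scaleE /= oopK => <-.
Qed.

(** The adjunction Hom_A(X, D' Y) = Hom_B(Y, D X): both sides are readings of one pairing of X and Y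
    with values in E. [flip_back] goes the other way. *)
Definition flip X (Y : lmodType B) (h : {linear X -> D' Y}) : {linear Y -> D X} :=
  lin (flip_linear h).

Lemma flipE X (Y : lmodType B) (h : {linear X -> D' Y}) y x :
  (flip h y : D X) x = (h x : D' Y) y.
Proof. by []. Qed.

End Duality.

Section DualityMore.
Variables (R : comNzRingType) (E : lmodType R).
Hypothesis hE : standard_injective E.
Hypothesis hR : ranked (R^o : lmodType R).
Variables (A B : pzRingType) (iotaA : central_map R A) (iotaB : central_map R B).
Variable op : opp_iso B A.
Hypothesis iotaAB : forall r, op (iotaB r) = iotaA r.
Hypothesis hA : ranked (restr iotaA A^o).

Notation D := (dual E iotaA op).
Notation D' := (dual E iotaB (opp_sym op)).
Implicit Types X Y Z : lmodType A.

Lemma iotaBA r : opp_sym op (iotaA r) = iotaB r.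
Proof. by rewrite /= -iotaAB oopK. Qed.

Lemma flip_back X (Y : lmodType B) (k : {linear Y -> D X}) :
  exists h : {linear X -> D' Y}, forall x y, (h x : D' Y) y = (k y : D X) x.
Proof.
have kL1 x : linear (fun y : restr iotaB Y => (k y : D X) x).
  move=> r y y'; rewrite restr_scaleE linearP.
  exact: (congr1 (fun z : E => z + k y' x) (dual_scalar iotaAB r (k y) x)).
have kL : linear (fun x : X => lin (kL1 x) : D' Y).
  move=> a x x'; apply: linear_ext => y.
  transitivity (k y (a *: x) + k y x' : E).
    exact: (linearD (k y : {linear restr iotaA X -> E}) (a *: x : restr iotaA X)).
  have := linearZ_LR k (oinv op a) y => /(congr1 (fun h : D X => h x + k y x' : E)).
  by rewrite dual_scaleE oinvK => <-.
by exists (lin kL).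
Qed.

(** Extending f along g amounts, after flipping, to lifting a map from the projective module Q along
    the surjection D g. *)
Lemma dual_injective (Q : lmodType B) : projective_module Q -> injective_module (D' Q).
Proof.
move=> hQ X Y g f gI.
have [k kE] := hQ _ _ (dual_map E iotaA op g) (flip iotaAB f) (dual_onto hE gI).
have [h hE'] := flip_back k; exists h => x; apply: linear_ext => q.
by rewrite hE' -dual_mapE kE flipE.
Qed.

(** Flipped back, y is a map from Y to the double dual of X, which is X by reflexivity. *)
Lemma dual_full X Y (y : {linear D X -> D Y}) : ranked X ->
  exists z : {linear Y -> X}, forall (f : D X) w, (y f : D Y) w = f (z w).
Proof.
move=> hX; have [h hE'] := flip_back y.
have [e [eK Ke]] := bij_inverse (eval_bij hE hR iotaAB hA hX).
exists (e \o h) => f w /=; rewrite -hE' -[in LHS](Ke (h w)) //.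
Qed.

Lemma dual_bij X Y (f : {linear X -> Y}) :
  bijective f <-> bijective (dual_map E iotaA op f).
Proof.
split=> fB.
  apply: onto_inj_bij; first exact/(dual_onto hE)/bij_inj.
  exact/dual_inj/bij_onto.
apply: onto_inj_bij.
  move=> y; have [C [c [cO cf]]] := cokernel_type f.
  apply/cf; apply: (dual_separates hE hR (iotaA := iotaA) (op := op)) => k.
  have k0 : dual_map E iotaA op f (dual_map E iotaA op c k) = 0.
    apply: linear_ext => x /=.
    by have -> : c (f x) = 0 by [apply/cf; exists x]; rewrite (linear0 k).
  have := injective_eq0 (bij_inj fB) k0.
  exact: (congr1 (fun k : D Y => k y)).
apply: linear_inj => x fx0; apply: (dual_separates hE hR (iotaA := iotaA) (op := op)) => k.
have [h <-] := bij_onto fB k.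
by rewrite dual_mapE fx0; exact: (linear0 (h : {linear restr iotaA Y -> E})).
Qed.

End DualityMore.

(** * The A-dual of projective modules and the Nakayama functor *)

Section Star.
Variables (A B : pzRingType) (op : opp_iso B A).
Implicit Types P X : lmodType A.

Lemma star_linear P (b : B) (f : {linear P -> A^o}) :
  linear (fun x => f x * op b : A^o).
Proof. by move=> a x y; rewrite linearP mulrDl -mulrA. Qed.

Definition star_action P : hom_action B P A^o.
Proof.
apply: (@HomAction A B P A^o (fun b f => lin (star_linear b f))) => /=.
- by move=> a b f x; rewrite oopM mulrA.
- by move=> f x; rewrite oop1 mulr1.
- by move=> b f g h hE x; rewrite hE mulrDl.
- by move=> a b f x; rewrite oopD mulrDr.
Defined.

Definition star P : lmodType B := hom_mod (star_action P).

Lemma star_scaleE P (b : B) (f : star P) x : (b *: f) x = f x * op b :> A.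
Proof. by []. Qed.

Lemma star_is_star P : is_star op (fun f : star P => (f : {linear P -> A^o})).
Proof.
split=> //; first by move=> f g; exact: (@linear_ext A P A^o f g).
by move=> f; exists f.
Qed.

Lemma star_map_linear P P' (p : {linear P -> P'}) :
  linear (fun f : star P' => (f \o p : {linear P -> A^o}) : star P).
Proof. by move=> b f g; apply: linear_ext. Qed.

Definition star_map P P' p := lin (@star_map_linear P P' p).

Lemma pure_linear P X (z : {linear P -> A^o}) (x : X) :
  linear (fun p => (z p : A) *: x).
Proof. by move=> a p q; rewrite linearP scalerDl scalerA. Qed.

(** The map attached to the tensor of z and x. For P finitely generated projective these maps span
    Hom(P, X), which thereby takes the place of the tensor product of [star op P] and X. *)
Definition pure P X (z : {linear P -> A^o}) (x : X) : {linear P -> X} :=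
  lin (pure_linear z x).

Lemma dual_basis P : projective_module P -> finitely_generated P ->
  exists n (s : 'I_n -> P) (xi : 'I_n -> {linear P -> A^o}),
    forall x, x = \sum_i (xi i x : A) *: s i.
Proof.
move=> hP /free_onto[n [s sO]].
have [h hE] := hP _ _ (lin (combination_linear s)) idfun sO.
have cL i : linear (fun x : P => h x ord0 i : A^o).
  by move=> a x y; rewrite linearP !mxE.
by exists n, s, (fun i => lin (cL i)) => x; rewrite -[LHS]hE.
Qed.

End Star.

Section Represents.
Variables (R : comNzRingType) (E : lmodType R) (A : pzRingType).
Variable iota : central_map R A.

(* The module J represents the functor X |-> Hom_R(Hom_A(P, X), E), with
   universal functional w; so J is the value at P of the Nakayama functor. *)
Definition represents (P J : lmodType A) (w : {linear homR iota P J -> E}) : Prop :=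
  (forall (X : lmodType A) (F : {linear homR iota P X -> E}),
     exists a : {linear X -> J}, forall h : {linear P -> X}, F h = w (a \o h)) /\
  (forall (X : lmodType A) (a : {linear X -> J}),
     (forall h : {linear P -> X}, w (a \o h) = 0) -> forall x, a x = 0).
End Represents.

Section Nakayama.
Variables (R : comNzRingType) (E : lmodType R).
Hypothesis hE : standard_injective E.
Hypothesis hR : ranked (R^o : lmodType R).
Variables (A B : pzRingType) (iotaA : central_map R A) (iotaB : central_map R B).
Variable op : opp_iso B A.
Hypothesis iotaAB : forall r, op (iotaB r) = iotaA r.
Hypothesis hA : ranked (restr iotaA A^o).

Notation D' := (dual E iotaB (opp_sym op)).
Implicit Types P X : lmodType A.

Lemma ranked_opp : ranked (restr iotaB B^o).
Proof.
have opL : linear ((fun b => op b) : restr iotaB B^o -> restr iotaA A^o).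
  move=> r b c; rewrite !restr_scaleE oopD.
  by congr (_ + _); rewrite -[LHS]/(op (iotaB r * b)) oopM iotaAB -cmapC.
by apply: (ranked_inj (i := lin opL)) => //; exact: (can_inj (oopK op)).
Qed.

Definition nakayama P : lmodType A := D' (star op P).

Lemma ranked_star P : ranked P -> ranked (star op P).
Proof.
move=> hP.
have [rho h] := ranked_homR hA hP (ranked_ring hA).
have sc r (f : star op P) (g : star op P) :
    r *: (f : homR iotaA P A^o) + g = (iotaB r *: f + g : star op P).
  apply: linear_ext => x.
  exact: (congr1 (fun z : A => z + g x) (etrans (cmapC iotaA r (f x)) (congr1 (fun b => f x * b) (esym (iotaAB r))))).
exists rho => U V hU hV; apply: h.
- by case: hU => U0 UL; split=> // r f g Uf Ug; rewrite sc; exact: UL.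
- by case: hV => V0 VL; split=> // r f g Vf Vg; rewrite sc; exact: VL.
Qed.

Lemma ranked_nakayama P : ranked P -> ranked (nakayama P).
Proof.
move=> hP; apply: (dual_ranked hE hR (iotaA := iotaB) (iotaB := iotaA)).
- by move=> r; rewrite /= -iotaAB oopK.
- exact: ranked_opp.
exact: ranked_star.
Qed.

Notation J P := (nakayama P).

Lemma pureDr P X (z : star op P) a (x y : X) :
  (pure z (a *: x + y) : homR iotaA P X) =
  (pure (oinv op a *: z : star op P) x : homR iotaA P X) + pure z y.
Proof.
apply: linear_ext => p; rewrite hom_addE /= scalerDr; congr (_ + _).
by rewrite scalerA -[a in LHS](oinvK op).
Qed.

Lemma pureDl P X r (z z' : restr iotaB (star op P)) (x : X) :
  (pure (r *: z + z' : restr iotaB (star op P)) x : homR iotaA P X) =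
  r *: (pure z x : homR iotaA P X) + pure z' x.
Proof.
apply: linear_ext => p; rewrite hom_addE hom_scaleE scalar_actionE /=.
transitivity ((z p * op (iotaB r) + z' p : A) *: x); first by [].
by rewrite scalerDl iotaAB -(cmapC iotaA r (z p)) -scalerA.
Qed.

Lemma dual_basis_expand P X n (s : 'I_n -> P) (xi : 'I_n -> {linear P -> A^o})
    (u : {linear P -> X}) : (forall x, x = \sum_i (xi i x : A) *: s i) ->
  (u : homR iotaA P X) = \sum_i (pure (xi i) (u (s i)) : homR iotaA P X).
Proof.
move=> sE; apply: linear_ext => x; rewrite {1}(sE x) linear_sum.
elim/big_ind2: _ => [|u1 v1 u2 v2 -> ->|i _]; first by rewrite hom_zeroE.
  by rewrite hom_addE.
by rewrite linearZ_LR.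
Qed.

Lemma star_basis_expand P n (s : 'I_n -> P) (xi : 'I_n -> {linear P -> A^o})
    (z : star op P) : (forall x, x = \sum_i (xi i x : A) *: s i) ->
  z = \sum_i oinv op (z (s i) : A) *: (xi i : star op P).
Proof.
move=> sE; apply: linear_ext => x; rewrite {1}(sE x) linear_sum.
transitivity (\sum_i (oinv op (z (s i) : A) *: (xi i : star op P)) x : A^o).
  by apply: eq_bigr => i _; rewrite linearZ_LR star_scaleE oinvK.
elim/big_ind2: _ => [|u1 v1 u2 v2 -> ->|//]; first by rewrite hom_zeroE.
by rewrite hom_addE.
Qed.

Lemma nakayama_scalar P r (a b : J P) (z : star op P) :
  (iotaA r *: a + b : J P) z = r *: (a z : E) + b z.
Proof.
have BA r' : opp_sym op (iotaA r') = iotaB r' by rewrite /= -iotaAB oopK.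
by rewrite hom_addE (@dual_scalar R E B A iotaB iotaA (opp_sym op) BA).
Qed.

Section Functional.
Variables (P : lmodType A) (n : nat) (s : 'I_n -> P) (xi : 'I_n -> {linear P -> A^o}).
Hypothesis sE : forall x, x = \sum_i (xi i x : A) *: s i.

(** The sum is the evaluation pairing of [star op P] with its dual, read on Hom(P, J P) by means of
    the dual basis. Its value on [pure z a] is a(z), so it does not depend on the basis. *)
Lemma nakayama_functional_linear :
  linear (fun t : homR iotaA P (J P) => \sum_i (t (s i) : J P) (xi i)).
Proof.
move=> r t u; rewrite scaler_sumr -big_split; apply: eq_bigr => i _.
exact: nakayama_scalar.
Qed.

Definition nakayama_functional := lin nakayama_functional_linear.

Lemma nakayama_functional_pure (z : star op P) (a : J P) :
  nakayama_functional (pure z a) = a z.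
Proof.
rewrite [in RHS](star_basis_expand z sE).
rewrite (linear_sum (a : {linear restr iotaB (star op P) -> E})).
by apply: eq_bigr.
Qed.

End Functional.

Section FunctionalMap.
Variables (P X : lmodType A) (F : {linear homR iotaA P X -> E}).

Lemma functional_map_linear1 x : linear (fun z : restr iotaB (star op P) => F (pure z x)).
Proof. by move=> r z z'; rewrite pureDl linearP. Qed.

Lemma functional_map_linear : linear (fun x : X => lin (functional_map_linear1 x) : J P).
Proof.
move=> a x y; apply: linear_ext => z.
transitivity (F (pure z (a *: x + y))); first by [].
by rewrite pureDr linearD.
Qed.

Definition functional_map : {linear X -> J P} := lin functional_map_linear.

Lemma functional_mapE x (z : star op P) : (functional_map x : J P) z = F (pure z x).
Proof. by []. Qed.

End FunctionalMap.

(** A functional F on Hom(P, X) is known from the values F(pure z x), and x |-> (z |-> F(pure z x))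
    is a map from X to [nakayama P]. *)
Lemma nakayama_represents P : projective_module P -> finitely_generated P ->
  exists w : {linear homR iotaA P (nakayama P) -> E}, represents w /\
    forall (z : star op P) (a : nakayama P), w (pure z a) = a z.
Proof.
move=> hP fP; have [n [s [xi sE]]] := dual_basis hP fP.
exists (nakayama_functional s xi); split; last first.
  by move=> z a; exact: nakayama_functional_pure.
split=> X.
  move=> F; exists (functional_map F) => h.
  rewrite [in LHS](dual_basis_expand h sE) linear_sum.
  by apply: eq_bigr => i _; rewrite -functional_mapE.
move=> a a0 x; apply: linear_ext => z.
have := a0 (pure (z : {linear P -> A^o}) x).
have -> : (a \o pure (z : {linear P -> A^o}) x : {linear P -> _}) = pure z (a x).
  by apply: linear_ext => p /=; rewrite linearZ_LR.
by rewrite nakayama_functional_pure.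
Qed.

(** On the dual basis of P the map induced by p can be moved from t(s i) to the functional xi i. *)
Lemma nakayama_natural P P' (p : {linear P' -> P})
    (w : {linear homR iotaA P (nakayama P) -> E})
    (w' : {linear homR iotaA P' (nakayama P') -> E}) :
  projective_module P -> finitely_generated P ->
  (forall (z : star op P) (a : nakayama P), w (pure z a) = a z) ->
  (forall (z : star op P') (a : nakayama P'), w' (pure z a) = a z) ->
  forall t : {linear P -> nakayama P'},
    w (dual_map E iotaB (opp_sym op) (star_map op p) \o t) = w' (t \o p).
Proof.
move=> hP fP wP wP' t; have [n [s [xi sE]]] := dual_basis hP fP.
set N := dual_map _ _ _ _.
rewrite (dual_basis_expand (N \o t : {linear P -> _}) sE) linear_sum.
transitivity (\sum_i w' (pure (star_map op p (xi i)) (t (s i)))).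
  by apply: eq_bigr => i _; rewrite wP wP'.
rewrite -linear_sum; congr (w' _).
apply: linear_ext => x; rewrite /= (sE (p x)) linear_sum.
elim/big_ind2: _ => [|u1 v1 u2 v2 <- <-|i _]; first by rewrite hom_zeroE.
  by rewrite hom_addE.
by rewrite linearZ_LR.
Qed.

End Nakayama.

(** * Extensions *)

(* Complexes are indexed downwards, del i : C i.+1 -> C i; a projective
   resolution of X is augmented, i.e. its term of index 0 is X. *)
Definition augmented_resolution (A : pzRingType) (P : nat -> lmodType A)
    (del : forall i, {linear P i.+1 -> P i}) : Prop :=
  [/\ onto (del 0%N), forall i, exact_at (del i.+1) (del i)
    & forall i, projective_module (P i.+1)].

(* The degree k cohomology of Hom(P, Y) vanishes, for k > 0. *)
Definition vanishes_on (A : pzRingType) (P : nat -> lmodType A)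
    (del : forall i, {linear P i.+1 -> P i}) (k : nat) (Y : lmodType A) : Prop :=
  forall f : {linear P k.+1 -> Y}, (forall x, f (del k.+1 x) = 0) ->
    exists h : {linear P k -> Y}, forall x, f x = h (del k x).

(* J n -> J n.-1 -> ... -> J 0 is the beginning of an injective resolution of J n. *)
Definition coresolution (A : pzRingType) (n : nat) (J : nat -> lmodType A)
    (del : forall i, {linear J i.+1 -> J i}) : Prop :=
  [/\ forall i, (i < n)%N -> injective_module (J i),
      forall i, i.+1 = n -> injective (del i)
    & forall i, (i.+1 < n)%N -> exact_at (del i.+1) (del i)].

(** X is only isomorphic to [J n], which avoids transport along an equality of types in the family
    J. *)
Definition has_coresolutions (A : pzRingType) : Prop :=
  forall n (X : lmodType A), ranked X ->
  exists (J : nat -> lmodType A) (del : forall i, {linear J i.+1 -> J i})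
    (s : {linear X -> J n}),
  [/\ coresolution n del, bijective s & forall i, ranked (J i)].

Section Augment.
Variables (A : pzRingType) (X : lmodType A) (P : nat -> lmodType A).
Variables (del : forall i, {linear P i.+1 -> P i}) (eps : {linear P 0%N -> X}).

Definition augment (i : nat) : lmodType A := if i is j.+1 then P j else X.
Definition augment_del (i : nat) : {linear augment i.+1 -> augment i} :=
  match i with 0%N => eps | j.+1 => del j end.

Lemma augmentP : projective_resolution del eps -> augmented_resolution augment_del.
Proof.
move=> [hP hO h0 hS]; split=> // -[|i]; [exact: h0|exact: hS].
Qed.
End Augment.

Section ExactZero.
Variable A : pzRingType.
Implicit Types X Y Z : lmodType A.
Lemma exact_comp0 X Y Z (f : {linear X -> Y}) (g : {linear Y -> Z}) x :
  exact_at f g -> g (f x) = 0.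
Proof. by move=> fg; apply/fg; exists x. Qed.
End ExactZero.

Section Balance.
Variables (A : pzRingType) (P : nat -> lmodType A).
Variable dP : forall i, {linear P i.+1 -> P i}.
Hypothesis hP : augmented_resolution dP.
Variables (n : nat) (J : nat -> lmodType A) (dJ : forall i, {linear J i.+1 -> J i}).
Hypothesis hJ : coresolution n dJ.

(** A stage between the two computations of Ext: f amounts to a map from an iterated syzygy of [P 0]
    to an iterated cosyzygy of [J n], and it has to come from one map [P a -> J b.+2]. For a = 0
    this is Ext computed from J, and for n = b + 2 it is Ext computed from P. *)
Definition bicocycles (a b : nat) : Prop := forall f : {linear P a.+1 -> J b.+1},
  (forall x, f (dP a.+1 x) = 0) -> (forall x, dJ b (f x) = 0) ->
  exists h : {linear P a -> J b.+2}, forall x, f x = dJ b.+1 (h (dP a x)).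

(** One step of the zigzag through Hom(P, J): maps from the projective [P a.+1] lift along dJ, and
    maps to the injective [J b.+2] extend along dP. *)
Lemma bicocyclesS a b : (b.+3 <= n)%N -> bicocycles a.+1 b.+1 <-> bicocycles a b.
Proof.
have [Pon Pex Pproj] := hP; have [Jinj _ Jex] := hJ => bn; split=> H f fP fJ.
  have [g gE] : exists g : {linear P a.+1 -> J b.+2}, forall x, dJ b.+1 (g x) = f x.
    by apply: projective_factor => // x; apply/(Jex b); [lia|].
  have [||h hE] := H (g \o dP a.+1 : {linear _ -> _}).
  - by move=> x /=; rewrite (exact_comp0 _ (Pex _)) linear0.
  - by move=> x /=; rewrite gE fP.
  have [|k kE] := @injective_factor _ _ _ _ (dP a)
      (g \- (dJ b.+2 \o h) : {linear _ -> _}) (Jinj b.+2 bn).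
    by move=> x /(Pex a)[y <-] /=; rewrite -hE /= subrr.
  exists k => x; rewrite kE /= linearB gE.
  by rewrite (exact_comp0 _ (Jex b.+1 _)) ?subr0 //; lia.
have [|g gE] := @injective_factor _ _ _ _ (dP a.+1) f (Jinj b.+2 bn).
  by move=> x /(Pex a.+1)[y <-].
have [||h hE] := H (dJ b.+1 \o g : {linear _ -> _}).
- by move=> x /=; rewrite gE.
- by move=> x /=; rewrite (exact_comp0 _ (Jex b _)) //; lia.
have [k kE] : exists k : {linear P a.+1 -> J b.+3},
    forall x, dJ b.+2 (k x) = (g \- (h \o dP a) : {linear _ -> _}) x.
  apply: projective_factor => // x; apply/(Jex b.+1); first lia.
  by rewrite /= linearB -hE /= subrr.
by exists k => x; rewrite kE /= gE (exact_comp0 _ (Pex _)) linear0 subr0.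
Qed.

Lemma bicocyclesD a b k : ((b + k).+2 <= n)%N ->
  bicocycles (a + k) (b + k) <-> bicocycles a b.
Proof.
elim: k => [|k IH] h; first by rewrite !addn0.
by rewrite !addnS bicocyclesS ?IH //; lia.
Qed.

Lemma vanishes_bicocycles k b : n = b.+2 ->
  vanishes_on dP k.+1 (J b.+2) <-> bicocycles k.+1 b.
Proof.
have [Pon Pex Pproj] := hP; have [Jinj Jmono Jex] := hJ => nb; split=> H f fP.
  move=> fJ; have [g gE] : exists g : {linear P k.+2 -> J b.+2}, forall x, dJ b.+1 (g x) = f x.
    by apply: injective_lift => [|x]; [exact: Jmono|apply/(Jex b) => //; lia].
  have [|h hE] := H g.
    by move=> x; apply: (Jmono b.+1) => //; rewrite gE fP linear0.
  by exists h => x; rewrite -hE gE.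
have [||h hE] := H (dJ b.+1 \o f : {linear _ -> _}).
- by move=> x /=; rewrite fP linear0.
- by move=> x /=; rewrite (exact_comp0 _ (Jex b _)) //; lia.
by exists h => x; apply: (Jmono b.+1) => //; exact: hE.
Qed.

Lemma lifts_bicocycles b : (b.+2 <= n)%N ->
  (forall c : {linear P 0%N -> J b.+1}, (forall x, dJ b (c x) = 0) ->
    exists h : {linear P 0%N -> J b.+2}, forall x, c x = dJ b.+1 (h x)) <->
  bicocycles 0%N b.
Proof.
have [Pon Pex Pproj] := hP; have [Jinj Jmono Jex] := hJ => nb; split=> H f fP.
  move=> fJ; have [|c cE] := onto_factor (f := f) Pon.
    by move=> x /(Pex 0%N)[y <-].
  have [|h hE] := H c.
    by move=> x; have [y <-] := Pon x; rewrite cE.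
  by exists h => x; rewrite -hE cE.
have [||h hE] := H (f \o dP 0%N : {linear _ -> _}).
- by move=> x /=; rewrite (exact_comp0 _ (Pex 0%N)) linear0.
- by move=> x /=; rewrite fP.
by exists h => x; have [y <-] := Pon x; exact: hE.
Qed.

(* Ext may be computed by resolving either variable. *)
Lemma balance k b : n = (b + k).+3 ->
  vanishes_on dP k.+1 (J (b + k).+3) <->
  (forall c : {linear P 0%N -> J b.+1}, (forall x, dJ b (c x) = 0) ->
    exists h : {linear P 0%N -> J b.+2}, forall x, c x = dJ b.+1 (h x)).
Proof.
move=> nE; rewrite (@vanishes_bicocycles k (b + k).+1) // lifts_bicocycles; last by lia.
have := @bicocyclesD 0 b k.+1; rewrite add0n addnS; apply; lia.
Qed.

End Balance.

Section SecondVariable.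
Variables (A : pzRingType) (P : nat -> lmodType A).
Variable dP : forall i, {linear P i.+1 -> P i}.
Hypothesis hP : augmented_resolution dP.

(** The part Ext^(k+1)(X, Y) -> Ext^(k+2)(X, K) -> Ext^(k+2)(X, V) of the long exact sequence, for X
    = [P 0]. *)
Lemma vanishes_kernel (K V Y : lmodType A) (i : {linear K -> V}) (p : {linear V -> Y}) k :
  injective i -> onto p -> exact_at i p ->
  vanishes_on dP k.+1 Y -> vanishes_on dP k.+2 V -> vanishes_on dP k.+2 K.
Proof.
have [Pon Pex Pproj] := hP => iI pO ip hY hV f fP.
have [|h hE] := hV (i \o f : {linear _ -> _}).
  by move=> x /=; rewrite fP linear0.
have [|c cE] := hY (p \o h : {linear _ -> _}).
  by move=> x /=; rewrite -hE /= (exact_comp0 _ ip).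
have [c' c'E] := Pproj k _ _ p c pO.
have [g gE] : exists g : {linear P k.+2 -> K},
    forall x, i (g x) = (h \- (c' \o dP k.+1) : {linear _ -> _}) x.
  by apply: injective_lift => // x; apply/ip; rewrite /= linearB c'E -cE subrr.
exists g => x; apply: iI.
by rewrite gE /= -hE (exact_comp0 _ (Pex _)) linear0 subr0.
Qed.

Lemma vanishes_kernel1 (K V Y : lmodType A) (i : {linear K -> V}) (p : {linear V -> Y}) :
  injective i -> onto p -> exact_at i p ->
  (forall c : {linear P 0%N -> Y}, exists l : {linear P 0%N -> V}, forall x, p (l x) = c x) ->
  vanishes_on dP 1 V -> vanishes_on dP 1 K.
Proof.
have [Pon Pex Pproj] := hP => iI pO ip hY hV f fP.
have [|h hE] := hV (i \o f : {linear _ -> _}).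
  by move=> x /=; rewrite fP linear0.
have [|c cE] := onto_factor (f := (p \o h : {linear _ -> _})) Pon.
  by move=> x /(Pex 0%N)[y <-] /=; rewrite -hE /= (exact_comp0 _ ip).
have [l lE] := hY c.
have [g gE] : exists g : {linear P 1%N -> K},
    forall x, i (g x) = (h \- (l \o dP 0%N) : {linear _ -> _}) x.
  by apply: injective_lift => // x; apply/ip; rewrite /= linearB lE cE subrr.
exists g => x; apply: iI.
by rewrite gE /= -hE (exact_comp0 _ (Pex _)) linear0 subr0.
Qed.

End SecondVariable.

(* In an exact sequence C n.+1 -> ... -> C 0 whose terms have no higher
   extensions from X in degrees below n, maps from X lift. *)
Section HomExactRight.
Variables (A : pzRingType) (n : nat) (C : nat -> lmodType A).
Variable dC : forall i, {linear C i.+1 -> C i}.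
Hypothesis Cmono : injective (dC n).
Hypothesis Cex : forall i, (i < n)%N -> exact_at (dC i.+1) (dC i).
Variables (P : nat -> lmodType A) (dP : forall i, {linear P i.+1 -> P i}).
Hypothesis hP : augmented_resolution dP.
Hypothesis van : forall k j, (0 < k < n)%N -> (j <= n.+1)%N -> vanishes_on dP k (C j).

(** Induction on the distance to the left end. A lift g0 exists by projectivity; its defect g0 dP
    lifts by induction to a cocycle, which is a coboundary by [van] and is used to correct g0. The
    bound a <= j keeps the degree of that Ext below n. *)
Lemma cocycle_lift a j : (a <= j)%N -> (j < n)%N -> forall f : {linear P a.+1 -> C j.+1},
  (forall x, f (dP a.+1 x) = 0) -> (forall x, dC j (f x) = 0) ->
  exists g : {linear P a.+1 -> C j.+2},
    (forall x, f x = dC j.+1 (g x)) /\ forall x, g (dP a.+1 x) = 0.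
Proof.
have [Pon Pex Pproj] := hP.
move: {2}(n - j)%N (erefl (n - j)%N) => m; elim: m a j => [|m IH] a j mE aj jn f fP fC.
  by lia.
have [g0 g0E] : exists g : {linear P a.+1 -> C j.+2}, forall x, dC j.+1 (g x) = f x.
  by apply: projective_factor => // x; apply/(Cex jn).
have [jE|jn'] : j.+1 = n \/ (j.+1 < n)%N by lia.
  exists g0; split=> // x; have := Cmono; rewrite -jE => dI.
  by apply: dI; rewrite g0E fP linear0.
have [||||g1 [g1E g1P]] := IH a.+1 j.+1 _ _ jn' (g0 \o dP a.+1 : {linear _ -> _}).
- by lia.
- by lia.
- by move=> x /=; rewrite (exact_comp0 _ (Pex _)) linear0.
- by move=> x /=; rewrite g0E fP.
have [||h hE] := van (k := a.+1) (j := j.+3) _ _ g1P; try lia.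
exists (g0 \- (dC j.+2 \o h) : {linear _ -> _}); split=> x /=.
  by rewrite linearB g0E (exact_comp0 _ (Cex jn')) subr0.
by have /= -> := g1E x; rewrite -hE subrr.
Qed.

Lemma hom_exact_right j : (j < n)%N -> forall f : {linear P 0%N -> C j.+1},
  (forall x, dC j (f x) = 0) ->
  exists g : {linear P 0%N -> C j.+2}, forall x, dC j.+1 (g x) = f x.
Proof.
have [Pon Pex Pproj] := hP => jn f fC.
have [jE|jn'] : j.+1 = n \/ (j.+1 < n)%N by lia.
  have := Cmono; rewrite -jE => dI; apply: injective_lift => // x.
  by apply/(Cex jn).
have [g0 g0E] : exists g : {linear P 1%N -> C j.+2},
    forall x, dC j.+1 (g x) = (f \o dP 0%N : {linear _ -> _}) x.
  by apply: projective_factor => // x; apply/(Cex jn); exact: fC.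
have [|||g1 [g1E g1P]] := @cocycle_lift 1 j.+1 _ jn' (g0 \o dP 1%N : {linear _ -> _}).
- by [].
- by move=> x /=; rewrite (exact_comp0 _ (Pex _)) linear0.
- by move=> x /=; rewrite g0E /= (exact_comp0 _ (Pex _)) linear0.
have [||h hE] := van (k := 1) (j := j.+3) _ _ g1P; try lia.
have [|g gE] := onto_factor (f := (g0 \- (dC j.+2 \o h) : {linear _ -> _})) Pon.
  by move=> x /(Pex 0%N)[y <-] /=; have /= -> := g1E y; rewrite -hE subrr.
exists g => x; have [y <-] := Pon x.
by rewrite gE /= linearB g0E (exact_comp0 _ (Cex jn')) subr0.
Qed.

End HomExactRight.

Section HomExactLeft.
Variables (A : pzRingType) (n : nat) (C : nat -> lmodType A).
Variable dC : forall i, {linear C i.+1 -> C i}.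
Hypothesis Conto : onto (dC 0%N).
Hypothesis Cex : forall i, (i < n)%N -> exact_at (dC i.+1) (dC i).
Variables (J : nat -> lmodType A) (dJ : forall i, {linear J i.+1 -> J i}).
Hypothesis hJ : coresolution n.+1 dJ.
Hypothesis van : forall b j, (b.+2 <= n)%N -> (j <= n.+1)%N ->
  forall c : {linear C j -> J b.+1}, (forall x, dJ b (c x) = 0) ->
    exists h : {linear C j -> J b.+2}, forall x, c x = dJ b.+1 (h x).

(** The dual correction, by induction on j: an extension g0 exists by injectivity, its defect dJ g0
    extends one term further to the right as a cocycle, and this is a coboundary by [van]. Ext is
    measured here by the coresolution J of the target. *)
Lemma cocycle_extend j b : (j <= b)%N -> (b.+2 <= n)%N ->
  forall f : {linear C j.+1 -> J b.+1},
  (forall x, f (dC j.+1 x) = 0) -> (forall x, dJ b (f x) = 0) ->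
  exists g : {linear C j -> J b.+1},
    (forall x, f x = g (dC j x)) /\ forall x, dJ b (g x) = 0.
Proof.
have [Jinj Jmono Jex] := hJ; elim: j b => [|j IH] b jb bn f fC fJ.
  have [|g gE] := onto_factor (f := f) Conto.
    by move=> x /(Cex (i := 0%N))[|y <-] //; lia.
  by exists g; split=> // x; have [y <-] := Conto x; rewrite gE.
case: b jb bn f fC fJ => // b jb bn f fC fJ.
have [|g0 g0E] := @injective_factor _ _ _ _ (dC j.+1) f (Jinj b.+2 (leqW bn)).
  by move=> x /(Cex (i := j.+1))[|y <-] //; lia.
have [||||g1 [g1E g1J]] := IH b _ _ (dJ b.+1 \o g0 : {linear _ -> _}).
- by [].
- by lia.
- by move=> x /=; rewrite g0E fJ.
- by move=> x /=; rewrite (exact_comp0 _ (Jex b _)) //; lia.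
have [||h hE] := van (b := b) (j := j) _ _ g1J; try lia.
exists (g0 \- (h \o dC j) : {linear _ -> _}); split=> x /=.
  by rewrite g0E (exact_comp0 _ (Cex (i := j) _)) ?(linear0 h) ?subr0 //; lia.
by rewrite linearB; have /= -> := g1E x; rewrite hE subrr.
Qed.

Lemma hom_exact_left j : (j < n)%N -> forall f : {linear C j.+1 -> J n.+1},
  (forall x, f (dC j.+1 x) = 0) ->
  exists g : {linear C j -> J n.+1}, forall x, g (dC j x) = f x.
Proof.
have [Jinj Jmono Jex] := hJ; case: j => [|j] jn f fC.
  by apply: onto_factor => // x /(Cex jn)[y <-].
have [|g0 g0E] := @injective_factor _ _ _ _ (dC j.+1) (dJ n \o f : {linear _ -> _}) (Jinj n (ltnSn n)).
  by move=> x /(Cex jn)[y <-] /=; rewrite fC linear0.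
case: n Jinj Jmono Jex Cex van jn f fC g0 g0E (@cocycle_extend j)
  => // -[//|m] Jinj Jmono Jex Cex' van' jn f fC g0 g0E ext.
have [||||g1 [g1E g1J]] := ext m _ _ (dJ m.+1 \o g0 : {linear _ -> _}).
- by lia.
- by lia.
- by move=> x /=; rewrite g0E /= (exact_comp0 _ (Jex m.+1 _)) //; lia.
- by move=> x /=; rewrite (exact_comp0 _ (Jex m _)) //; lia.
have [||h hE] := van' m j _ _ g1 g1J; try lia.
have [g gE] : exists g : {linear C j.+1 -> J m.+3},
    forall x, dJ m.+2 (g x) = (g0 \- (h \o dC j) : {linear _ -> _}) x.
  apply: injective_lift => [|x]; first exact: Jmono.
  apply/(Jex m.+1); first lia.
  by rewrite /= linearB; have /= -> := g1E x; rewrite hE subrr.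
exists g => x; apply: (Jmono m.+2) => //.
by rewrite gE /= g0E /= (exact_comp0 _ (Cex' j _)) ?(linear0 h) ?subr0 //; lia.
Qed.

End HomExactLeft.

Section Representing.
Variables (R : comNzRingType) (E : lmodType R).
Hypothesis hE : standard_injective E.
Hypothesis hR : ranked (R^o : lmodType R).
Variables (A : pzRingType) (iota : central_map R A).
Hypothesis hA : ranked (restr iota A^o).
Implicit Types P X Y J : lmodType A.

(** Hom(P, g) is injective if g is, and E is injective, so the functor represented by J turns
    injections into surjections. *)
Lemma represents_injective P J (w : {linear homR iota P J -> E}) :
  represents w -> injective_module J.
Proof.
move=> [ex un] X Y g f gI.
have [|G GE] := @injective_factor _ _ _ _ (postcomp iota P g)
   (w \o postcomp iota P f : {linear _ -> _}) (standard_injective_module hE).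
  move=> h h0; have -> : h = 0; last exact: linear0.
  by apply: linear_ext => x; apply: (injective_eq0 gI); exact: (congr1 (fun k : homR iota P Y => k x) h0).
have [a aE] := ex Y G; exists a => x; apply/eqP; rewrite -subr_eq0; apply/eqP.
apply: (un X ((a \o g) \- f : {linear _ -> _})) => h.
transitivity (w ((a \o g) \o h : {linear P -> J}) - w (f \o h : {linear P -> J})).
  by rewrite -linearB; congr (w _); apply: linear_ext.
have -> : w ((a \o g) \o h : {linear P -> J}) = w (a \o (g \o h) : {linear P -> J}).
  by congr (w _); exact: linear_ext.
by rewrite -aE; apply/eqP; rewrite subr_eq0; apply/eqP; exact: (GE h).
Qed.

Lemma represents_map P P' J J' (w : {linear homR iota P J -> E})
    (w' : {linear homR iota P' J' -> E}) (p : {linear P' -> P}) :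
  represents w -> exists q : {linear J' -> J},
    forall t : {linear P -> J'}, w (q \o t) = w' (t \o p).
Proof.
move=> [ex _]; have [q qE] := ex J' (w' \o precomp iota J' p : {linear _ -> _}).
by exists q => t; rewrite -qE.
Qed.

Lemma represents_iso P J J' (w : {linear homR iota P J -> E})
    (s : {linear J' -> J}) : bijective s -> represents w ->
  represents (w \o postcomp iota P s : {linear homR iota P J' -> E}).
Proof.
move=> sB [ex un]; have [t [tK Kt]] := bij_inverse sB; split=> X.
  move=> F; have [a aE] := ex X F; exists (t \o a) => h.
  by rewrite aE /=; congr (w _); apply: linear_ext => x /=; rewrite Kt.
move=> a a0 x; apply: (injective_eq0 (bij_inj sB)).
apply: (un X (s \o a : {linear _ -> _})) => h.
by rewrite -[RHS](a0 h) /=; congr (w _); apply: linear_ext.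
Qed.

Lemma represents_faithful P P' J' (w' : {linear homR iota P' J' -> E})
    (u : {linear P' -> P}) : represents w' ->
  (forall t : {linear P -> J'}, w' (t \o u) = 0) -> forall x, u x = 0.
Proof.
move=> [ex _] h; suff -> : (u : homR iota P' P) = 0 by [].
apply: contrapT => nu; have [F Fu] := cogenerator hE hR nu.
by have [a aE] := ex P F; apply: Fu; rewrite aE h.
Qed.

(** Through w' the module Hom(P, J') is the dual of Hom(P', P). The functional t |-> w(q t) on it is
    therefore, by reflexivity, evaluation at some u. *)
Lemma represents_full P P' J J' (w : {linear homR iota P J -> E})
    (w' : {linear homR iota P' J' -> E}) (q : {linear J' -> J}) :
  ranked P -> ranked P' -> represents w' ->
  exists u : {linear P' -> P}, forall t : {linear P -> J'}, w (q \o t) = w' (t \o u).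
Proof.
move=> hP hP' [ex un].
have [refl _] := dual_reflexive hE hR (ranked_homR hA hP' hP).
have tL1 (t : homR iota P J') : linear (fun x : homR iota P' P => w' (t \o x)).
  by move=> r x y; rewrite -linearP; congr (w' _); apply: linear_ext => p; rewrite /= linearP.
have tL : linear (fun t => lin (tL1 t) : dualR E (homR iota P' P)).
  move=> r t s; apply: linear_ext => x.
  transitivity (w' (r *: (((t : {linear P -> J'}) \o x : {linear P' -> J'}) : homR iota P' J'))
    + w' ((s : {linear P -> J'}) \o x : {linear P' -> J'})); last first.
    by rewrite (linearZ_LR w').
  by rewrite -(linearD w'); congr (w' _); apply: linear_ext.
have tB : bijective (lin tL).
  apply: onto_inj_bij => [F|].
    have [a aE] := ex P F; exists a; apply: linear_ext => x; exact/esym/aE.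
  apply: linear_inj => t t0; apply: linear_ext; apply: un => x.
  exact: (congr1 (fun F : dualR E (homR iota P' P) => F x) t0).
have [v [vK Kv]] := bij_inverse tB.
have [u uE] := refl ((w \o postcomp iota P q) \o v : {linear _ -> _}).
by exists u => t; have := uE (lin tL t); rewrite [LHS]/= vK.
Qed.

Lemma regular_cogenerator J (w : {linear homR iota A^o J -> E}) X (x : X) :
  represents w -> x <> 0 -> exists a : {linear X -> J}, a x <> 0.
Proof.
move=> [ex _] nx; have [f fx] := cogenerator hE hR (V := restr iota X) nx.
have FL : linear (fun h : homR iota A^o X => f (h 1)).
  by move=> r h k; rewrite -linearP.
have [a aE] := ex X (lin FL); exists a => ax; apply: fx.
have hL : linear (fun c : A^o => (c : A) *: x) by move=> b c d; rewrite scalerDl scalerA.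
have := aE (lin hL); rewrite /= scale1r => ->.
suff -> : (a \o lin hL : homR iota A^o J) = 0 by rewrite linear0.
by apply: linear_ext => c /=; rewrite linearZ_LR ax scaler0.
Qed.

Variables (J0 : lmodType A) (w0 : {linear homR iota A^o J0 -> E}).
Hypothesis hw0 : represents w0.
Hypothesis hJ0 : ranked J0.

Lemma injective_prod X Y : injective_module X -> injective_module Y ->
  injective_module (X * Y)%type.
Proof.
move=> hX hY U V g f gI.
have [h1 h1E] := hX _ _ g (fst \o f : {linear _ -> _}) gI.
have [h2 h2E] := hY _ _ g (snd \o f : {linear _ -> _}) gI.
have hL : linear (fun v => (h1 v, h2 v)) by move=> a u v; rewrite !linearP.
by exists (lin hL) => x /=; rewrite h1E h2E /=; case: (f x).
Qed.

(** Among the maps to injectives of finite length take one with smallest kernel; a nonzero element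
    of the kernel would be detected by one more map, into J0. *)
Lemma injective_embedding X : ranked X ->
  exists (I : lmodType A) (i : {linear X -> I}),
    [/\ ranked I, injective_module I & injective i].
Proof.
move=> hX.
have [|U [_ [I [i [hI iI <-]]] Umin]] := @ranked_min _ _ (fun U => exists (I : lmodType A)
  (i : {linear X -> I}), [/\ ranked I, injective_module I & [set x | i x = 0] = U]) hX.
  exists setT => //; exists J0, \0; split=> //; last by apply/seteqP; split.
  exact: represents_injective hw0.
exists I, i; split=> //; apply: linear_inj => x ix0; apply: contrapT => nx.
have [a ax] := regular_cogenerator hw0 nx.
have bL : linear (fun x => (i x, a x)) by move=> b u v; rewrite !linearP.
apply: ax.
have kI : [set x | lin bL x = 0] `<=` [set x | i x = 0] by move=> y /= [].
have h : [set x | lin bL x = 0] x; last by have := congr1 snd h.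
apply: (Umin _ (kernel_submodule (lin bL)) _ kI x ix0).
exists (I * J0)%type, (lin bL); split=> //; first exact: ranked_prod.
by apply: injective_prod => //; exact: represents_injective hw0.
Qed.

Lemma coresolution_exists : has_coresolutions A.
Proof.
move=> n X hX; elim: n => [|n [J [del [s [[Jinj Jmono Jex] sB hJ]]]]].
  by exists (fun=> X), (fun=> \0), idfun; split=> //; exists idfun.
have [I [i [hI iI i0 iex]]] : exists (I : lmodType A) (i : {linear J 0%N -> I}),
    [/\ ranked I, injective_module I, n = 0%N -> injective i
      & (0 < n)%N -> exact_at (del 0%N) i].
  case: n {s Jinj Jmono Jex sB} => [|n].
    by have [I [i [hI II iI]]] := injective_embedding (hJ 0%N); exists I, i.
  have [C [c [cO cP]]] := cokernel_type (del 0%N).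
  have [I [i [hI II iI]]] := injective_embedding (ranked_onto cO (hJ 0%N)).
  exists I, (i \o c); split=> // _ y; rewrite -cP /=; split=> [|->]; last exact: linear0.
  exact: injective_eq0.
pose J' k := if k is k'.+1 then J k' else I.
pose del' k : {linear J' k.+1 -> J' k} := match k with 0%N => i | k'.+1 => del k' end.
exists J', del', s; split=> //; last by case.
split; first by case=> [//|k]; rewrite ltnS => /Jinj.
  by case=> [[/esym/i0]|k [kn]] //; exact: Jmono.
case=> [|k] kn; first exact: iex.
by apply: Jex; rewrite -ltnS.
Qed.

End Representing.

(** * Minimal projective resolutions and first facts on Ext *)

Lemma minimal_resolution_exists (A : pzRingType) (X : lmodType A) :
  ranked (A^o : lmodType A) -> ranked X ->
  exists (K P : nat -> lmodType A) (p : forall n, {linear P n -> K n})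
    (i : forall n, {linear K n.+1 -> P n}) (e : {linear X -> K 0%N}),
  [/\ bijective e, forall n, projective_cover (p n), forall n, ranked (P n)
    & forall n, injective (i n) /\ exact_at (i n) (p n)].
Proof.
move=> hA hX.
have cov (K : {K : lmodType A | ranked K}) :
    {P : lmodType A & {p : {linear P -> sval K} | ranked P /\ projective_cover p}}.
  have /cid[P /cid[p h]] := projective_cover_exists hA (svalP K).
  by exists P, p.
have ker (K : {K : lmodType A | ranked K}) : {S : {K : lmodType A | ranked K} &
    {i : {linear sval S -> projT1 (cov K)} |
      injective i /\ exact_at i (sval (projT2 (cov K)))}}.
  case: (cov K) => P [p [hP hp]] /=.
  have /cid[S /cid[i [iI ip]]] := kernel_type p.
  by exists (exist _ S (ranked_inj iI hP)), i.
pose K := fix K n := if n is m.+1 then projT1 (ker (K m)) else exist _ X hX.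
exists (fun n => sval (K n)), (fun n => projT1 (cov (K n))),
  (fun n => sval (projT2 (cov (K n)))), (fun n => sval (projT2 (ker (K n)))), idfun.
split; first by exists idfun.
- by move=> n; case: (svalP (projT2 (cov (K n)))).
- by move=> n; case: (svalP (projT2 (cov (K n)))).
- by move=> n; exact: (svalP (projT2 (ker (K n)))).
Qed.

Section MinimalResolution.
Variables (A : pzRingType) (X : lmodType A) (K P : nat -> lmodType A).
Variables (p : forall n, {linear P n -> K n}) (i : forall n, {linear K n.+1 -> P n}).
Variables (e : {linear X -> K 0%N}) (e' : {linear K 0%N -> X}).
Hypothesis eK : cancel e e'.
Hypothesis Ke : cancel e' e.
Hypothesis hp : forall n, projective_cover (p n).
Hypothesis hi : forall n, injective (i n) /\ exact_at (i n) (p n).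

Definition splice_del n : {linear P n.+1 -> P n} := i n \o p n.+1.
Definition splice_eps : {linear P 0%N -> X} := e' \o p 0%N.

Lemma splice_resolution : projective_resolution splice_del splice_eps.
Proof.
split; first by move=> n; case: (hp n).
- move=> x; have [_ pO _] := hp 0%N; have [y yx] := pO (e x).
  by exists y; rewrite /= yx eK.
- move=> y; have [_ ip] := hi 0%N; have [_ pO _] := hp 1%N.
  split=> [/(congr1 e)|[x <-]].
    rewrite /= Ke linear0 => /ip[k <-].
    by have [x <-] := pO k; exists x.
  by rewrite /= (exact_comp0 _ ip) linear0.
move=> n y; have [iI _] := hi n; have [_ ip] := hi n.+1; have [_ pO _] := hp n.+2.
split=> [/= h|[x <-]]; last by rewrite /= (exact_comp0 _ ip) linear0.
by have /ip[k <-] := injective_eq0 iI h; have [x <-] := pO k; exists x.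
Qed.

Lemma splice_superfluous n : superfluous_kernel (splice_del n).
Proof.
move=> U hU h; have [_ _ sup] := hp n.+1; have [iI _] := hi n; apply: sup => // x.
have [u [v [Uu /= v0 ->]]] := h x; exists u, v; split=> //.
exact: injective_eq0 iI v0.
Qed.

Lemma splice_nth_syzygy n : is_nth_syzygy n X (K n).
Proof.
elim: n => [|n IH]; first by exists e, e'.
exists (K n); split=> //; exists (P n), (p n), (i n).
by have [iI ip] := hi n; split.
Qed.

End MinimalResolution.

Section ExtTheory.
Variable A : pzRingType.
Implicit Types X Y K V : lmodType A.

Lemma Ext_vanishes_on k X Y (P : nat -> lmodType A)
    (del : forall i, {linear P i.+1 -> P i}) (eps : {linear P 0%N -> X}) :
  (0 < k)%N -> projective_resolution del eps -> Ext_vanishes k X Y ->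
  vanishes_on (augment_del del eps) k Y.
Proof. by case: k => // k _ hP h; exact: h hP. Qed.

Lemma vanishes_on_Ext k X Y : (0 < k)%N ->
  (forall (P : nat -> lmodType A) (del : forall i, {linear P i.+1 -> P i})
     (eps : {linear P 0%N -> X}), projective_resolution del eps ->
     vanishes_on (augment_del del eps) k Y) -> Ext_vanishes k X Y.
Proof. by case: k => // k _ h P del eps hP; exact: h hP. Qed.

Lemma vanishes_on_iso (P : nat -> lmodType A) (dP : forall i, {linear P i.+1 -> P i})
    k Y Y' (s : {linear Y -> Y'}) : bijective s ->
  vanishes_on dP k Y <-> vanishes_on dP k Y'.
Proof.
move=> /bij_inverse[t [tK Kt]]; split=> H f fP.
  have [|h hE] := H (t \o f : {linear _ -> _}).
    by move=> x /=; rewrite fP linear0.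
  by exists (s \o h) => x /=; rewrite -hE /= Kt.
have [|h hE] := H (s \o f : {linear _ -> _}).
  by move=> x /=; rewrite fP linear0.
by exists (t \o h) => x /=; rewrite -hE /= tK.
Qed.

Lemma Ext_injective k X Y : (0 < k)%N -> injective_module Y -> Ext_vanishes k X Y.
Proof.
move=> k0 hY; apply: vanishes_on_Ext => // P del eps /augmentP[_ Pex _] f fP.
have [|h hE] := @injective_factor _ _ _ _ (augment_del del eps k) f hY.
  by move=> x /(Pex k)[y <-].
by exists h.
Qed.

End ExtTheory.

(** * Cluster-tilting subcategories and minimal approximations *)

Section ClusterTilting.
Variables (A : pzRingType).
Hypothesis hA : ranked (A^o : lmodType A).
Hypothesis coresolutions : has_coresolutions A.
Variables (d : nat) (M : lmodType A -> Prop).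
Hypothesis d1 : (1 <= d)%N.
Hypothesis hM : cluster_tilting d M.
Implicit Types X Y K V N : lmodType A.

Lemma resolution_exists X : ranked X -> exists (P : nat -> lmodType A)
  (del : forall i, {linear P i.+1 -> P i}) (eps : {linear P 0%N -> X}),
  projective_resolution del eps.
Proof.
move=> hX; have [K [P [p [i [e [/bij_inverse[e' [eK Ke]] hp _ hi]]]]]] :=
  minimal_resolution_exists hA hX.
by exists P, (splice_del p i), (splice_eps p e'); exact: splice_resolution eK Ke hp hi.
Qed.

Lemma M_ranked X : M X -> ranked X.
Proof. by have [[fl _ _ _] _ _ _ _] := hM => /fl /finite_length_ranked. Qed.

Lemma M_retract X Y (i : {linear X -> Y}) (p : {linear Y -> X}) :
  (forall x, p (i x) = x) -> M Y -> M X.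
Proof. by have [[_ _ _ h] _ _ _ _] := hM => ip hY; exact: h hY ip. Qed.

Lemma M_iso X Y (s : {linear X -> Y}) : bijective s -> M X <-> M Y.
Proof.
move=> /bij_inverse[t [tK Kt]]; split=> h.
  exact: M_retract Kt h.
exact: M_retract tK h.
Qed.

Lemma M_prod X Y : M X -> M Y -> M (X * Y)%type.
Proof. by have [[_ _ h _] _ _ _ _] := hM; exact: h. Qed.

Lemma M_zero X : zero_module X -> M X.
Proof. by have [[_ h _ _] _ _ _ _] := hM; exact: h. Qed.

Lemma M_Ext X Y k : M X -> M Y -> (0 < k < d)%N -> Ext_vanishes k X Y.
Proof. by have [_ _ _ h _] := hM => /h[_ H] hY kd; exact: H. Qed.

Lemma M_injective Y : ranked Y -> injective_module Y -> M Y.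
Proof.
have [_ _ _ _ h] := hM => hY iY; apply/h; split; first exact: ranked_finite_length.
by move=> k X /andP[k0 _] _; exact: Ext_injective.
Qed.

(** Ext has to vanish on every resolution of X, not only on the trivial one. Balance replaces that
    resolution by a coresolution of Y, along which maps from the projective X lift; with length d +
    1, degree k + 1 is found at position d - k - 2. *)
Lemma M_projective X : ranked X -> projective_module X -> M X.
Proof.
have [_ _ _ h _] := hM => hX pX; apply/h; split; first exact: ranked_finite_length.
move=> [//|k] Y kd hY; apply: vanishes_on_Ext => // P del eps /augmentP hP.
have [J [dJ [s [hJ sB _]]]] := coresolutions d.+1 (M_ranked hY).
apply/(vanishes_on_iso _ _ sB).
have e : d.+1 = ((d - k.+2) + k).+3 by lia.
move: J dJ s hJ sB; rewrite e => J dJ s hJ sB.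
apply/(balance hP hJ (erefl _)) => c c0.
have [_ _ Jex] := hJ.
have [|c' c'E] := @projective_factor _ _ _ _ (dJ (d - k.+2).+1) c pX.
  by move=> x; apply/(Jex (d - k.+2)%N); [lia|exact: c0].
by exists c' => x; rewrite c'E.
Qed.

Lemma M_lifts X Y (J : nat -> lmodType A) (dJ : forall i, {linear J i.+1 -> J i})
    (s : {linear Y -> J d.+1}) b : M X -> M Y -> coresolution d.+1 dJ -> bijective s ->
  (b.+2 <= d)%N -> forall c : {linear X -> J b.+1}, (forall x, dJ b (c x) = 0) ->
  exists h : {linear X -> J b.+2}, forall x, c x = dJ b.+1 (h x).
Proof.
move=> hX hY hJ sB bd; have [P [del [eps hP]]] := resolution_exists (M_ranked hX).
have hP' := augmentP hP.
have e : d.+1 = (b + (d - b.+2)).+3 by lia.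
have v : vanishes_on (augment_del del eps) (d - b.+2).+1 (J (b + (d - b.+2)).+3).
  rewrite -e; apply/(vanishes_on_iso _ _ sB); apply: Ext_vanishes_on => //.
  by apply: M_Ext => //; lia.
exact/(balance hP' hJ e).
Qed.

Definition extM (j : nat) (Y : lmodType A) : Prop :=
  forall k X, (0 < k <= j)%N -> M X -> Ext_vanishes k X Y.

Lemma M_extM Y : ranked Y -> extM d.-1 Y -> M Y.
Proof.
have [_ _ _ _ h] := hM => hY eY; apply/h; split; first exact: ranked_finite_length.
by move=> k X kd; apply: eY; lia.
Qed.

(** Dimension shift: the kernel of an M-approximation gains one vanishing degree over its target.
    Degree one is the assumption that maps from M lift along p. *)
Lemma extM_kernel K V Y (i : {linear K -> V}) (p : {linear V -> Y}) j :
  injective i -> onto p -> exact_at i p -> M V ->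
  (forall X (c : {linear X -> Y}), M X ->
     exists l : {linear X -> V}, forall x, p (l x) = c x) ->
  extM j Y -> (j.+1 < d)%N -> extM j.+1 K.
Proof.
move=> iI pO ip hV pL eY jd [//|[|k]] X kj hX;
  apply: vanishes_on_Ext => // P del eps hP; have hP' := augmentP hP.
  apply: (vanishes_kernel1 hP' iI pO ip) => [c|]; first exact: pL.
  by apply: Ext_vanishes_on => //; apply: M_Ext => //; lia.
apply: (vanishes_kernel hP' iI pO ip).
  by apply: Ext_vanishes_on => //; apply: eY => //; lia.
by apply: Ext_vanishes_on => //; apply: M_Ext => //; lia.
Qed.

(** Surjectivity comes from A, which is projective and so lies in M: x is reached by lifting the map
    a |-> a x. *)
Lemma minimal_approximation X : ranked X ->
  exists V (f : {linear V -> X}), [/\ M V, onto f, right_minimal f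
    & forall (W : lmodType A) (g : {linear W -> X}), M W ->
        exists h : {linear W -> V}, forall x, f (h x) = g x].
Proof.
have [_ cf _ _ _] := hM => hX.
have [V [f [hV fP]]] := cf X (ranked_finite_length hX).
have [V' [i [r [ri fir fm]]]] := right_minimal_version f (M_ranked hV).
have fP' (W : lmodType A) (g : {linear W -> X}) : M W ->
    exists h : {linear W -> V'}, forall x, (f \o i) (h x) = g x.
  by move=> hW; have [h hE] := fP W g hW; exists (r \o h) => x /=; rewrite fir.
exists V', (f \o i); split=> //; first exact: M_retract ri hV.
move=> x.
have gL : linear (fun a : A^o => (a : A) *: x) by move=> a b c; rewrite scalerDl scalerA.
have [h hE] := fP' _ (lin gL) (M_projective hA (@regular_projective A)).
by exists (h 1); exact: etrans (hE 1) (scale1r x).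
Qed.

Definition exactM (C : nat -> lmodType A) (dC : forall i, {linear C i.+1 -> C i}) :
    Prop :=
  [/\ forall i, (i <= d.+1)%N -> M (C i), onto (dC 0%N),
      forall i, (i < d)%N -> exact_at (dC i.+1) (dC i) & injective (dC d)].

Section ExactM.
Variables (C : nat -> lmodType A) (dC : forall i, {linear C i.+1 -> C i}).
Hypothesis hC : exactM dC.

Lemma exactM_lift X j : M X -> (j < d)%N -> forall f : {linear X -> C j.+1},
  (forall x, dC j (f x) = 0) ->
  exists g : {linear X -> C j.+2}, forall x, dC j.+1 (g x) = f x.
Proof.
have [CM CO Cex Cmono] := hC => hX jd f f0.
have [P [del [eps hP]]] := resolution_exists (M_ranked hX).
have hP' := augmentP hP.
apply: (@hom_exact_right A d C dC Cmono Cex _ _ hP') => // k i kd id1.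
by apply: Ext_vanishes_on => //; [lia|apply: M_Ext => //; exact: CM].
Qed.

Lemma exactM_extend X j : M X -> (j < d)%N -> forall f : {linear C j.+1 -> X},
  (forall x, f (dC j.+1 x) = 0) ->
  exists g : {linear C j -> X}, forall x, g (dC j x) = f x.
Proof.
have [CM CO Cex Cmono] := hC => hX jd f f0.
have [J [dJ [s [hJ sB _]]]] := coresolutions d.+1 (M_ranked hX).
have [t [tK Kt]] := bij_inverse sB.
have [||g gE] := @hom_exact_left A d C dC CO Cex J dJ hJ _ j jd (s \o f : {linear _ -> _}).
- move=> b i bd id1 c c0; apply: (M_lifts _ hX hJ sB) => //; exact: CM.
- by move=> x /=; rewrite f0 linear0.
by exists (t \o g) => x /=; rewrite gE /= tK.
Qed.

End ExactM.
End ClusterTilting.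

(** * Chain maps and homotopies *)

Section ChainMaps.
Variables (A : pzRingType) (n : nat) (W C : nat -> lmodType A).
Variables (dW : forall i, {linear W i.+1 -> W i}) (dC : forall i, {linear C i.+1 -> C i}).

Definition chain_map (g : forall i, {linear W i -> C i}) : Prop :=
  forall i, (i <= n)%N -> forall z, dC i (g i.+1 z) = g i (dW i z).

Definition is_complex (X : nat -> lmodType A) (dX : forall i, {linear X i.+1 -> X i}) :
    Prop :=
  forall i, (i < n)%N -> forall z, dX i (dX i.+1 z) = 0.

Lemma chain_map_lift (g0 : {linear W 0%N -> C 0%N}) (g1 : {linear W 1%N -> C 1%N}) :
  is_complex dW -> (forall z, dC 0%N (g1 z) = g0 (dW 0%N z)) ->
  (forall i, (i < n)%N -> forall f : {linear W i.+2 -> C i.+1},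
     (forall z, dC i (f z) = 0) ->
     exists g : {linear W i.+2 -> C i.+2}, forall z, dC i.+1 (g z) = f z) ->
  exists g, [/\ chain_map g, g 0%N = g0 & g 1%N = g1].
Proof.
move=> cW g01 lifts.
pose T i := {linear W i.+1 -> C i.+1}.
(* The relation carries its own hypotheses, so that a choice exists at every stage, the zero map
   serving where they fail; [comm] shows by induction that they hold below n. *)
pose Q i (x : T i) (y : T i.+1) := (i < n)%N ->
  (forall z, dC i (x (dW i.+1 z)) = 0) -> forall z, dC i.+1 (y z) = x (dW i.+1 z).
have [i x|f [f0 fQ]] := @dep_choice T Q g1.
  have [[ltin h]|nh] := pselect ((i < n)%N /\ forall z, dC i (x (dW i.+1 z)) = 0).
    by have [y yE] := lifts i ltin (x \o dW i.+1 : {linear _ -> _}) h; exists y => _ _; exact: yE.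
  by exists \0 => a b; case: nh.
pose g i : {linear W i -> C i} := match i with 0%N => g0 | i.+1 => f i end.
have comm i : (i <= n)%N -> forall z, dC i (g i.+1 z) = g i (dW i z).
  elim: i => [|i IH] lin z /=; first by rewrite f0.
  apply: fQ => // {}z; have := IH (ltnW lin) (dW i.+1 z); rewrite /= => ->.
  by rewrite cW // linear0.
by exists g; split=> //=; rewrite f0.
Qed.

Lemma chain_map_extend (gn : {linear W n.+1 -> C n.+1}) :
  (forall i, (i <= n)%N -> injective_module (C i)) ->
  (forall z, dW n z = 0 -> dC n (gn z) = 0) ->
  (forall i, (i < n)%N -> exact_at (dW i.+1) (dW i)) -> is_complex dC ->
  exists g, chain_map g /\ g n.+1 = gn.
Proof.
move=> Cinj h0 Wex cC.
pose T i := {linear W i -> C i}.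
pose Q i (x : T i) (y : T i.+1) :=
  (forall z, dW i z = 0 -> dC i (y z) = 0) -> forall z, dC i (y z) = x (dW i z).
have [i y lin|f [fn fQ]] := @dep_choice_down T Q (fun i => \0) n.+1 gn.
  have [h|nh] := pselect (forall z, dW i z = 0 -> dC i (y z) = 0).
    have [x xE] := injective_factor (f := (dC i \o y : {linear _ -> _})) (Cinj i lin) h.
    by exists x => _ z; rewrite xE.
  by exists \0 => a; case: nh.
have comm m i : (i + m)%N = n -> forall z, dC i (f i.+1 z) = f i (dW i z).
  elim: m i => [|m IH] i iE; (apply: fQ; first by lia).
    have e : n = i by lia.
    by case: _ / e => z; rewrite fn; exact: h0.
  have lin : (i < n)%N by lia.
  move=> z /(Wex i lin)[y <-]; rewrite -IH; last by lia.
  by rewrite cC.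
by exists f; split=> // i lin; apply: (comm (n - i)%N); lia.
Qed.

(** A factorisation of [g 0] through [dC 0] spreads to the left as a homotopy. If [dC n] is
    injective it ends as a factorisation of [g n.+1] through [dW n]; for extensions, a splitting of
    the pullback becomes one of the pushout. *)
Lemma homotopy_right_left (g : forall i, {linear W i -> C i}) (s0 : {linear W 0%N -> C 1%N}) :
  chain_map g -> is_complex dW -> (forall z, g 0%N z = dC 0%N (s0 z)) ->
  (forall i, (i < n)%N -> forall f : {linear W i.+1 -> C i.+1},
     (forall z, dC i (f z) = 0) ->
     exists h : {linear W i.+1 -> C i.+2}, forall z, dC i.+1 (h z) = f z) ->
  exists s : {linear W n -> C n.+1}, forall z, dC n (g n.+1 z) = dC n (s (dW n z)).
Proof.
move=> cg cW g0E lifts.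
pose T i := {linear W i -> C i.+1}.
pose Q i (x : T i) (y : T i.+1) := (i < n)%N ->
  (forall z, dC i (g i.+1 z - x (dW i z)) = 0) ->
  forall z, g i.+1 z = dC i.+1 (y z) + x (dW i z).
have [i x|s [s0E sQ]] := @dep_choice T Q s0.
  have [[lin h]|nh] := pselect ((i < n)%N /\ forall z, dC i (g i.+1 z - x (dW i z)) = 0).
    have [y yE] := lifts i lin (g i.+1 \- (x \o dW i) : {linear _ -> _}) h.
    by exists y => _ _ z; rewrite yE /= subrK.
  by exists \0 => a b; case: nh.
have inv i : (i <= n)%N -> forall z, dC i (g i.+1 z - s i (dW i z)) = 0.
  elim: i => [|i IH] lin z; rewrite linearB cg //; first by rewrite s0E g0E subrr.
  rewrite (sQ i lin (IH (ltnW lin))) addrC addKr //.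
  by rewrite cW // linear0.
exists (s n) => z; apply/eqP; rewrite -subr_eq0 -linearB; apply/eqP; exact: inv.
Qed.

(** The way back, with extension along dW in place of lifting along dC. *)
Lemma homotopy_left_right (g : forall i, {linear W i -> C i}) (s : {linear W n -> C n.+1}) :
  chain_map g -> is_complex dC -> onto (dW 0%N) ->
  (forall z, dC n (g n.+1 z) = dC n (s (dW n z))) ->
  (forall i, (i < n)%N -> forall f : {linear W i.+1 -> C i.+1},
     (forall z, f (dW i.+1 z) = 0) ->
     exists h : {linear W i -> C i.+1}, forall z, h (dW i z) = f z) ->
  exists s0 : {linear W 0%N -> C 1%N}, forall z, g 0%N z = dC 0%N (s0 z).
Proof.
move=> cg cC WO gn ext.
pose T i := {linear W i -> C i.+1}.
pose Q i (x : T i) (y : T i.+1) :=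
  (forall z, g i.+1 (dW i.+1 z) - dC i.+1 (y (dW i.+1 z)) = 0) ->
  forall z, g i.+1 z = dC i.+1 (y z) + x (dW i z).
have [i y lin|f [fn fQ]] := @dep_choice_down T Q (fun i => \0) n s.
  have [h|nh] := pselect (forall z, g i.+1 (dW i.+1 z) - dC i.+1 (y (dW i.+1 z)) = 0).
    have [x xE] := ext i lin (g i.+1 \- (dC i.+1 \o y) : {linear _ -> _}) h.
    by exists x => _ z; rewrite xE /= addrC subrK.
  by exists \0 => a; case: nh.
have inv m i : (i + m)%N = n -> forall z, g i (dW i z) - dC i (f i (dW i z)) = 0.
  elim: m i => [|m IH] i iE.
    have e : n = i by lia.
    by case: _ / e => z; rewrite -cg // gn fn subrr.
  move=> z.
  have h := fQ i _ (IH i.+1 _) z; rewrite -cg; last by lia.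
  rewrite -linearB h; [|lia|lia].
  by rewrite addrK cC //; lia.
exists (f 0%N) => z; have [y <-] := WO z.
by apply/eqP; rewrite -subr_eq0; apply/eqP; apply: (inv n).
Qed.

End ChainMaps.

(** * Realising extension classes by sequences in M *)

Section Realization.
Variables (A : pzRingType).
Hypothesis hA : ranked (A^o : lmodType A).
Hypothesis coresolutions : has_coresolutions A.
Variables (d : nat) (M : lmodType A -> Prop).
Hypothesis d1 : (1 <= d)%N.
Hypothesis hM : cluster_tilting d M.

(* An exact sequence G (m+2) -> ... -> G 0 whose only term possibly outside M,
   apart from G 0, is G 1 can be replaced, without changing G 0 and G (m+2), by
   one with all these terms in M: cover G 1 by an M-approximation V and pull
   back, which moves the bad term one step to the left; after enough steps it
   has no extensions left and lies in M.  Chain maps from complexes in M lift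
   strictly, since each step is a pullback. *)
Lemma realization m (G : nat -> lmodType A) (dG : forall i, {linear G i.+1 -> G i}) :
  (m < d)%N -> ranked (G 1%N) -> (forall i, (1 < i <= m.+2)%N -> M (G i)) ->
  extM M (d.-1 - m) (G 1%N) -> injective (dG m.+1) ->
  (forall i, (i <= m)%N -> exact_at (dG i.+1) (dG i)) ->
  exists (W : nat -> lmodType A) (dW : forall i, {linear W i.+1 -> W i})
    (s : forall i, {linear W i -> G i}),
  [/\ forall i, (0 < i <= m.+2)%N -> M (W i),
      injective (dW m.+1) /\ forall i, (i <= m)%N -> exact_at (dW i.+1) (dW i),
      [/\ chain_map m.+1 dW dG s, bijective (s 0%N) & bijective (s m.+2)],
      (forall y, exists x, s 0%N (dW 0%N x) = dG 0%N y) /\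
      (forall (V : lmodType A) (f : {linear V -> G 1%N}), M V ->
        exists g : {linear V -> W 1%N}, forall x, s 1%N (g x) = f x)
    & forall (C : nat -> lmodType A) (dC : forall i, {linear C i.+1 -> C i})
        (g : forall i, {linear C i -> G i}),
      (forall i, (0 < i <= m.+1)%N -> M (C i)) -> is_complex m.+1 dC ->
      chain_map m.+1 dC dG g ->
      exists h : forall i, {linear C i -> W i},
      [/\ chain_map m.+1 dC dW h, forall z, s 0%N (h 0%N z) = g 0%N z
        & forall z, s m.+2 (h m.+2 z) = g m.+2 z]].
Proof.
elim: m G dG => [|m IH] G dG md hG1 GM eG Gmono Gex.
  have MG1 : M (G 1%N).
    by apply: (M_extM d1 hM hG1); move: eG; rewrite subn0.
  exists G, dG, (fun i => idfun); split=> //.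
  - by move=> [|[|[|i]]] // h; exact: GM.
  - by split=> //; exists idfun.
  - by split=> [y|V f _]; [exists y|exists f].
  - by move=> C dC g _ _ gG; exists g.
have [V [w [MV wO _ wP]]] := minimal_approximation hA coresolutions d1 hM hG1.
(* The kernel K is the pullback of [G 2] and V over [G 1]; phi is an M-approximation of [G 1]
   because w is one, so K has one more vanishing Ext degree. *)
pose phi : {linear (G 2%N * V)%type -> G 1%N} := (dG 1%N \o fst) \- (w \o snd).
have [K [k [kI kP]]] := kernel_type phi.
have phiO : onto phi.
  by move=> y; have [v vy] := wO (- y); exists (0, v); rewrite /phi /= linear0 vy opprK add0r.
have M2V : M (G 2%N * V)%type by apply: (M_prod hM) => //; exact: GM.
have kE y : dG 1%N (k y).1 = w (k y).2.
  by apply/eqP; rewrite -subr_eq0; apply/eqP; apply/kP; exists y.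
have eK : extM M (d.-1 - m) K.
  have e : (d.-1 - m = (d.-1 - m.+1).+1)%N by lia.
  rewrite e; apply: (extM_kernel d1 hM kI phiO kP M2V) => //; last by lia.
  move=> X c hX; have [h hE] := wP X (\- c : {linear _ -> _}) hX.
  have lL : linear (fun x => (0 : G 2%N, h x)).
    by move=> a x y; congr pair; rewrite /= ?linearP ?scaler0 ?addr0.
  by exists (lin lL) => x; rewrite /phi /= linear0 hE /= opprK add0r.
have hK : ranked K by exact: (ranked_inj kI (M_ranked hM M2V)).
have jL : linear (fun x : G 3%N => (dG 2%N x, 0 : V)).
  by move=> a x y; congr pair; rewrite /= ?linearP ?scaler0 ?addr0.
have [|j jE] := injective_lift (f := lin jL) kI.
  move=> x; apply/kP; rewrite /phi /= linear0 subr0.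
  by rewrite (exact_comp0 _ (Gex 1%N _)).
(* Without [G 0] the sequence ends in V, and the only doubtful term, now K, again has index 1. *)
pose G' i : lmodType A := match i with 0%N => V | 1%N => K | i.+2 => G i.+3 end.
pose dG' i : {linear G' i.+1 -> G' i} :=
  match i with 0%N => snd \o k | 1%N => j | i.+2 => dG i.+3 end.
have [||||||W' [dW' [s' [WM [Wmono Wex] [sC sB0 sBm] [WO Wl] Wlift]]]] := IH G' dG' => //.
- exact: ltnW.
- by move=> [|[|i]] // h; apply: GM.
- case: m {IH md GM eG eK} Gmono Gex => [|m] Gmono Gex //=.
  apply: linear_inj => x jx0; apply: (injective_eq0 Gmono).
  by have := jE x; rewrite jx0 linear0 => -[].
- case=> [|[|i]] im; last exact: Gex.
    move=> y; split=> [/= y2|[x <-]]; last by rewrite /= jE.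
    have e0 : dG 1%N (k y).1 = 0 by rewrite kE y2 linear0.
    have [x xE] := (Gex 1%N isT (k y).1).1 e0.
    exists x; apply: kI; rewrite jE /= xE -y2; by case: (k y).
  move=> y; split=> [/= jy|[x <-]].
    by apply/(Gex 2%N) => //; have := jE y; rewrite jy linear0 => -[].
  apply: kI; rewrite jE linear0 /=; congr pair.
  by rewrite (exact_comp0 _ (Gex 2%N _)).
have [t [tK Kt]] := bij_inverse sB0.
pose W i : lmodType A := if i is i.+1 then W' i else G 0%N.
pose dW i : {linear W i.+1 -> W i} :=
  match i with 0%N => dG 0%N \o w \o s' 0%N | i.+1 => dW' i end.
pose s i : {linear W i -> G i} :=
  match i with 0%N => idfun | 1%N => w \o s' 0%N | 2%N => fst \o k \o s' 1%N
  | i.+3 => s' i.+2 end.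
have c0 z : s' 0%N (dW' 0%N z) = (k (s' 1%N z)).2 by rewrite -sC.
exists W, dW, s; split.
- by move=> [|[|i]] // h; [exact/(M_iso hM sB0)|apply: WM].
- split=> //; case=> [|i] im; last exact: Wex.
  move=> y; split=> [/= y0|[x <-]]; last first.
    by rewrite /= c0 -kE (exact_comp0 _ (Gex 0%N _)).
  have [a aE] := (Gex 0%N isT _).1 y0.
  have [q qE] : exists q, k q = (a, s' 0%N y) by apply/kP; rewrite /phi /= aE subrr.
  have [x xE] := WO q; exists x; apply: (bij_inj sB0).
  by rewrite xE /= qE.
- split=> //; last by exists idfun.
  case=> [//|[|[|i]]] im z /=; last exact: (sC i.+2 im z).
    by rewrite c0 kE.
  have := sC 1%N isT z; rewrite /= => <-.
  by rewrite jE.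
- split=> [y|V' f hV']; first by have [v <-] := wO y; exists (t v); rewrite /= Kt.
  have [g gE] := wP V' f hV'; exists (t \o g) => x /=.
  by rewrite Kt gE.
move=> C dC g CM cC gG.
have [h0 h0E] := wP (C 1%N) (g 1%N) (CM 1%N isT).
have h1L : linear (fun z : C 2%N => (g 2%N z, h0 (dC 1%N z))) by move=> a x y; rewrite !linearP.
have [|h1 h1E] := injective_lift (f := lin h1L) kI.
  by move=> z; apply/kP; rewrite /phi /= h0E -gG // subrr.
pose C' i : lmodType A := C i.+1.
pose dC' i : {linear C' i.+1 -> C' i} := dC i.+1.
pose g' i : {linear C' i -> G' i} :=
  match i with 0%N => h0 | 1%N => h1 | i.+2 => g i.+3 end.
have [|||h [hC hs0 hsm]] := Wlift C' dC' g'.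
- by move=> i im; apply: CM; lia.
- by move=> i im z; apply: cC; lia.
- case=> [|[|i]] im z /=; last exact: gG.
    by rewrite h1E.
  apply: kI; rewrite jE h1E /= cC // linear0; congr pair.
  by rewrite gG.
pose h' i : {linear C i -> W i} := match i with 0%N => g 0%N | i.+1 => h i end.
exists h'; split=> //.
case=> [_ z|i im z] /=; last exact: (hC i im z).
by rewrite hs0 /= h0E gG.
Qed.

(* The sequence in M realizing the extension given by psi : N -> G 0, where
   G is a coresolution of the left end. *)
Lemma realize_extension (N : lmodType A) (G : nat -> lmodType A)
    (dG : forall i, {linear G i.+1 -> G i}) (psi : {linear N -> G 0%N}) :
  coresolution d.+1 dG -> (forall i, (i <= d.+1)%N -> ranked (G i)) ->
  M (G d.+1) -> ranked N ->
  exists (W : nat -> lmodType A) (dW : forall i, {linear W i.+1 -> W i})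
    (s : forall i, {linear W i -> G i}) (s0 : {linear W 0%N -> N}),
  [/\ forall i, (0 < i <= d.+1)%N -> M (W i),
      injective (dW d) /\ forall i, (i < d)%N -> exact_at (dW i.+1) (dW i),
      [/\ chain_map d dW dG s, forall z, s 0%N z = psi (s0 z), bijective s0
        & bijective (s d.+1)],
      forall (V : lmodType A) (f : {linear V -> N}) (b : {linear V -> G 1%N}), M V ->
        (forall x, psi (f x) = dG 0%N (b x)) ->
        exists g : {linear V -> W 1%N}, forall x, s0 (dW 0%N (g x)) = f x
    & forall (C : nat -> lmodType A) (dC : forall i, {linear C i.+1 -> C i})
        (c0 : {linear C 0%N -> N}) (c : forall i, {linear C i -> G i}),
      (forall i, (0 < i <= d)%N -> M (C i)) -> is_complex d dC ->
      chain_map d dC dG c -> (forall z, c 0%N z = psi (c0 z)) ->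
      exists h : forall i, {linear C i -> W i},
      [/\ chain_map d dC dW h, forall z, s0 (h 0%N z) = c0 z
        & forall z, s d.+1 (h d.+1 z) = c d.+1 z]].
Proof.
move=> [Ginj Gmono Gex] hG MG hN.
have G10 x : dG 0%N (dG 1%N x) = 0 by apply: exact_comp0; apply: Gex.
(* Its kernel Y is the pullback of psi along [dG 0]. With m = d - 1 the Ext condition of
   [realization] is empty, so nothing has to be known about the extensions of Y. *)
pose phi : {linear (N * G 1%N)%type -> G 0%N} := (psi \o fst) \- (dG 0%N \o snd).
have [Y [k [kI kP]]] := kernel_type phi.
have kE y : psi (k y).1 = dG 0%N (k y).2.
  by apply/eqP; rewrite -subr_eq0; apply/eqP; apply/kP; exists y.
have pairP (V : lmodType A) (f : {linear V -> N}) (b : {linear V -> G 1%N}) :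
    (forall x, psi (f x) = dG 0%N (b x)) ->
    exists g : {linear V -> Y}, forall x, k (g x) = (f x, b x).
  move=> fb; have fbL : linear (fun x => (f x, b x)) by move=> a x y; rewrite !linearP.
  have [|g gE] := injective_lift (f := lin fbL) kI; last by exists g.
  by move=> x; apply/kP; rewrite /phi /= fb subrr.
have [|j jE] := pairP (G 2%N) \0 (dG 1%N); first by move=> x; rewrite /= linear0 G10.
pose G' i : lmodType A := match i with 0%N => N | 1%N => Y | i.+2 => G i.+2 end.
pose dG' i : {linear G' i.+1 -> G' i} :=
  match i with 0%N => fst \o k | 1%N => j | i.+2 => dG i.+2 end.
have e1 : d.-1.+1 = d by lia.
have [|||||| W [dW [q [WM [Wmono Wex] [qC qB0 qBd] [_ Wl] Wlift]]]] :=
    @realization d.-1 G' dG' => //.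
- by lia.
- by apply: (ranked_inj kI); apply: ranked_prod => //; exact: hG.
- case=> [|[|i]] //= id1; have [e|lt] : i.+2 = d.+1 \/ (i.+2 < d.+1)%N by lia.
    by rewrite e.
  by apply: (M_injective hM); [apply: hG; lia|exact: Ginj].
- by rewrite subnn => -[].
- rewrite e1; case: d d1 Gmono {e1} => // -[|d'] _ Gmono; last exact: Gmono.
  apply: linear_inj => x jx0; apply: (injective_eq0 (Gmono 1%N erefl)).
  by have := jE x; rewrite jx0 linear0 => -[].
- case=> [|[|i]] im; last by apply: Gex; lia.
    move=> y; split=> [/= y1|[x <-]]; last by rewrite /= jE.
    have e0 : dG 0%N (k y).2 = 0 by rewrite -kE y1 linear0.
    have [x xE] := (Gex 0%N d1 (k y).2).1 e0.
    by exists x; apply: kI; rewrite jE /= xE -y1; case: (k y).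
  have G21 : exact_at (dG 2%N) (dG 1%N) by apply: Gex; lia.
  move=> y; split=> [/= jy|[x <-]].
    by apply/G21; have := jE y; rewrite jy linear0 => -[].
  by apply: kI; rewrite jE linear0 /= (exact_comp0 _ G21).
rewrite e1 in Wmono qC qBd WM Wlift.
pose s i : {linear W i -> G i} := match i with
  0%N => psi \o q 0%N | 1%N => snd \o k \o q 1%N | i.+2 => q i.+2 end.
have q0 z : q 0%N (dW 0%N z) = (k (q 1%N z)).1 by rewrite -qC.
exists W, dW, s, (q 0%N); split=> //.
- by split=> // i id1; apply: Wex; lia.
- split=> //; last by case: d d1 qBd.
  case=> [|[|i]] im z /=; last exact: (qC i.+2 im z).
    by rewrite q0 kE.
  have /= := qC 1%N im z; rewrite -[in LHS]/j => <-.
  by rewrite jE.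
- move=> V f b hV fb; have [g gE] := pairP V f b fb.
  have [g' g'E] := Wl V g hV; exists g' => x.
  by rewrite q0 g'E gE.
move=> C dC c0 c CM cC cG c00.
have [|g1 g1E] := pairP (C 1%N) (c0 \o dC 0%N) (c 1%N).
  by move=> z /=; rewrite -c00 cG.
pose g i : {linear C i -> G' i} :=
  match i with 0%N => c0 | 1%N => g1 | i.+2 => c i.+2 end.
have [|||w [wC w0 wd]] := Wlift C dC g.
- exact: CM.
- exact: cC.
- case=> [|[|i]] im z /=; last exact: (cG i.+2 im z).
    by rewrite g1E.
  by apply: kI; rewrite jE g1E /= cC // linear0 cG.
exists w; split=> //.
by case: d d1 wd.
Qed.

End Realization.

(** * Minimal almost split complexes *)

Section AlmostSplitComplex.
Variables (A : pzRingType).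
Hypothesis hA : ranked (A^o : lmodType A).
Hypothesis coresolutions : has_coresolutions A.
Variables (d : nat) (M : lmodType A -> Prop).
Hypothesis d1 : (1 <= d)%N.
Hypothesis hM : cluster_tilting d M.

Lemma kernel_approximations (X Y : lmodType A) (f : {linear X -> Y}) : M X ->
  exists (C : nat -> lmodType A) (dC : forall i, {linear C i.+1 -> C i})
    (e : {linear C 0%N -> X}),
  [/\ forall i, M (C i), exact_at e f /\ exact_at (dC 0%N) e,
      forall i, exact_at (dC i.+1) (dC i),
      right_minimal e /\ forall i, right_minimal (dC i)
    & (forall (V : lmodType A) (g : {linear V -> X}), M V -> (forall x, f (g x) = 0) ->
         exists h : {linear V -> C 0%N}, forall x, e (h x) = g x) /\
      (forall (V : lmodType A) (g : {linear V -> C 0%N}), M V -> (forall x, e (g x) = 0) ->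
         exists h : {linear V -> C 1%N}, forall x, dC 0%N (h x) = g x) /\
      (forall i (V : lmodType A) (g : {linear V -> C i.+1}), M V ->
         (forall x, dC i (g x) = 0) ->
         exists h : {linear V -> C i.+2}, forall x, dC i.+1 (h x) = g x)].
Proof.
move=> hX.
pose good (X' Y' V : lmodType A) (f' : {linear X' -> Y'}) (v : {linear V -> X'}) :=
  [/\ M V, exact_at v f', right_minimal v
    & forall (U : lmodType A) (g : {linear U -> X'}), M U -> (forall x, f' (g x) = 0) ->
         exists h : {linear U -> V}, forall x, v (h x) = g x].
(* A map is packed with its source in M, so that successive kernel approximations become the
   iteration of one function. *)
pose arrow := {X' : {X' : lmodType A | M X'} & {Y' : lmodType A & {linear sval X' -> Y'}}}.
have step (a : arrow) : {V : {V : lmodType A | M V} & {v : {linear sval V -> sval (projT1 a)} |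
    good _ _ _ (projT2 (projT2 a)) v}}.
  case: a => -[X' hX'] [Y' f'] /=.
  suff /cid[V /cid[v h]] : exists (V : lmodType A) (v : {linear V -> X'}), good _ _ _ f' v.
    have hV : M V by case: h.
    by exists (exist _ V hV), v.
  have [K [k [kI kP]]] := kernel_type f'.
  have hK := ranked_inj kI (M_ranked hM hX').
  have [V [v [hV vO vm vP]]] := minimal_approximation hA coresolutions d1 hM hK.
  exists V, (k \o v); split=> //.
  - move=> x; split=> [/kP[y <-]|[z <-]]; last exact: (exact_comp0 (v z) kP).
    by have [z <-] := vO y; exists z.
  - by move=> y yP; apply: vm => x; apply: kI; exact: yP.
  move=> U g hU g0; have [|g' g'E] := injective_lift (f := g) kI.
    by move=> x; apply/kP.
  by have [h hE] := vP U g' hU; exists h => x /=; rewrite hE.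
pose next (a : arrow) : arrow :=
  existT _ (projT1 (step a)) (existT _ (sval (projT1 a)) (sval (projT2 (step a)))).
pose arr := fix arr n : arrow :=
  if n is m.+1 then next (arr m) else existT _ (exist _ X hX) (existT _ Y f).
pose src n := sval (projT1 (arr n)).
exists (fun n => src n.+1), (fun n => sval (projT2 (step (arr n.+1)))),
  (sval (projT2 (step (arr 0%N)))).
have H n := svalP (projT2 (step (arr n))).
split.
- by move=> n; case: (H n).
- by split; [case: (H 0%N)|case: (H 1%N)].
- by move=> n; case: (H n.+2).
- by split=> [|n]; [case: (H 0%N)|case: (H n.+1)].
split; first by case: (H 0%N).
by split=> [|i]; [case: (H 1%N)|case: (H i.+2)].
Qed.

Definition almost_split_complex (C : nat -> lmodType A)
    (dC : forall i, {linear C i.+1 -> C i}) : Prop :=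
  [/\ exactM d M dC, forall i, (i <= d)%N -> in_radical (dC i),
      right_almost_split M (dC 0%N) & left_almost_split M (dC d)].

Section Sequence.
Variables (C : nat -> lmodType A) (dC : forall i, {linear C i.+1 -> C i}).
Hypothesis hC : exactM d M dC.
Hypothesis Crad : forall i, (i <= d)%N -> in_radical (dC i).
Hypothesis Cras : right_almost_split M (dC 0%N).

Lemma exactM_complex : is_complex d dC.
Proof. by case: hC => _ _ Cex _ i id1 z; exact: (exact_comp0 z (Cex i id1)). Qed.

(* An endomorphism of the sequence which is the identity on C 0 is homotopic to
   the identity, hence invertible on C d.+1 because the differentials lie in
   the radical. *)
Lemma endo_iso (e : forall i, {linear C i -> C i}) :
  chain_map d dC dC e -> (forall z, e 0%N z = z) -> bijective (e d.+1).
Proof.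
have [CM CO Cex Cmono] := hC => ce e0.
pose e' i : {linear C i -> C i} := idfun \- e i.
have [||||k kE] := @homotopy_right_left A d C C dC dC e' \0.
- by move=> i id1 z; rewrite /e' /= linearB ce.
- exact: exactM_complex.
- by move=> z; rewrite /e' /= e0 subrr linear0.
- by move=> i id1 f; apply: (exactM_lift hA d1 hM hC) => //; apply: CM; lia.
have := comp_bij_inv (Crad (leqnn d) k) => -[v vK Kv].
have eE z : e d.+1 z = z - k (dC d z).
  by apply/esym/eqP; rewrite subr_eq addrC -subr_eq; apply/eqP/Cmono; rewrite -kE.
by exists v => z; rewrite ?vK eE ?vK ?Kv.
Qed.

Lemma exactM_left_almost_split : left_almost_split M (dC d).
Proof.
have [CM CO Cex Cmono] := hC; split=> [[r rE]|V h hV nsm].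
  (* A retraction of [dC d] is a homotopy at the left end for the identity of C; carried to the
     right end it is a section of [dC 0]. *)
  have [|||||s sE] := @homotopy_left_right A d C C dC dC (fun i => idfun) r => //.
  - exact: exactM_complex.
  - by move=> z; rewrite rE.
  - by move=> i id1 f f0; apply: (exactM_extend hA coresolutions d1 hM hC) => //; apply: CM; lia.
  by case: Cras => ns _; apply: ns; exists s => z; rewrite -sE.
have [G [dG [s [[Ginj Gmono Gex] sB hG]]]] := coresolutions d.+1 (M_ranked hM hV).
have [t [tK Kt]] := bij_inverse sB.
(* In place of a pushout, h is extended to a chain map into a coresolution of V; [c 0] is the class
   of the pushed out extension, and W realises it. *)
have [||||c [cc cn]] := @chain_map_extend A d C G dC dG (s \o h).
- by move=> i id1; apply: Ginj.
- by move=> z /(injective_eq0 Cmono) ->; rewrite !linear0.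
- exact: Cex.
- by move=> i id1 z; apply: exact_comp0; apply: Gex.
have [|||W [dW [q [q0 [WM [Wmono Wex] [qC qE q0B qBd] Wl Wlift]]]]] :=
    realize_extension hA coresolutions d1 hM (c 0%N) (And3 Ginj Gmono Gex).
- by move=> i _; exact: hG.
- exact/(M_iso hM sB).
- exact/(M_ranked hM)/CM.
have [||w [wC w0 wd]] := Wlift C dC idfun c _ exactM_complex cc.
- by move=> i im; apply: CM; lia.
- by [].
have W1M : M (W 1%N) by apply: WM.
pose p : {linear W 1%N -> C 0%N} := q0 \o dW 0%N.
have [[sec secE]|nsp] := pselect (split_epi p).
  have yE z : c 0%N z = dG 0%N ((q 1%N \o sec : {linear _ -> _}) z).
    by rewrite /= qC // qE; congr (c 0%N _); rewrite -[LHS]secE.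
  have [|u uE] := @homotopy_right_left A d C G dC dG c _ cc exactM_complex yE.
    move=> i id1 f f0; have [e|lt] : i.+2 = d.+1 \/ (i.+2 <= d)%N by lia.
      apply: injective_lift; first exact: Gmono.
      by move=> x; apply/(Gex i).
    have [|f' f'E] := M_lifts hA d1 hM _ hV (And3 Ginj Gmono Gex) sB lt f0.
      by apply: CM; lia.
    by exists f' => z.
  exists (t \o u) => x /=; have /Gmono dI : d.+1 = d.+1 by [].
  by rewrite -(dI _ _ (uE x)) cn /= tK.
(* Not being split, p factors through [dC 0], which gives a chain map th from W back to C. Then th w
   is the identity on [C 0], so it is invertible on [C d.+1], where w factors through h. *)
exfalso; apply: nsm; have [ns ras] := Cras.
have [ka kaE] := ras _ p W1M nsp.
have cW : is_complex d dW.
  by move=> i id1 z; apply: exact_comp0; apply: Wex; lia.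
have [||th [thC th0 _]] := @chain_map_lift A d W C dW dC q0 ka cW.
- exact: kaE.
- by move=> i id1 f f0; apply: (exactM_lift hA d1 hM hC) => //; apply: WM; lia.
have [q' [q'K Kq']] := bij_inverse qBd.
have eb : bijective (th d.+1 \o w d.+1).
  apply: (@endo_iso (fun i => th i \o w i)); first by move=> i id1 z /=; rewrite thC // wC.
  by move=> z /=; rewrite th0; exact: w0.
have [v' v'E] : exists v' : {linear C d.+1 -> C d.+1}, forall z, v' (th d.+1 (w d.+1 z)) = z.
  by have [v' [v'K _]] := bij_inverse (f := (th d.+1 \o w d.+1 : {linear _ -> _})) eb; exists v'.
exists (v' \o th d.+1 \o q' \o s) => x.
have := wd x; rewrite cn /= => <-; rewrite q'K; exact: v'E.
Qed.

End Sequence.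
(** The map a |-> a x from A to N is not a split epimorphism, as N is not projective, so it factors
    through g. *)
Lemma right_almost_split_onto (X N : lmodType A) (g : {linear X -> N}) :
  ~ projective_module N -> right_almost_split M g -> onto g.
Proof.
move=> nN [_ ras] x.
have hL : linear (fun a : A^o => (a : A) *: x) by move=> a b c; rewrite scalerDl scalerA.
have MA := M_projective coresolutions d1 hM hA (@regular_projective A).
have [|k kE] := ras _ (lin hL) MA.
  by move=> [s sE]; apply: nN; exact: projective_retract sE (@regular_projective A).
by exists (k 1); exact: etrans (kE 1) (scale1r x).
Qed.

Lemma almost_split_exists (N W : lmodType A) (p : {linear W -> N}) :
  M N -> indecomposable N -> ~ projective_module N -> M W ->
  right_almost_split M p ->
  exists (P : nat -> lmodType A) (del : forall i, {linear P i.+1 -> P i})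
    (eps : {linear P 0%N -> N}), almost_split_complex (augment_del del eps).
Proof.
move=> hN iN nN hW [nsp ras].
have [X [i [r [ri pir pm]]]] := right_minimal_version p (M_ranked hM hW).
have hX : M X by exact: (M_retract hM ri hW).
pose g : {linear X -> N} := p \o i.
have gras : right_almost_split M g.
  split=> [[s sE]|V h hV nsh]; first by apply: nsp; exists (i \o s) => y; exact: sE.
  by have [k kE] := ras V h hV nsh; exists (r \o k) => x; rewrite /g /= pir.
have gO := right_almost_split_onto nN gras.
have [C [dC [e [CM [eg de] dd [em dm] [lift0 [lift1 lift2]]]]]] := kernel_approximations g hX.
pose P i : lmodType A := if i is j.+1 then C j else X.
pose del i : {linear P i.+1 -> P i} := match i with 0%N => e | j.+1 => dC j end.
exists P, del, g; set Q := augment N P; set dQ := augment_del del g.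
have QM j : M (Q j) by case: j => [|[|j]]; [exact: hN|exact: hX|exact: CM].
have Qex j : exact_at (dQ j.+1) (dQ j).
  by case: j => [|[|j]]; [exact: eg|exact: de|exact: dd].
have Qmin j : right_minimal (dQ j).
  by case: j => [|[|j]]; [exact: pm|exact: em|exact: dm].
have Qlift j (V : lmodType A) (f : {linear V -> Q j.+1}) : M V ->
    (forall x, dQ j (f x) = 0) ->
    exists h : {linear V -> Q j.+2}, forall x, dQ j.+1 (h x) = f x.
  case: j f => [|[|j]] f hV f0; [exact: lift0|exact: lift1|exact: lift2].
(* Composition with [dQ j] does not distinguish 1 - [dQ j.+1] y from the identity, so right
   minimality of [dQ j] makes it invertible. *)
have Qrad j : in_radical (dQ j.+1).
  move=> y; apply: (Qmin j (idfun \- (dQ j.+1 \o y) : {linear _ -> _})) => x.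
  by rewrite /= linearB (exact_comp0 _ (Qex j)) subr0.
(* At N itself minimality is replaced by indecomposability: g y is not invertible, hence
   nilpotent. *)
have Qrad0 : in_radical (dQ 0%N).
  move=> y; have [|n yn] := indecomposable_nilpotent (e := (g \o y : {linear _ -> _}))
    (M_ranked hM hN) iN.
    move=> /bij_inverse[u [_ Ku]]; case: gras => ng _; apply: ng.
    by exists (y \o u) => z; exact: Ku.
  exact: (nilpotent_one_sub (M_ranked hM hN) yn).
have Qext j : (j < d)%N -> forall (K : lmodType A) (k : {linear K -> Q j.+1}),
    injective k -> exact_at k (dQ j) -> extM M j K.
  elim: j => [|j IH] jd K k kI kP; first by move=> l Y /andP[l0]; rewrite leqn0 => /eqP l1; rewrite l1 in l0.
  have [K' [k' [kI' kP']]] := kernel_type (dQ j).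
  have [|q qE] := injective_lift (f := dQ j.+1) kI'.
    by move=> x; apply/kP'; rewrite (exact_comp0 _ (Qex j)).
  have qO : onto q.
    move=> z; have [x xE] : exists x, dQ j.+1 x = k' z.
      by apply/(Qex j)/kP'; exists z.
    by exists x; apply: kI'; rewrite qE.
  have IH' : extM M j K' by apply: IH kI' kP'; lia.
  have ex : exact_at k q.
    move=> x; rewrite -kP -qE; split=> [->|]; first exact: linear0.
    exact: injective_eq0.
  apply: (extM_kernel d1 hM kI qO ex (QM j.+2) _ IH' jd).
  move=> Y c hY; have [|h hE] := Qlift j Y (k' \o c : {linear _ -> _}) hY.
    by move=> x; exact: (exact_comp0 _ kP').
  by exists h => x; apply: kI'; rewrite qE hE.
(* By [Qext] the kernel of [dQ d.-1] lies in M, so it is its own approximation, and right minimality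
   makes [dQ d] an isomorphism onto it. *)
have Qmono : injective (dQ d).
  have [K [k [kI kP]]] := kernel_type (dQ d.-1).
  have e1 : d.-1.+1 = d by lia.
  have hK : M K.
    apply: (M_extM d1 hM); last by apply: (Qext d.-1 _ _ k) => //; lia.
    exact: (ranked_inj kI (M_ranked hM (QM d.-1.+1))).
  have [|h hE] := Qlift d.-1 K k hK; first by move=> x; exact: (exact_comp0 _ kP).
  have [|q qE] := injective_lift (f := dQ d.-1.+1) kI.
    by move=> x; apply/kP; rewrite (exact_comp0 _ (Qex _)).
  have hq : bijective (h \o q : {linear _ -> _}).
    by apply: (Qmin d.-1.+1) => x; rewrite /= hE qE.
  rewrite -e1; apply: linear_inj => x dx0.
  have qx0 : q x = 0 by apply: (injective_eq0 kI); rewrite qE.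
  by apply: (injective_eq0 (bij_inj hq)); rewrite /= qx0 linear0.
have Qrad' j : (j <= d)%N -> in_radical (dQ j) by case: j.
have Qexact : exactM d M dQ by split.
split=> //.
by apply: exactM_left_almost_split.
Qed.

End AlmostSplitComplex.

(** * The higher Auslander-Reiten translate *)

Section Translate.
Variables (R : comNzRingType) (E : lmodType R).
Hypothesis hE : standard_injective E.
Hypothesis hR : ranked (R^o : lmodType R).
Variables (A : pzRingType) (iota : central_map R A).
Hypothesis hiA : ranked (restr iota A^o).
Hypothesis coresolutions : has_coresolutions A.
Variables (n : nat) (M : lmodType A -> Prop).
Notation d := n.+1.
Hypothesis hM : cluster_tilting d M.

Let hA : ranked (A^o : lmodType A) := ranked_ring hiA.
Let d1 : (1 <= d)%N := isT.

Variable N : lmodType A.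
Hypothesis hN : M N.
Hypothesis iN : indecomposable N.
Hypothesis nN : ~ projective_module N.

Variables (P : nat -> lmodType A) (del : forall i, {linear P i.+1 -> P i}).
Variable eps : {linear P 0%N -> N}.
Hypothesis hP : projective_resolution del eps.
Hypothesis Prk : forall i, ranked (P i).
Hypothesis Psup : superfluous_kernel (del n).

(* J i is the Nakayama functor applied to P i for i <= d, and J d.+1, the kernel
   of J d -> J n, is tau_d N. *)
Variables (J : nat -> lmodType A) (q : forall i, {linear J i.+1 -> J i}).
Variable w : forall i, {linear homR iota (P i) (J i) -> E}.
Hypothesis Jrep : forall i, (i <= d)%N -> represents (w i).
Hypothesis Jrk : forall i, (i <= d.+1)%N -> ranked (J i).
Hypothesis Jnat : forall i, (i < d)%N -> forall t : {linear P i -> J i.+1},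
  w i (q i \o t) = w i.+1 (t \o del i).
Hypothesis Jmono : injective (q d).
Hypothesis Jker : exact_at (q d) (q n).

Let hPa := augmentP hP.

Lemma J_injective i : (i <= d)%N -> injective_module (J i).
Proof. by move=> id; exact: (represents_injective hE (Jrep id)). Qed.

(** The last hypothesis says that F depends only on h composed with [del i]. As E is injective, F
    then extends to a functional on Hom([P i.+1], V), and this is a map to [J i.+1]. *)
Lemma functional_lift (V : lmodType A) i (a : {linear V -> J i})
    (F : {linear homR iota (P i) V -> E}) : (i < d)%N ->
  (forall h : {linear P i -> V}, F h = w i (a \o h)) ->
  (forall h : {linear P i -> V}, (forall x, h (del i x) = 0) -> F h = 0) ->
  exists b : {linear V -> J i.+1}, forall x, q i (b x) = a x.
Proof.
move=> id FE F0.
have [|G GE] := @injective_factor _ _ _ _ (precomp iota V (del i)) F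
    (standard_injective_module hE).
  move=> h h0; apply: F0 => x.
  exact: (congr1 (fun k : homR iota (P i.+1) V => k x) h0).
have [ex _] := Jrep (i := i.+1) id; have [b bE] := ex V G.
exists b => x; apply/eqP; rewrite -subr_eq0; apply/eqP.
have [_ un] := Jrep (ltnW id).
apply: (un V ((q i \o b) \- a : {linear _ -> _})) => h.
transitivity (w i ((q i \o b) \o h : {linear P i -> J i}) - w i (a \o h : {linear P i -> J i})).
  by rewrite -linearB; congr (w i _); apply: linear_ext.
have -> : w i ((q i \o b) \o h : {linear P i -> J i}) = w i (q i \o (b \o h) : {linear P i -> J i}).
  by congr (w i _); apply: linear_ext.
rewrite Jnat //.
have -> : w i.+1 ((b \o h) \o del i : {linear P i.+1 -> J i.+1}) = w i.+1 (b \o (h \o del i) : {linear _ -> _}).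
  by congr (w i.+1 _); apply: linear_ext.
by rewrite -bE -FE; apply/eqP; rewrite subr_eq0; apply/eqP; exact: (GE h).
Qed.

Lemma J_complex i : (i < d)%N -> forall z, q i (q i.+1 z) = 0.
Proof.
rewrite ltnS leq_eqVlt => /orP[/eqP-> z|id z]; first exact: exact_comp0 Jker.
have id1 : (i < d)%N by exact: ltnW.
have [_ un] := Jrep (ltnW id1).
apply: (un _ (q i \o q i.+1 : {linear _ -> _})) => h.
transitivity (w i (q i \o (q i.+1 \o h) : {linear P i -> J i})).
  by congr (w i _); apply: linear_ext.
rewrite Jnat //.
transitivity (w i.+1 (q i.+1 \o (h \o del i) : {linear P i.+1 -> J i.+1})).
  by congr (w i.+1 _); apply: linear_ext.
rewrite Jnat //.
have -> : ((h \o del i) \o del i.+1 : homR iota (P i.+2) (J i.+2)) = 0; last exact: linear0.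
have [_ Pex _] := hPa.
by apply: linear_ext => x /=; rewrite (exact_comp0 x (Pex i.+1)) linear0.
Qed.

(** By [functional_lift] the functional of a has to vanish on cocycles [P i.+1 -> V]. These are
    coboundaries because Ext^(i+1)(N, V) = 0, and coboundaries are killed because [q i] a = 0. *)
Lemma J_lift (V : lmodType A) i (a : {linear V -> J i.+1}) : M V -> (i < n)%N ->
  (forall x, q i (a x) = 0) -> exists b : {linear V -> J i.+2}, forall x, q i.+1 (b x) = a x.
Proof.
move=> hV i_n a0.
apply: (functional_lift (F := w i.+1 \o postcomp iota (P i.+1) a : {linear _ -> _})) => //.
move=> h h0.
have [||k kE] := Ext_vanishes_on (k := i.+1) _ hP (M_Ext hM hN hV _) h0; [lia|lia|].
transitivity (w i.+1 ((a \o k) \o del i : {linear P i.+1 -> J i.+1})).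
  by congr (w i.+1 _); apply: linear_ext => x; rewrite /= kE.
rewrite -Jnat; last by lia.
have -> : (q i \o (a \o k) : homR iota (P i) (J i)) = 0; last exact: linear0.
by apply: linear_ext => x; exact: a0.
Qed.

(** Exactness at an element y is [J_lift] for the map c |-> c y, since A lies in M. *)
Lemma J_coresolution : coresolution d.+1 q.
Proof.
split=> [i|i [->]//|i]; first exact: J_injective.
rewrite !ltnS leq_eqVlt => /orP[/eqP-> //|i_n].
move=> y; split=> [y0|[x <-]]; last exact: J_complex (ltnW i_n) x.
have aL : linear (fun c : A^o => (c : A) *: y) by move=> b c e; rewrite scalerDl scalerA.
have hV := M_projective coresolutions d1 hM hA (@regular_projective A).
have [|b bE] := J_lift (a := lin aL) hV i_n.
  by move=> c; rewrite /= linearZ_LR y0 scaler0.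
by exists (b 1); exact: etrans (bE 1) (scale1r y).
Qed.

Lemma tau_in_M : M (J d.+1).
Proof.
have [_ _ _ _ CT] := hM; apply/CT; split; first exact/ranked_finite_length/Jrk.
move=> [//|k] X kd hX; apply: vanishes_on_Ext => // P' del' eps' /augmentP hP'.
have e : d.+1 = (n - k.+1 + k).+3 by lia.
have := (balance hP' J_coresolution e).2; rewrite -e; apply=> c c0.
have [|b bE] := J_lift hX _ c0; first by lia.
by exists b => x; rewrite bE.
Qed.

Lemma scalar_bijective r (f : {linear N -> N}) :
  bijective (fun x => iota r *: f x) -> bijective f.
Proof.
move=> hb; apply: (ranked_inj_bij (M_ranked hM hN)); apply: linear_inj => x fx0.
by apply: (bij_inj hb); rewrite fx0 !linear0 !scaler0.
Qed.

(** As N is indecomposable, its non-invertible endomorphisms form an R-submodule of End(N); E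
    separates the class of the identity from zero in the quotient. *)
Lemma socle_functional : exists eta : {linear homR iota N N -> E},
  eta (idfun : {linear N -> N}) <> 0 /\
  forall f : {linear N -> N}, ~ bijective f -> eta f = 0.
Proof.
have rN := M_ranked hM hN.
pose U : set (homR iota N N) := [set f | ~ bijective (f : N -> N)].
have hU : submodule U.
  split.
    move=> [v vK _]; have [nz _] := iN; apply: nz => x.
    by rewrite -(vK x) -[in RHS](vK 0).
  move=> r f g Uf Ug.
  apply: (@indecomposable_add _ _ (r *: (f : homR iota N N) : {linear N -> N}) g) => //.
  by move=> /scalar_bijective.
have [Q [p [_ pP]]] := quotient_type hU.
have np : p (idfun : {linear N -> N}) <> 0.
  by move=> /pP; apply; exists idfun.
have [F Fp] := cogenerator hE hR np.
exists (F \o p); split=> // f /pP /= ->; exact: linear0.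
Qed.

Section Functional.
Variables (eta : {linear homR iota N N -> E}) (psi : {linear N -> J 0%N}).
Hypothesis eta1 : eta (idfun : {linear N -> N}) <> 0.
Hypothesis eta0 : forall f : {linear N -> N}, ~ bijective f -> eta f = 0.
Hypothesis psiE : forall f : {linear N -> N},
  w 0%N (psi \o (f \o eps) : {linear P 0%N -> J 0%N}) = eta f.

(** The maps [P 0 -> V] that matter in [functional_lift] vanish on the image of [del 0], so they are
    f eps with f : N -> V, and the functional takes there the value eta(h f). *)
Lemma psi_lift (V : lmodType A) (h : {linear V -> N}) :
  (forall f : {linear N -> V}, eta (h \o f : {linear N -> N}) = 0) ->
  exists b : {linear V -> J 1%N}, forall x, q 0%N (b x) = psi (h x).
Proof.
move=> hf; apply: (functional_lift (a := (psi \o h : {linear _ -> _}))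
   (F := w 0%N \o postcomp iota (P 0%N) (psi \o h) : {linear _ -> _})) => //.
move=> g g0; have [Pproj epsO h0 _] := hP.
have [|f fE] := onto_factor (f := g) epsO; first by move=> x /h0[y <-].
rewrite -(hf f) -psiE /=; congr (w 0%N _); apply: linear_ext => x /=.
by rewrite fE.
Qed.

Lemma psi_factor_eta (f : {linear N -> N}) (b : {linear N -> J 1%N}) :
  (forall x, psi (f x) = q 0%N (b x)) -> eta f = 0.
Proof.
move=> fb; rewrite -psiE.
transitivity (w 0%N (q 0%N \o (b \o eps) : {linear P 0%N -> J 0%N})).
  by congr (w 0%N _); apply: linear_ext => x; exact: fb.
rewrite Jnat //; have [_ _ h0 _] := hP.
have -> : ((b \o eps) \o del 0%N : homR iota (P 1%N) (J 1%N)) = 0; last exact: linear0.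
by apply: linear_ext => x /=; rewrite (exact_comp0 x h0) linear0.
Qed.

Lemma right_almost_split_of (W1 : lmodType A) (p : {linear W1 -> N}) (b : {linear W1 -> J 1%N}) :
  (forall x, psi (p x) = q 0%N (b x)) ->
  (forall (V : lmodType A) (f : {linear V -> N}) (c : {linear V -> J 1%N}), M V ->
     (forall x, psi (f x) = q 0%N (c x)) ->
     exists g : {linear V -> W1}, forall x, p (g x) = f x) ->
  right_almost_split M p.
Proof.
move=> pb Wl; split=> [[s sE]|V h hV nsh].
  apply: eta1; apply: (psi_factor_eta (b := (b \o s : {linear _ -> _}))) => x /=.
  by rewrite -pb sE.
have [|c cE] := psi_lift (h := h).
  move=> f; apply: eta0 => /bij_inverse[u [_ Ku]]; apply: nsh.
  by exists (f \o u) => y; exact: Ku.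
by apply: (Wl V h c) => // x; rewrite cE.
Qed.

(* If an endomorphism of tau_d N extends to J with H 0 o psi factoring through
   J 1, then it is nilpotent: H is J(u) for an endomorphism u of P, and eta
   vanishes on End(N) u, so u is nilpotent on N; a power of u on P is then
   null-homotopic up to a map P d -> ker (P d -> P n), which is nilpotent since
   that kernel is superfluous. *)
Lemma tau_endo_nilpotent (H : forall i, {linear J i -> J i}) (b : {linear N -> J 1%N}) :
  chain_map d q q H -> (forall x, H 0%N (psi x) = q 0%N (b x)) ->
  exists m, forall z, iter m (H d.+1) z = 0.
Proof.
move=> cH Hb; have [Pproj epsO h0 hS] := hP.
have U i : {u : {linear P i -> P i} | (i <= d)%N -> forall t : {linear P i -> J i},
    w i (H i \o t) = w i (t \o u)}.
  apply: cid; have [id|nid] := leqP i d; last by exists idfun.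
  have [u uE] := represents_full hE hR hiA (w i) (H i) (Prk i) (Prk i) (Jrep id).
  by exists u.
pose u i := sval (U i).
have uE i (id : (i <= d)%N) (t : {linear P i -> J i}) : w i (H i \o t) = w i (t \o u i).
  exact: (svalP (U i)).
have uC i : (i < d)%N -> forall x, del i (u i.+1 x) = u i (del i x).
  move=> id x; apply/eqP; rewrite -subr_eq0; apply/eqP.
  apply: (represents_faithful hE hR (u := (del i \o u i.+1) \- (u i \o del i) : {linear _ -> _})
    (Jrep (i := i.+1) id)) => t.
  transitivity (w i.+1 ((t \o del i) \o u i.+1 : {linear P i.+1 -> J i.+1})
     - w i.+1 ((t \o u i) \o del i : {linear P i.+1 -> J i.+1})).
    by rewrite -linearB; congr (w i.+1 _); apply: linear_ext => y; rewrite /= linearB.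
  rewrite -uE // -Jnat //.
  have -> : w i.+1 (H i.+1 \o (t \o del i) : {linear P i.+1 -> J i.+1}) =
            w i.+1 ((H i.+1 \o t) \o del i : {linear P i.+1 -> J i.+1}).
    by congr (w i.+1 _); apply: linear_ext.
  rewrite -Jnat //.
  have -> : w i (q i \o (H i.+1 \o t) : {linear P i -> J i}) = w i (H i \o (q i \o t) : {linear P i -> J i}).
    by congr (w i _); apply: linear_ext => y /=; rewrite cH // ltnW.
  rewrite uE ?(ltnW id) //; apply/eqP; rewrite subr_eq0; apply/eqP.
  by congr (w i _); apply: linear_ext.
have [|v vE] := onto_factor (f := (eps \o u 0%N : {linear _ -> _})) epsO.
  by move=> x /h0[y <-] /=; rewrite -uC // (exact_comp0 _ h0).
(* With an inverse v' of v, eta(1) = eta(v' v) would be the value of [w 0] on [H 0] psi v' eps,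
   which factors through [q 0] and so gives zero. *)
have nv : ~ bijective v.
  move=> /bij_inverse[v' [_ Kv']]; apply: eta1.
  have -> : (idfun : homR iota N N) = (v' \o v : {linear N -> N}).
    by apply: linear_ext => x /=; apply/esym; have [v2 [v2K _]] := bij_inverse (f := v)
      (ranked_onto_bij (M_ranked hM hN) (fun y => ex_intro _ (v' y) (Kv' y))); rewrite -[LHS]v2K Kv' v2K.
  rewrite -psiE.
  transitivity (w 0%N ((psi \o (v' \o eps)) \o u 0%N : {linear P 0%N -> J 0%N})).
    by congr (w 0%N _); apply: linear_ext => x /=; rewrite vE.
  rewrite -uE //.
  transitivity (w 0%N (q 0%N \o (b \o (v' \o eps)) : {linear P 0%N -> J 0%N})).
    by congr (w 0%N _); apply: linear_ext => x /=; rewrite Hb.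
  rewrite Jnat //.
  have -> : ((b \o (v' \o eps)) \o del 0%N : homR iota (P 1%N) (J 1%N)) = 0; last exact: linear0.
  by apply: linear_ext => x /=; rewrite (exact_comp0 x h0) !linear0.
have [m vm] := indecomposable_nilpotent (M_ranked hM hN) iN nv.
pose um i := lin (linear_iter (u i) m).
pose g i : {linear augment N P i -> augment N P i} :=
  match i with 0%N => lin (linear_iter v m) | j.+1 => um j end.
have [_ Paex Paproj] := hPa.
have gC : chain_map d (augment_del del eps) (augment_del del eps) g.
  case=> [_ z|i id z] /=.
    by elim: m {vm um g} => //= m IH; rewrite -IH vE.
  by elim: m {vm um g} => //= m IH; rewrite uC // IH.
have [|||s sE] := @homotopy_right_left A d _ _ _ _ g \0 gC.
- by move=> i _ z; exact: (exact_comp0 z (Paex i)).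
- by move=> z; rewrite /= vm linear0.
- move=> i _ f f0; apply: projective_factor; first exact: Paproj.
  by move=> x; apply/(Paex i).
pose e : {linear P d -> P d} := um d \- ((s : {linear P n -> P d}) \o del n).
have e0 z : del n (e z) = 0.
  by rewrite /e /= linearB; have /= -> := sE z; rewrite subrr.
have [k [k0 _ ek]] := fitting e (Prk d).
have enil : forall x, iter k e x = 0.
  have kerT : [set x | lin (linear_iter e k) x = 0] = setT.
    apply: Psup; first exact: kernel_submodule.
    move=> x; have [y yE] := ek x.
    exists (x - iter k e y), (iter k e y); split; last by rewrite subrK.
      apply: etrans (linearB (lin (linear_iter e k)) x (iter k e y)) _.
      by rewrite /= yE subrr.
    by rewrite -(prednK k0) /= e0.
  by move=> x; have : [set x | lin (linear_iter e k) x = 0] x by rewrite kerT.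
have [qe qeE] := represents_map (w d) e (Jrep (leqnn d)).
have [qs qsE] := represents_map (w n) (s : {linear P n -> P d}) (Jrep (leqnn d)).
have umE j (t : {linear P d -> J d}) :
    w d (lin (linear_iter (H d) j) \o t) = w d (t \o lin (linear_iter (u d) j)).
  elim: j t => [|j IHj] t; first by congr (w d _); apply: linear_ext.
  transitivity (w d (H d \o (lin (linear_iter (H d) j) \o t) : {linear P d -> J d})).
    by congr (w d _); apply: linear_ext.
  rewrite uE //.
  transitivity (w d (lin (linear_iter (H d) j) \o (t \o u d) : {linear P d -> J d})).
    by congr (w d _); apply: linear_ext.
  by rewrite IHj; congr (w d _); apply: linear_ext.
(* The decomposition of [um d] into e and s [del n], carried to [J d]. The second summand factors
   through [q n], so it vanishes on the image of [q d]. *)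
have HmE z : iter m (H d) z = qe z + qs (q n z).
  apply/eqP; rewrite -subr_eq0; apply/eqP; have [_ un] := Jrep (leqnn d).
  apply: (un _ (lin (linear_iter (H d) m) \- (qe \+ (qs \o q n)) : {linear J d -> J d})) => t.
  transitivity (w d (lin (linear_iter (H d) m) \o t : {linear P d -> J d})
     - (w d (qe \o t : {linear P d -> J d}) + w d (qs \o (q n \o t) : {linear P d -> J d}))).
    by rewrite -linearD -linearB; congr (w d _); apply: linear_ext.
  rewrite umE qeE qsE.
  have -> : w n ((q n \o t) \o (s : {linear P n -> P d}) : {linear P n -> J n}) =
            w n (q n \o (t \o (s : {linear P n -> P d})) : {linear P n -> J n}).
    by congr (w n _); apply: linear_ext.
  rewrite Jnat // -linearD -linearB.
  rewrite [X in w d X](_ : _ = 0); first exact: linear0.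
  apply: linear_ext => x; rewrite hom_zeroE.
  transitivity (t (um d x) - (t (e x) + t (s (del n x)))); first by [].
  by rewrite -linearD /e /= subrK subrr.
have qe0 z : iter k qe z = 0.
  have [_ un] := Jrep (leqnn d); apply: (un _ (lin (linear_iter qe k))) => t.
  have -> : w d (lin (linear_iter qe k) \o t) = w d (t \o lin (linear_iter e k)).
    elim: k {k0 ek enil} t => [|j IHj] t; first by congr (w d _); apply: linear_ext.
    transitivity (w d (qe \o (lin (linear_iter qe j) \o t) : {linear P d -> J d})).
      by congr (w d _); apply: linear_ext.
    rewrite qeE.
    transitivity (w d (lin (linear_iter qe j) \o (t \o e) : {linear P d -> J d})).
      by congr (w d _); apply: linear_ext.
    by rewrite IHj; congr (w d _); apply: linear_ext.
  rewrite [X in w d X](_ : _ = 0); first exact: linear0.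
  by apply: linear_ext => x; rewrite hom_zeroE /= enil linear0.
have Hq j z : q d (iter j (H d.+1) z) = iter j (H d) (q d z).
  by elim: j => //= j <-; rewrite cH.
exists (k * m)%N => z; apply: (injective_eq0 Jmono).
rewrite Hq.
have -> : iter (k * m) (H d) (q d z) = iter k qe (q d z).
  elim: k {k0 ek enil qe0} => // j IHj.
  rewrite mulSn iterD IHj /= HmE.
  have -> : q n (iter j qe (q d z)) = 0; last by rewrite linear0 addr0.
  by rewrite -IHj -Hq (exact_comp0 _ Jker).
exact: qe0.
Qed.

End Functional.

Lemma translate_almost_split :
  exists (C : nat -> lmodType A) (dC : forall i, {linear C i.+1 -> C i})
    (e : {linear C 0%N -> N}),
  almost_split_complex d M (augment_del dC e) /\
  exists t : {linear augment N C d.+1 -> J d.+1}, bijective t.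
Proof.
have [eta [eta1 eta0]] := socle_functional.
have [Pproj epsO h0 hS] := hP.
have [|F FE] := @injective_factor _ _ _ _ (precomp iota N eps) eta
    (standard_injective_module hE).
  move=> f f0; suff -> : f = 0 by rewrite linear0.
  apply: linear_ext => x; have [y <-] := epsO x.
  exact: (congr1 (fun k : homR iota (P 0%N) N => k y) f0).
have [psi psiF] := (Jrep (leq0n d)).1 N F.
have psiE (f : {linear N -> N}) :
  w 0%N (psi \o (f \o eps) : {linear P 0%N -> J 0%N}) = eta f by rewrite -psiF; exact: FE.
have [W [dW [s [s0 [WM [Wmono Wex] [sC sE [s0' s0K s0K'] sB] Wl Wlift]]]]] :=
  realize_extension hA coresolutions d1 hM psi J_coresolution Jrk tau_in_M (M_ranked hM hN).
have s0B : bijective s0 by exists s0'.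
have W1M : M (W 1%N) by apply: WM.
pose p : {linear W 1%N -> N} := s0 \o dW 0%N.
have pb x : psi (p x) = q 0%N (s 1%N x) by rewrite /p /= -sE sC.
have pras : right_almost_split M p.
  apply: (right_almost_split_of eta1 eta0 psiE pb) => V f c hV fc.
  by have [g gE] := Wl V f c hV fc; exists g => x; exact: gE.
have pO := right_almost_split_onto hA coresolutions d1 hM nN pras.
have [C [dC [e hC]]] := almost_split_exists hA coresolutions d1 hM hN iN nN W1M pras.
exists C, dC, e; split=> //.
set Q := augment N C; set dQ := augment_del dC e.
have [Qex Qrad Qras _] := hC; have [QM QO Qexact Qmono] := Qex.
have cQ := exactM_complex Qex.
have WexM : exactM d M dW.
  split=> //; last 1 first.
  - move=> y; have [x xE] := pO (s0 y); exists x; exact: (bij_inj s0B).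
  by case=> [_|i id]; [exact/(M_iso hM s0B)|apply: WM].
have cW := exactM_complex WexM.
have [t0 [t0K Kt0]] := bij_inverse s0B.
have [Qns Ql] := Qras; have [pns pl] := pras.
have Q1M : M (Q 1%N) by apply: QM.
(* Each of the two right almost split maps factors through the other, which starts chain maps in
   both directions. *)
have [c1 c1E] := pl _ (dQ 0%N) Q1M Qns.
have [k1 k1E] := Ql _ p W1M pns.
have [||c [cC c0 _]] := @chain_map_lift A d Q W dQ dW t0 c1 cQ.
- by move=> z; apply: (bij_inj s0B); rewrite Kt0 -c1E.
- by move=> i id f; apply: (exactM_lift hA d1 hM WexM) => //; apply: QM; lia.
have [||th [thC th0 _]] := @chain_map_lift A d W Q dW dQ s0 k1 cW.
- by move=> z; rewrite k1E.
- by move=> i id f; apply: (exactM_lift hA d1 hM Qex) => //; apply: WM; lia.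
have eb : bijective (th d.+1 \o c d.+1).
  apply: (endo_iso hA d1 hM Qex Qrad (e := fun i => th i \o c i)).
    by move=> i id z /=; rewrite thC // cC.
  by move=> z /=; rewrite th0 c0 Kt0.
(* As W is not minimal, [endo_iso] covers only th c. For c th, its difference g from the identity is
   shown to be nilpotent at the left end. *)
pose g i : {linear W i -> W i} := idfun \- (c i \o th i).
have gC : chain_map d dW dW g.
  by move=> i id z; rewrite /g /= linearB cC // thC.
have [||k kE] := @homotopy_right_left A d W W dW dW g \0 gC cW.
- by move=> z; rewrite /g /= th0 c0 t0K subrr linear0.
- by move=> i id f; apply: (exactM_lift hA d1 hM WexM) => //; apply: WM; lia.
have gk z : g d.+1 z = k (dW d z) by apply: Wmono; exact: kE.
have [r [rK Kr]] := bij_inverse sB.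
pose hT : {linear J d.+1 -> J d.+1} := s d.+1 \o g d.+1 \o r.
have [||||H [HC Hd]] := @chain_map_extend A d J J q q hT.
- by move=> i id; exact: J_injective.
- by move=> z /(injective_eq0 Jmono) ->; rewrite !linear0.
- by move=> i id; have [_ _] := J_coresolution; apply.
- exact: J_complex.
(* At the left end [eps'] factors through [dW d], because g does. Moved to the right end, this makes
   [H 0] psi factor through [q 0], as [tau_endo_nilpotent] requires. *)
pose eps' i : {linear W i -> J i} := H i \o s i.
have [|||||b bE] := @homotopy_left_right A d W J dW q eps' (s d.+1 \o k).
- by move=> i id z; rewrite /eps' /= HC // sC.
- exact: J_complex.
- by case: WexM.
- by move=> z; rewrite /eps' Hd /hT /= rK -gk.
- move=> i id f f0; apply: injective_factor; first exact: J_injective.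
  by move=> x /(Wex i id)[y <-].
have [|m Hm] := tau_endo_nilpotent eta1 psiE (b := (b \o t0 : {linear _ -> _})) HC.
  by move=> x; rewrite /= -bE /eps' /= sE Kt0.
have gm z : iter m (g d.+1) z = 0.
  apply: (bij_inj sB); rewrite linear0 -(Hm (s d.+1 z)) Hd.
  by elim: m {Hm} => // m IH; rewrite iterS [RHS]iterS -IH /hT /= rK.
have T := nilpotent_one_sub (M_ranked hM (WM d.+1 (leqnn _))) gm.
have cthB : bijective (c d.+1 \o th d.+1).
  by apply: (eq_bij T) => z; rewrite /g /= opprB addrC subrK.
have cB : bijective (c d.+1).
  apply: onto_inj_bij => [y|]; first by have [z <-] := bij_onto cthB y; exists (th d.+1 z).
  by move=> x y xy; apply: (bij_inj eb); rewrite /= xy.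
exists (s d.+1 \o c d.+1); exact: bij_comp.
Qed.

End Translate.

Lemma is_dual_iso (R : comNzRingType) (E : lmodType R) (A B : pzRingType)
    (iota : R -> A) (op : B -> A) (X : lmodType A) (Y Y' : lmodType B)
    (t : {linear Y' -> Y}) :
  bijective t -> is_dual E iota op X Y -> is_dual E iota op X Y'.
Proof.
move=> tB [phi [phiL phiI phiO phiD phiZ]]; exists (phi \o t); split=> [q|q q' h|f fL|q q' x|b q x] /=.
- exact: phiL.
- exact/(bij_inj tB)/phiI.
- by have [y yE] := phiO f fL; have [q qE] := bij_onto tB y; exists q => x; rewrite /= qE.
- by rewrite linearD phiD.
- by rewrite (linearZ_LR t) phiZ.
Qed.

Lemma is_dual_unique (R : comNzRingType) (E : lmodType R) (A B : pzRingType)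
    (iota : central_map R A) (op : opp_iso B A) (X : lmodType A) (Y : lmodType B) :
  is_dual E iota op X Y -> exists t : {linear Y -> dual E iota op X}, bijective t.
Proof.
move=> [phi [phiL phiI phiO phiD phiZ]].
have tL : linear (fun y => lin (phiL y : linear (phi y : restr iota X -> E)) : dual E iota op X).
  move=> b y y'; apply: linear_ext => x /=.
  by rewrite phiD phiZ.
exists (lin tL); apply: onto_inj_bij => [f|y y' yy'].
  have [|y yE] := phiO f; first by move=> r x x'; exact: (linearP f r (x : restr iota X) x').
  by exists y; apply: linear_ext.
by apply: phiI => x; exact: (congr1 (fun f : dual E iota op X => f x) yy').
Qed.

(* Replaces the terms J k, k > n, by T. *)
Lemma splice_left (A : pzRingType) (T : lmodType A) n (J : nat -> lmodType A)
    (q : forall i, {linear J i.+1 -> J i}) (u : {linear T -> J n}) :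
  exists (J' : nat -> lmodType A) (q' : forall i, {linear J' i.+1 -> J' i})
    (s : forall i, {linear J' i -> J i}) (k : {linear J' n.+1 -> T}),
  [/\ forall i, (i <= n)%N -> bijective (s i), bijective k,
      forall i, (i < n)%N -> forall x, s i (q' i x) = q i (s i.+1 x)
    & forall x, s n (q' n x) = u (k x)].
Proof.
elim: n J q u => [|n IH] J q u.
  pose J' i : lmodType A := if i is i'.+1 then T else J 0%N.
  pose q' i : {linear J' i.+1 -> J' i} := match i with 0%N => u | i'.+1 => idfun end.
  pose s i : {linear J' i -> J i} := match i with 0%N => idfun | i'.+1 => \0 end.
  exists J', q', s, idfun; split=> //; last by exists idfun.
  by case=> // _; exists idfun.
have [J' [q' [s [k [sB kB sq sn]]]]] := IH (fun i => J i.+1) (fun i => q i.+1) u.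
pose J'' i : lmodType A := if i is i'.+1 then J' i' else J 0%N.
pose q'' i : {linear J'' i.+1 -> J'' i} :=
  match i with 0%N => q 0%N \o s 0%N | i'.+1 => q' i' end.
pose s'' i : {linear J'' i -> J i} := match i with 0%N => idfun | i'.+1 => s i' end.
exists J'', q'', s'', k; split=> //.
  by case=> [|i] id; [exists idfun|exact: sB].
by case=> [|i] id x //; exact: sq.
Qed.

(** * The almost split complex ending in N, with its left end identified *)

Section Core.
Variables (R : comNzRingType) (E : lmodType R).
Hypothesis hE : standard_injective E.
Hypothesis hR : ranked (R^o : lmodType R).
Variables (A B : pzRingType) (iotaA : central_map R A) (iotaB : central_map R B).
Variable op : opp_iso B A.
Hypothesis iotaAB : forall r, op (iotaB r) = iotaA r.
Hypothesis hiA : ranked (restr iotaA A^o).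

Let hA : ranked (A^o : lmodType A) := ranked_ring hiA.

Lemma iotaBA' r : opp_sym op (iotaA r) = iotaB r.
Proof. by rewrite /= -iotaAB oopK. Qed.

Lemma coresolutions : has_coresolutions A.
Proof.
have fA := @regular_finitely_generated A.
have [w [hw _]] := nakayama_represents E iotaAB (@regular_projective A) fA.
exact: (coresolution_exists hE hR hw (ranked_nakayama hE hR iotaAB hiA hA)).
Qed.

Variables (n : nat) (M : lmodType A -> Prop).
Hypothesis hM : cluster_tilting n.+1 M.

(** Finite length of T is recorded for the dual assertion, where T is recovered from its double
    dual. *)
Lemma core_almost_split (N : lmodType A) :
  M N -> indecomposable N -> ~ projective_module N ->
  exists (C : nat -> lmodType A) (dC : forall i, {linear C i.+1 -> C i})
    (e : {linear C 0%N -> N}),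
  almost_split_complex n.+1 M (augment_del dC e) /\
  exists (K : lmodType A) (T : lmodType B),
  [/\ is_nth_syzygy n N K, is_transpose op K T, ranked T
    & is_dual E iotaB (opp_sym op) T (augment N C n.+2)].
Proof.
move=> hN iN nN.
have [K [P [p [i [e [/bij_inverse[e' [eK Ke]] hp Prk hi]]]]]] :=
  minimal_resolution_exists hA (M_ranked hM hN).
pose del := splice_del p i.
have hP := splice_resolution eK Ke hp hi.
have Pproj k : projective_module (P k) by case: (hp k).
have Pfg k : finitely_generated (P k) by exact: ranked_finitely_generated.
have w k := cid (nakayama_represents E iotaAB (Pproj k) (Pfg k)).
pose J k := nakayama E iotaB op (P k).
pose q k : {linear J k.+1 -> J k} := dual_map E iotaB (opp_sym op) (star_map op (del k)).
(* As [del n] is a minimal presentation of the syzygy [K n], this cokernel is the transpose of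
   [K n]; its dual is the kernel of [q n]. *)
have [T [c [cO cex]]] := cokernel_type (star_map op (del n)).
have hT : ranked T := ranked_onto cO (ranked_star iotaAB hiA (Prk n.+1)).
pose D := dual E iotaB (opp_sym op).
pose u : {linear D T -> J n.+1} := dual_map E iotaB (opp_sym op) c.
have uI : injective u by exact: dual_inj.
have uex : exact_at u (q n) by exact: (dual_exact hE cex).
have [J' [q' [s [k [sB kB sq sn]]]]] := splice_left q u.
have J'rk j : (j <= n.+2)%N -> ranked (J' j).
  rewrite leq_eqVlt => /orP[/eqP->|jn].
    apply: (ranked_inj (bij_inj kB)); apply: (dual_ranked hE hR (iotaB := iotaA)) => //.
      exact: iotaBA'.
    exact: (ranked_opp iotaAB hiA).
  by apply: (ranked_inj (bij_inj (sB j jn))); exact: (ranked_nakayama hE hR iotaAB hiA).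
pose w' j : {linear homR iotaA (P j) (J' j) -> E} := sval (w j) \o postcomp iotaA (P j) (s j).
have [|||C [dC [eps [hC [t tB]]]]] := @translate_almost_split R E hE hR A iotaA hiA coresolutions
  n M hM N hN iN nN P del (splice_eps p e') hP Prk
  (splice_superfluous hp hi (n := n)) J' q' w'
  (fun j jd => represents_iso (sB j jd) (svalP (w j)).1) J'rk _ _ _.
- move=> j jd t.
  transitivity (sval (w j) (q j \o (s j.+1 \o t) : {linear P j -> J j})).
    by rewrite /w' /=; congr (sval (w j) _); apply: linear_ext => x /=; rewrite sq.
  rewrite (nakayama_natural (del j) (Pproj j) (Pfg j) (svalP (w j)).2 (svalP (w j.+1)).2).
  by rewrite /w' /=; congr (sval (w j.+1) _); apply: linear_ext.
- apply: linear_inj => x x0; apply: (injective_eq0 (bij_inj kB)); apply: (injective_eq0 uI).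
  by rewrite -sn x0 linear0.
- have sI := bij_inj (sB n (leqnSn n)); have sI1 := bij_inj (sB n.+1 (leqnn _)).
  have [k' [k'K Kk']] := bij_inverse kB.
  move=> y; split=> [y0|[x <-]].
    have [x xE] : exists x, u x = s n.+1 y by apply/uex; rewrite -sq // y0 linear0.
    by exists (k' x); apply: sI1; rewrite sn Kk'.
  by apply: (injective_eq0 sI); rewrite sq // sn (exact_comp0 _ uex).
- exists C, dC, eps; split=> //.
  exists (K n), T; split=> //; first exact: (splice_nth_syzygy eK Ke hp hi).
    2: exact: (is_dual_iso (t := k \o t) (bij_comp kB tB) (dual_is_dual _ _ _ _)).
  exists (P n.+1), (P n), (del n), (p n); split.
    split; first exact: hp.
    split; [exact: Pproj| |exact: (splice_superfluous hp hi)].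
    move=> y; have [iI ip] := hi n; have [_ pO _] := hp n.+1.
    split=> [/ip[x <-]|[x <-]]; last exact: (exact_comp0 _ ip).
    by have [z <-] := pO x; exists z.
  exists (star op (P n)), (star op (P n.+1)), (fun f => f), (fun f => f),
    (star_map op (del n)), c.
  by split=> //; exact: star_is_star.
Qed.

End Core.

(** If g fixes the first map, exactness gives g = 1 + k [del 1], which is invertible as [del 1] is
    in the radical; the last map is treated dually. For d = 1 these neighbouring maps are the end
    maps, so the hypothesis includes both ends. *)
Lemma d_almost_split_of_radical (A : pzRingType) (M : lmodType A -> Prop) d
    (C : nat -> lmodType A) (del : forall i, {linear C i -> C i.+1}) :
  (1 <= d)%N -> d_exact M d del -> (forall i, (i <= d)%N -> in_radical (del i)) ->
  left_almost_split M (del 0%N) -> right_almost_split M (del d) ->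
  d_almost_split M d del.
Proof.
case: d => // d _ ex rad las ras; have [CM _ exl exr] := ex.
split=> //; last by move=> i /andP[_ id]; apply: rad; lia.
- split=> // g gE; have [_ h] := exr (C 1%N) (CM 1%N isT).
  have [|k kE] := h 0%N (g \- idfun : {linear _ -> _}) isT.
    by move=> x /=; rewrite gE subrr.
  have /eq_bij := comp_bij_inv (f := \- k) (g := del 1%N) (rad 1%N isT (\- k : {linear _ -> _})).
  apply=> x /=.
  by rewrite kE opprK addrCA subrr addr0.
split=> // g gE; have [_ h] := exl (C d.+1) (CM d.+1 (leqnSn _)).
have [|k kE] := h d (g \- idfun : {linear _ -> _}) (ltnSn d).
  by move=> x /=; rewrite linearB gE subrr.
have /eq_bij := rad d (leqnSn d) (\- k : {linear _ -> _}).
by apply=> x /=; rewrite linearN opprK kE addrCA subrr addr0.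
Qed.

(** * Passage to ascending indices *)

Section Reverse.
Variables (A : pzRingType) (Q : nat -> lmodType A) (dQ : forall i, {linear Q i.+1 -> Q i}).

Lemma iter_predn n j : iter j predn n = (n - j)%N.
Proof. by elim: j => [|j /= ->]; rewrite ?subn0 // subnS. Qed.

Definition del_pred m : {linear Q m -> Q m.-1} := match m with 0%N => idfun | k.+1 => dQ k end.

(* The index n - j is written iter j predn n, which makes the type of the
   differential reduce. *)
Definition reverse n j : lmodType A := Q (iter j predn n).
Definition reverse_del n j : {linear reverse n j -> reverse n j.+1} :=
  del_pred (iter j predn n).

End Reverse.

Section ReverseAlmostSplit.
Variables (A : pzRingType).
Hypothesis hA : ranked (A^o : lmodType A).
Hypothesis coresolutions : has_coresolutions A.
Variables (d : nat) (M : lmodType A -> Prop).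
Hypothesis d1 : (1 <= d)%N.
Hypothesis hM : cluster_tilting d M.

Lemma reverse_almost_split (Q : nat -> lmodType A) (dQ : forall i, {linear Q i.+1 -> Q i}) :
  almost_split_complex d M dQ -> d_almost_split M d (reverse_del dQ d.+1).
Proof.
move=> [hC rad ras las]; have [CM CO Cex Cmono] := hC.
have idx i : (i < d)%N -> exists2 m, (m < d)%N & iter i predn d.+1 = m.+2.
  by move=> id; exists (d - i.+1)%N; rewrite ?iter_predn; lia.
have idxd : iter d predn d.+1 = 1%N by rewrite iter_predn subSnn.
apply: d_almost_split_of_radical => //; last 2 first.
- move=> i id; rewrite /reverse_del /reverse /=.
  have -> : iter i predn d.+1 = (d - i).+1 by rewrite iter_predn; lia.
  by apply: rad; lia.
- by rewrite /reverse_del /reverse /= idxd.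
- split=> [i id|i x id|X hX|X hX].
  + by apply: CM; rewrite iter_predn; lia.
  + have [m md mE] := idx i id; move: x; rewrite /reverse_del /reverse /= mE => x /=.
    exact: (exact_comp0 x (Cex m md)).
  + split=> [h h0 x|i]; first exact: (injective_eq0 Cmono (h0 x)).
    rewrite /reverse_del /reverse /= => h id; move: h; have [m md ->] := idx i id => h h0.
    exact: (exactM_lift hA d1 hM hC hX md h0).
  + split=> [|i].
      rewrite /reverse_del /reverse /= idxd => h h0 x; have [y <-] := CO x; exact: h0.
    rewrite /reverse_del /reverse /= => h id; move: h; have [m md ->] := idx i id => h h0.
    exact: (exactM_extend hA coresolutions d1 hM hC hX md h0).
Qed.
End ReverseAlmostSplit.

Lemma dual_prod (R : comNzRingType) (E : lmodType R) (A B : pzRingType)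
    (iota : central_map R A) (op : opp_iso B A) (X Y : lmodType A) :
  exists s : {linear dual E iota op (X * Y)%type -> (dual E iota op X * dual E iota op Y)%type},
    bijective s.
Proof.
have l1 : linear (fun x : X => (x, 0 : Y)).
  by move=> a x y; congr pair; rewrite /= ?scaler0 ?addr0.
have l2 : linear (fun y : Y => (0 : X, y)).
  by move=> a x y; congr pair; rewrite /= ?scaler0 ?addr0.
pose D1 := dual_map E iota op (lin l1); pose D2 := dual_map E iota op (lin l2).
have sL : linear (fun f => (D1 f, D2 f)) by move=> b f g; rewrite !linearP.
exists (lin sL); pose P1 := dual_map E iota op (fst : {linear (X * Y)%type -> X}).
pose P2 := dual_map E iota op (snd : {linear (X * Y)%type -> Y}).
exists (fun fg => P1 fg.1 + P2 fg.2) => [f|[f g]].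
  apply: linear_ext => -[x y].
  transitivity (f ((x, 0) + (0, y)) : E).
    exact: esym (linearD (f : {linear restr iota (X * Y)%type -> E}) (x, 0) (0, y)).
  by congr (f _); congr pair; rewrite /= ?addr0 ?add0r.
congr pair; apply: linear_ext => x.
  by transitivity (f x + g 0 : E); last by rewrite (linear0 g) addr0.
by transitivity (f 0 + g x : E); last by rewrite (linear0 f) add0r.
Qed.

(** * Duality for Ext and for cluster-tilting subcategories *)

Section ExtDuality.
Variables (R : comNzRingType) (E : lmodType R).
Hypothesis hE : standard_injective E.
Hypothesis hR : ranked (R^o : lmodType R).
Variables (A B : pzRingType) (iotaA : central_map R A) (iotaB : central_map R B).
Variable op : opp_iso B A.
Hypothesis iotaAB : forall r, op (iotaB r) = iotaA r.
Hypothesis hiA : ranked (restr iotaA A^o).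

Notation D := (dual E iotaA op).
Notation D' := (dual E iotaB (opp_sym op)).
Notation Dmap := (dual_map E iotaA op).
Notation D'map := (dual_map E iotaB (opp_sym op)).

Let iotaBA := iotaBA iotaAB.
Let hiB : ranked (restr iotaB B^o) := ranked_opp iotaAB hiA.
Let hA : ranked (A^o : lmodType A) := ranked_ring hiA.
Let hB : ranked (B^o : lmodType B) := ranked_ring hiB.

Lemma dual_ranked' (Y : lmodType B) : ranked Y -> ranked (D' Y).
Proof. exact: (dual_ranked hE hR iotaBA hiB). Qed.

Definition eval' (Y : lmodType B) : {linear Y -> D (D' Y)} :=
  flip iotaAB (X := D' Y) (Y := Y) idfun.

Lemma eval_inj' (Y : lmodType B) : injective (eval' Y).
Proof.
apply: linear_inj => y ey0.
apply: (dual_separates hE hR (iotaA := iotaB) (op := opp_sym op)) => f.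
exact: (congr1 (fun F : D (D' Y) => F f) ey0).
Qed.

Lemma eval_bij' (Y : lmodType B) : ranked Y -> bijective (eval' Y).
Proof.
move=> hY; apply: onto_inj_bij; last exact: eval_inj'.
move=> F; have [y yE] := bij_onto (eval_bij hE hR iotaBA hiB hY) F.
by exists y; apply: linear_ext => f; rewrite -yE.
Qed.

Lemma ranked_of_dual' (Y : lmodType B) : ranked (D' Y) -> ranked Y.
Proof.
move=> hY; apply: (ranked_inj (@eval_inj' Y)).
exact: (dual_ranked hE hR iotaAB hiA hY).
Qed.

(* Hom_B(P, D Z) = Hom_A(Z, D P), and D turns the projective resolution P into
   an injective one, so this is balance of Ext. *)
Lemma vanishes_dual (P : nat -> lmodType B) (dP : forall i, {linear P i.+1 -> P i})
    (Q : nat -> lmodType A) (dQ : forall i, {linear Q i.+1 -> Q i}) k :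
  augmented_resolution dP -> augmented_resolution dQ ->
  vanishes_on dP k.+1 (D (Q 0%N)) <-> vanishes_on dQ k.+1 (D' (P 0%N)).
Proof.
move=> [PO Pex Pproj] hQ.
pose J i : lmodType A := D' (reverse P k.+3 i).
have -> : D' (P 0%N) = J (0 + k).+3 by rewrite /J /reverse iter_predn subnn.
pose dJ i : {linear J i.+1 -> J i} := D'map (reverse_del dP k.+3 i).
have hJ : coresolution k.+3 dJ.
  split=> i.
  - move=> ik; rewrite /J /reverse iter_predn.
    have -> : (k.+3 - i)%N = (k.+3 - i).-1.+1 by lia.
    exact: (dual_injective hE iotaAB (Pproj _)).
  - move=> [->]; have e : iter k.+2 predn k.+3 = 1%N by rewrite iter_predn subSnn.
    change (injective (D'map (del_pred dP (iter k.+2 predn k.+3)))); rewrite e.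
    exact: dual_inj.
  move=> ik; change (exact_at (D'map (del_pred dP (iter i predn k.+3).-1))
    (D'map (del_pred dP (iter i predn k.+3)))).
  have -> : iter i predn k.+3 = (k.+1 - i).+2 by rewrite iter_predn; lia.
  exact: dual_exact.
rewrite (balance hQ hJ (k := k) (b := 0%N) erefl); split=> H.
  move=> c c0; have [|h hE'] := H (flip iotaAB c).
    move=> x; apply: linear_ext => z; rewrite flipE.
    exact: (congr1 (fun f : D' (P k.+3) => f x) (c0 z)).
  have [h' h'E] := flip_back iotaAB h.
  exists h' => z; apply: linear_ext => x; rewrite dual_mapE h'E -hE'.
  by rewrite flipE.
move=> f f0; have [c cE] := flip_back iotaAB f.
have [|h hE'] := H c.
  move=> z; apply: linear_ext => x; rewrite dual_mapE cE f0 //.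
exists (flip iotaAB h) => x; apply: linear_ext => z.
rewrite flipE -cE hE' //.
Qed.

Lemma Ext_dual k (X : lmodType B) (Z : lmodType A) : (0 < k)%N ->
  ranked X -> ranked Z -> Ext_vanishes k X (D Z) <-> Ext_vanishes k Z (D' X).
Proof.
case: k => // k _ hX hZ; split=> H.
  have [P [dP [eps hP]]] := resolution_exists hB hX.
  apply: vanishes_on_Ext => // Q dQ eta /augmentP hQ.
  exact/(vanishes_dual k (augmentP hP) hQ)/Ext_vanishes_on.
have [Q [dQ [eta hQ]]] := resolution_exists hA hZ.
apply: vanishes_on_Ext => // P dP eps /augmentP hP.
exact/(vanishes_dual k hP (augmentP hQ))/Ext_vanishes_on.
Qed.

Lemma Ext_iso k (C : pzRingType) (X Y Y' : lmodType C) (s : {linear Y -> Y'}) :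
  (0 < k)%N -> bijective s -> Ext_vanishes k X Y -> Ext_vanishes k X Y'.
Proof.
move=> k0 sB H; apply: vanishes_on_Ext => // P dP eps hP.
exact/(vanishes_on_iso _ _ sB)/Ext_vanishes_on.
Qed.

Section DualClusterTilting.
Variables (d : nat) (M : lmodType A -> Prop).
Hypothesis hM : cluster_tilting d M.

(** Defined through D' rather than as the class of all D Z, so that closure properties are inherited
    directly from M. *)
Definition dual_subcategory (Y : lmodType B) : Prop := M (D' Y).
Local Notation M' := dual_subcategory.

Lemma M'_ranked Y : M' Y -> ranked Y.
Proof. by move=> /(M_ranked hM)/ranked_of_dual'. Qed.

Lemma M'_dual Z : M Z -> M' (D Z).
Proof.
by move=> hZ; apply/(M_iso hM (eval_bij hE hR iotaAB hiA (M_ranked hM hZ))).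
Qed.

Lemma inverse_eval Z : ranked Z -> exists e : {linear D' (D Z) -> Z},
  (forall f, e f = 0 -> f = 0) /\ forall F x, (forall f : D Z, (F : D' (D Z)) f = f x) -> e F = x.
Proof.
move=> hZ; have [e [eK Ke]] := bij_inverse (eval_bij hE hR iotaAB hiA hZ).
exists e; split=> [f f0|F x Fx]; first by rewrite -[f]Ke f0 linear0.
by rewrite -[RHS]eK; congr (e _); apply: linear_ext => f; rewrite Fx.
Qed.

Lemma inverse_eval' Y : ranked Y -> exists e : {linear D (D' Y) -> Y},
  (forall f, e f = 0 -> f = 0) /\ forall F x, (forall f : D' Y, (F : D (D' Y)) f = f x) -> e F = x.
Proof.
move=> hY; have [e [eK Ke]] := bij_inverse (eval_bij' hY).
exists e; split=> [f f0|F x Fx]; first by rewrite -[f]Ke f0 linear0.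
by rewrite -[RHS]eK; congr (e _); apply: linear_ext => f; rewrite Fx.
Qed.

(** Duality exchanges the two approximation properties and, by [Ext_dual], the two Ext conditions;
    reflexivity removes the double duals. *)
Lemma dual_cluster_tilting : cluster_tilting d M'.
Proof.
have fl (Y : lmodType B) : M' Y -> finite_length Y.
  by move=> /M'_ranked/ranked_finite_length.
split; [split=> //| | | |].
- move=> X X0; apply: (M_zero hM) => f; apply: linear_ext => x.
  by rewrite (X0 x); exact: (linear0 (f : {linear restr iotaB X -> E})).
- move=> X Y hX hY; have [s sB] := dual_prod E iotaB (opp_sym op) X Y.
  by apply/(M_iso hM sB); exact: (M_prod hM).
- move=> X Y i p hY ip; apply: (M_retract hM (i := D'map p) (p := D'map i) _ hY) => f.
  by apply: linear_ext => x; transitivity (f (p (i x)) : E); last by rewrite ip.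
- move=> X /finite_length_ranked hX; have [_ _ cf _ _] := hM.
  have [V [f [hV fP]]] := cf _ (ranked_finite_length (dual_ranked' hX)).
  have [e [_ eE]] := inverse_eval' hX.
  exists (D V), (e \o Dmap f); split=> [|W g hW]; first exact: M'_dual.
  have [h hf] := fP _ (D'map g) hW; exists (flip iotaAB h) => w /=.
  by apply: eE => y; transitivity ((h (f y) : D' W) w); last by rewrite hf.
- move=> X /finite_length_ranked hX; have [_ cf _ _ _] := hM.
  have [V [f [hV fP]]] := cf _ (ranked_finite_length (dual_ranked' hX)).
  exists (D V), (flip iotaAB f); split=> [|W g hW]; first exact: M'_dual.
  have [h hf] := fP _ (D'map g) hW; have [e [_ eE]] := inverse_eval' (M'_ranked hW).
  exists (e \o Dmap h) => x /=; apply: eE => y.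
  by transitivity ((f (h y) : D' X) x); last by rewrite hf.
- move=> X; split=> [hX|[/finite_length_ranked hX H]].
    split=> [|k Y kd hY]; first exact: fl.
    have [k0 _] := andP kd; have hY' := M'_ranked hY.
    have [e [eK Ke]] := bij_inverse (eval_bij' hY').
    apply: (Ext_iso (s := e) k0 (Bijective Ke eK)).
    apply/(Ext_dual k0 (M'_ranked hX) (dual_ranked' hY')).
    exact: (M_Ext hM).
  have [_ _ _ _ h] := hM; apply/h; split=> [|k Z kd hZ].
    exact/ranked_finite_length/dual_ranked'.
  have [k0 _] := andP kd; apply/(Ext_dual k0 hX (M_ranked hM hZ)).
  by apply: H => //; exact: M'_dual.
move=> Y; split=> [hY|[/finite_length_ranked hY H]].
  split=> [|k X kd hX]; first exact: fl.
  have [k0 _] := andP kd; have hY' := M'_ranked hY.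
  have [e [eK Ke]] := bij_inverse (eval_bij' hY').
  apply: (Ext_iso (s := e) k0 (Bijective Ke eK)).
  apply/(Ext_dual k0 (M'_ranked hX) (dual_ranked' hY')).
  exact: (M_Ext hM).
have [_ _ _ h _] := hM; apply/h; split=> [|k Z kd hZ].
  exact/ranked_finite_length/dual_ranked'.
have [k0 _] := andP kd; have hZ' := M'_ranked (M'_dual hZ).
have [e [eK Ke]] := bij_inverse (eval_bij hE hR iotaAB hiA (M_ranked hM hZ)).
apply: (Ext_iso (s := e) k0 (Bijective Ke eK)).
apply/(Ext_dual k0 hZ' (dual_ranked' hY)).
apply: (Ext_iso k0 (eval_bij' hY)).
by apply: H => //; exact: M'_dual.
Qed.
End DualClusterTilting.
End ExtDuality.

Lemma is_transpose_iso (A B : pzRingType) (op : B -> A) (X : lmodType A) (T T' : lmodType B)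
    (t : {linear T -> T'}) :
  bijective t -> is_transpose op X T -> is_transpose op X T'.
Proof.
move=> tB [P1 [P0 [p1 [p0 [mp [Q0 [Q1 [phi0 [phi1 [p1s [c [s0 s1 nat ex cO]]]]]]]]]]]].
exists P1, P0, p1, p0; split=> //; exists Q0, Q1, phi0, phi1, p1s, (t \o c).
split=> // y.
  by rewrite -ex; split=> [/(injective_eq0 (bij_inj tB))|/= ->] //; rewrite linear0.
by have [z <-] := bij_onto tB y; have [x <-] := cO z; exists x.
Qed.

(** * Dualising an almost split complex *)

Section DualSequence.
Variables (R : comNzRingType) (E : lmodType R).
Hypothesis hE : standard_injective E.
Hypothesis hR : ranked (R^o : lmodType R).
Variables (A B : pzRingType) (iotaA : central_map R A) (iotaB : central_map R B).
Variable op : opp_iso B A.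
Hypothesis iotaAB : forall r, op (iotaB r) = iotaA r.
Hypothesis hiA : ranked (restr iotaA A^o).

Notation D := (dual E iotaA op).
Notation D' := (dual E iotaB (opp_sym op)).
Notation Dmap := (dual_map E iotaA op).
Notation D'map := (dual_map E iotaB (opp_sym op)).

Let iotaBA := iotaBA iotaAB.
Let hiB : ranked (restr iotaB B^o) := ranked_opp iotaAB hiA.
Let hB : ranked (B^o : lmodType B) := ranked_ring hiB.
Let coresolutionsB : has_coresolutions B := coresolutions hE hR iotaBA hiB.

Variables (d : nat) (M : lmodType A -> Prop).
Hypothesis d1 : (1 <= d)%N.
Hypothesis hM : cluster_tilting d M.
Local Notation M' := (dual_subcategory E iotaB op M).

Let hM' : cluster_tilting d M' := dual_cluster_tilting hE hR iotaAB hiA hM.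

Lemma dual_indecomposable L : ranked L -> indecomposable L -> indecomposable (D L).
Proof.
move=> hL [nL iL]; have eI := @eval_inj _ _ hE hR _ _ _ _ _ iotaAB L.
split=> [DL0|Y Z f fB].
  apply: nL => x; apply: (dual_separates hE hR (iotaA := iotaA) (op := op)) => f.
  by rewrite (DL0 f).
have [s sB] := dual_prod E iotaB (opp_sym op) Y Z.
have [g [gK Kg]] := bij_inverse fB.
have gB : bijective g by exists f.
have DgB : bijective (D'map g) by apply/(dual_bij hE hR iotaB (opp_sym op) g).
have zero (W : lmodType B) : zero_module (D' W) -> zero_module W.
  move=> W0 w; apply: (dual_separates hE hR (iotaA := iotaB) (op := opp_sym op)) => h.
  by rewrite (W0 h).
have [] := iL _ _ (s \o (D'map g \o eval E iotaAB L)).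
- exact/(bij_comp sB)/(bij_comp DgB)/(eval_bij hE hR iotaAB hiA hL).
- by left; exact: zero.
by right; exact: zero.
Qed.

Lemma dual_not_projective L : ranked L -> ~ injective_module L -> ~ projective_module (D L).
Proof.
move=> hL nL pDL; apply: nL.
have [e [eK _]] := bij_inverse (eval_bij hE hR iotaAB hiA hL).
exact: (injective_retract eK (dual_injective hE iotaAB pDL)).
Qed.

Variables (L : lmodType A) (Q : nat -> lmodType B).
Variable dQ : forall i, {linear Q i.+1 -> Q i}.
Hypothesis hL : M L.

(** The first term is L itself instead of [D' (Q 0)], since the sequence has to start at L; the
    isomorphism e is absorbed into the first map. *)
Definition dual_term i : lmodType A := if i is j.+1 then D' (Q j.+1) else L.

Variable e : {linear L -> D' (Q 0%N)}.
Hypothesis eB : bijective e.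
Hypothesis hQ : almost_split_complex d M' dQ.

Definition dual_term_iso i : {linear dual_term i -> D' (Q i)} :=
  match i with 0%N => e | j.+1 => idfun end.

Definition dual_del i : {linear dual_term i -> dual_term i.+1} :=
  D'map (dQ i) \o dual_term_iso i.

Lemma dual_term_isoB i : bijective (dual_term_iso i).
Proof. by case: i => [|i] //; exists idfun. Qed.

Lemma dual_delE i (x : dual_term i) w : (dual_del i x : D' (Q i.+1)) w = dual_term_iso i x (dQ i w).
Proof. by []. Qed.

(** By adjunction, lifting a map X -> D' Q is extending a map Q -> D X. A map D' Q -> X is, by
    fullness of the duality, dual to a map D X -> Q, and extending it is lifting the latter. *)
Lemma dual_d_exact : d_exact M d dual_del.
Proof.
have [hC rad ras las] := hQ; have [CM CO Cex Cmono] := hC.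
split.
- by case=> [|i] id; [exact: hL|exact: CM].
- move=> i x id; apply: linear_ext => w.
  transitivity (dual_term_iso i x (dQ i (dQ i.+1 w)) : E) => //.
  by rewrite (exact_comp0 (w : Q i.+2) (Cex i id)); exact: (linear0 (dual_term_iso i x : {linear restr iotaB (Q i) -> E})).
- move=> X hX; split=> [h h0 x|i h id h0].
    apply: (injective_eq0 (bij_inj eB)); apply: (injective_eq0 (dual_inj CO)).
    exact: h0.
  have [|k kE] := exactM_extend hB coresolutionsB d1 hM' hC (M'_dual hE hR iotaAB hiA hM hX) id
     (f := flip iotaAB h).
    move=> w; apply: linear_ext => x; exact: (congr1 (fun f : D' (Q i.+2) => f w) (h0 x)).
  have [h' h'E] := flip_back iotaAB k.
  have [s [sK Ks]] := bij_inverse (dual_term_isoB i).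
  exists (s \o h') => x; apply: linear_ext => w.
  transitivity (dual_term_iso i (s (h' x)) (dQ i w) : E) => //.
  by rewrite Ks h'E kE.
move=> X hX; have hX' := M'_dual hE hR iotaAB hiA hM hX; split=> [h h0 f|i h id h0].
  have [g gE] := dual_onto hE (iotaA := iotaB) (op := opp_sym op) Cmono f.
  have [x xE] := bij_onto (dual_term_isoB d) g.
  by rewrite -gE -xE; exact: h0.
have hXr := M_ranked hM hX; have Qr := M'_ranked hE hR iotaAB hiA hM (CM i.+1 (ltnW id)).
have [z zE] := dual_full hE hR iotaBA hiB (eval E iotaAB X \o h : {linear D' (Q i.+1) -> D' (D X)}) Qr.
have [|z' z'E] := exactM_lift hB d1 hM' hC hX' id (f := z).
  move=> w; apply: (dual_separates hE hR (iotaA := iotaB) (op := opp_sym op)) => f.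
  have [x xE] := bij_onto (dual_term_isoB i) f.
  transitivity ((dual_del i x : D' (Q i.+1)) (z w)); first by rewrite -xE.
  rewrite -zE /= h0.
  exact: (congr1 (fun f : D' (D X) => f w) (linear0 (eval E iotaAB X))).
have [u [_ uE]] := inverse_eval hE hR iotaAB hiA hXr.
exists (u \o D'map z') => f /=; apply: uE => w.
transitivity ((f : D' (Q i.+1)) (dQ i.+1 (z' w))) => //.
by rewrite z'E -zE.
Qed.

(** By fullness the composite of g with the correction at i is dual to some z; [comp_bij_inv] passes
    from 1 - dQ z to 1 - z dQ, whose dual is the map in question. *)
Lemma dual_in_radical i : (i <= d)%N -> in_radical (dual_del i).
Proof.
have [[CM _ _ _] rad _ _] := hQ => id g.
have Qr := M'_ranked hE hR iotaAB hiA hM (CM i.+1 id).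
have [z zE] := dual_full hE hR iotaBA hiB
  (dual_term_iso i \o g : {linear D' (Q i.+1) -> D' (Q i)}) Qr.
have uB := comp_bij_inv (rad i id z).
have /eq_bij := (dual_bij hE hR iotaB (opp_sym op)
  (idfun \- (z \o dQ i) : {linear Q i.+1 -> Q i.+1})).1 uB.
apply=> y; apply: linear_ext => w.
transitivity (y w - y (z (dQ i w)) : E).
  exact: (linearB (y : {linear restr iotaB (Q i.+1) -> E}) w (z (dQ i w))).
by rewrite -zE.
Qed.

Lemma dual_right_almost_split : right_almost_split M (dual_del d).
Proof.
have [[CM _ _ _] _ _ [nsm las]] := hQ.
have Qr := M'_ranked hE hR iotaAB hiA hM (CM d.+1 (leqnn _)).
split=> [[s sK]|V h hV nh].
  apply: nsm; have [z zE] := dual_full hE hR iotaBA hiB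
    (dual_term_iso d \o s : {linear D' (Q d.+1) -> D' (Q d)}) Qr.
  exists z => x; apply/eqP; rewrite -subr_eq0; apply/eqP.
  apply: (dual_separates hE hR (iotaA := iotaB) (op := opp_sym op)) => f.
  transitivity (f (z (dQ d x)) - f x : E).
    exact: (linearB (f : {linear restr iotaB (Q d.+1) -> E}) (z (dQ d x)) x).
  rewrite -zE /=; transitivity ((dual_del d (s f) : D' (Q d.+1)) x - f x) => //.
  by rewrite sK subrr.
have hVr := M_ranked hM hV; have [u [_ uE]] := inverse_eval hE hR iotaAB hiA hVr.
have [||k kE] := las (D V) (flip iotaAB h).
- exact: (M'_dual hE hR iotaAB hiA hM).
- move=> [r rK]; apply: nh; exists (u \o D'map r) => f; apply: linear_ext => y.
  have [ev [evK Kev]] := bij_inverse (eval_bij hE hR iotaAB hiA hVr).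
  have uev : u (D'map r f) = ev (D'map r f).
    by apply: uE => g; rewrite -[in LHS](Kev (D'map r f)).
  transitivity ((h (u (D'map r f)) : D' (Q d.+1)) y) => //; rewrite uev.
  transitivity ((eval E iotaAB V (ev (D'map r f)) : D' (D V)) (flip iotaAB h y)) => //.
  by rewrite Kev; transitivity (f (r (flip iotaAB h y)) : E) => //; rewrite rK.
have [k' k'E] := flip_back iotaAB k.
have [s [sK Ks]] := bij_inverse (dual_term_isoB d).
exists (s \o k') => v; apply: linear_ext => y.
transitivity (dual_term_iso d (s (k' v)) (dQ d y) : E) => //.
by rewrite Ks k'E kE.
Qed.

Lemma dual_left_almost_split : left_almost_split M (dual_del 0%N).
Proof.
have [[CM _ _ _] _ [nse ras] _] := hQ; have hLr := M_ranked hM hL.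
have Qr1 := M'_ranked hE hR iotaAB hiA hM (CM 1%N isT).
have [e' [eK Ke]] := bij_inverse eB.
split=> [[r rK]|V h hV nh].
  apply: nse; have [z zE] := dual_full hE hR iotaBA hiB
    (e \o r : {linear D' (Q 1%N) -> D' (Q 0%N)}) Qr1.
  exists z => y; apply/eqP; rewrite -subr_eq0; apply/eqP.
  apply: (dual_separates hE hR (iotaA := iotaB) (op := opp_sym op)) => f.
  transitivity (f (dQ 0%N (z y)) - f y : E).
    exact: (linearB (f : {linear restr iotaB (Q 0%N) -> E}) (dQ 0%N (z y)) y).
  have -> : f (dQ 0%N (z y)) = (dual_del 0%N (e' f) : D' (Q 1%N)) (z y).
    by rewrite dual_delE /= Ke.
  by rewrite -zE /= rK Ke subrr.
have [k0 k0E] := dual_full hE hR iotaBA hiB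
  (eval E iotaAB V \o (h \o e') : {linear D' (Q 0%N) -> D' (D V)})
  (M'_ranked hE hR iotaAB hiA hM (CM 0%N isT)).
have k0h x w : (e x : D' (Q 0%N)) (k0 w) = w (h x) by rewrite -k0E /= eK.
have [||k kE] := ras (D V) k0.
- exact: (M'_dual hE hR iotaAB hiA hM).
- move=> [r rK]; apply: nh; have [h' h'E] := flip_back iotaAB r.
  exists (e' \o h') => x; rewrite -[RHS]eK /=; congr (e' _).
  by apply: linear_ext => y; rewrite h'E -k0h rK.
have [u [_ uE]] := inverse_eval hE hR iotaAB hiA (M_ranked hM hV).
exists (u \o D'map k) => x; apply: uE => w.
by transitivity ((e x : D' (Q 0%N)) (dQ 0%N (k w))) => //; rewrite kE k0h.
Qed.

Lemma dual_d_almost_split : d_almost_split M d dual_del.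
Proof.
apply: d_almost_split_of_radical => //.
- exact: dual_d_exact.
- exact: dual_in_radical.
- exact: dual_left_almost_split.
exact: dual_right_almost_split.
Qed.

End DualSequence.

(** * Both assertions over a pair of opposite rings *)

Section Existence.
Variables (R : comNzRingType) (E : lmodType R).
Hypothesis hE : standard_injective E.
Hypothesis hR : ranked (R^o : lmodType R).
Variables (A B : pzRingType) (iotaA : central_map R A) (iotaB : central_map R B).
Variable op : opp_iso B A.
Hypothesis iotaAB : forall r, op (iotaB r) = iotaA r.
Hypothesis hiA : ranked (restr iotaA A^o).
Variables (n : nat) (M : lmodType A -> Prop).
Hypothesis hM : cluster_tilting n.+1 M.

Lemma almost_split_ending (N : lmodType A) :
  M N -> indecomposable N -> ~ projective_module N ->
  exists (C : nat -> lmodType A) (del : forall i, {linear C i -> C i.+1}),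
  [/\ d_almost_split M n.+1 del,
      exists (K : lmodType A) (T : lmodType B),
        [/\ is_nth_syzygy n N K, is_transpose op K T
          & is_dual E iotaB (opp_sym op) T (C 0%N)]
    & C n.+2 = N].
Proof.
move=> hN iN nN; have hA := ranked_ring hiA.
have [C [dC [e [hC [K [T [hK hT _ hD]]]]]]] :=
  core_almost_split hE hR iotaAB hiA hM hN iN nN.
exists (reverse (augment N C) n.+2), (reverse_del (augment_del dC e) n.+2); split.
- exact: (reverse_almost_split hA (coresolutions hE hR iotaAB hiA) _ hM hC).
- by exists K, T.
by rewrite /reverse iter_predn subnn.
Qed.

(** The complex for D L over B has left end D T, where T is the transpose of a syzygy of D L. Its
    dual starts at L and ends in the double dual of T, which is T. *)
Lemma almost_split_starting (L : lmodType A) :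
  M L -> indecomposable L -> ~ injective_module L ->
  exists (C : nat -> lmodType A) (del : forall i, {linear C i -> C i.+1}),
  [/\ d_almost_split M n.+1 del, C 0%N = L
    & exists DL K : lmodType B,
        [/\ is_dual E iotaA op L DL, is_nth_syzygy n DL K
          & is_transpose (opp_sym op) K (C n.+2)]].
Proof.
move=> hL iL nL; have hLr := M_ranked hM hL.
pose D := dual E iotaA op; pose M' := dual_subcategory E iotaB op M.
have iotaBA := iotaBA iotaAB; have hiB := ranked_opp iotaAB hiA.
have hM' : cluster_tilting n.+1 M' := dual_cluster_tilting hE hR iotaAB hiA hM.
have hDL : M' (D L) := M'_dual hE hR iotaAB hiA hM hL.
have [C [dC [e [hC [K [T [hK hT Tr hD]]]]]]] :=
  core_almost_split hE hR iotaBA hiB hM' hDL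
    (dual_indecomposable hE hR iotaAB hiA hLr iL)
    (dual_not_projective hE hR iotaAB hiA hLr nL).
have [t tB] := is_dual_unique (hD : is_dual E iotaA op T (augment (D L) C n.+2)).
have eB := eval_bij hE hR iotaAB hiA hLr.
exists _, (dual_del (augment_del dC e) (eval E iotaAB L)).
split=> //.
  exact: (dual_d_almost_split hE hR iotaAB hiA _ hM hL eB hC).
exists (D L), K; split=> //; first exact: dual_is_dual.
apply: (is_transpose_iso (t := dual_map E iotaB (opp_sym op) t \o eval E iotaAB T)) hT.
exact: (bij_comp ((dual_bij hE hR iotaB (opp_sym op) t).1 tB) (eval_bij hE hR iotaAB hiA Tr)).
Qed.
End Existence.

Section ArtinAlgebra.
Variables (R : comNzRingType) (Lam : algType R).

Definition scalar_map : central_map R Lam.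
Proof.
apply: (@CentralMap R Lam (fun r => r%:A)).
- by rewrite scale1r.
- by move=> r s; rewrite scalerDl.
- by move=> r s; rewrite -scalerAl mul1r scalerA.
by move=> r a; rewrite mulr_algl mulr_algr.
Defined.

Definition converse_iso : opp_iso Lam Lam^c.
Proof. by apply: (@OppIso Lam Lam^c (fun a => a) (fun a => a)). Defined.

(** The underlying function is that of [scalar_map], so that compatibility with [converse_iso] holds
    by computation. *)
Definition converse_scalar_map : central_map R Lam^c.
Proof.
apply: (@CentralMap R Lam^c (fun r => r%:A : Lam)).
- by rewrite scale1r.
- by move=> r s; rewrite scalerDl.
- by move=> r s; exact: etrans (cmapM scalar_map r s) (cmapC scalar_map r _).
by move=> r a; exact: esym (cmapC scalar_map r a).
Defined.

Lemma artin_algebra_ranked : artin_algebra Lam ->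
  ranked (R^o : lmodType R) /\ ranked (restr converse_scalar_map (Lam^c)^o).
Proof.
move=> [aR [m [s sE]]]; have hR := artinian_ranked aR; split=> //.
apply: finitely_generated_ranked => //.
apply: (@finitely_generated_ord R (restr converse_scalar_map (Lam^c)^o) m s) => x.
have [c cE] := sE x; exists c; rewrite [LHS]cE.
by apply: eq_bigr => i _; rewrite -mulr_algr.
Qed.
End ArtinAlgebra.

Theorem theorem5p5 (R : comNzRingType) (Lam : algType R) (d : nat)
    (M : lmodType Lam^c -> Prop) (E : lmodType R) :
  artin_algebra Lam -> (1 <= d)%N -> cluster_tilting d M ->
  standard_injective E ->
  (forall N : lmodType Lam^c,
     M N -> indecomposable N -> ~ projective_module N ->
     exists (C : nat -> lmodType Lam^c)
            (del : forall i, {linear C i -> C i.+1}),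
       [/\ d_almost_split M d del, is_tau E d N (C 0%N) & C d.+1 = N]) /\
  (forall L : lmodType Lam^c,
     M L -> indecomposable L -> ~ injective_module L ->
     exists (C : nat -> lmodType Lam^c)
            (del : forall i, {linear C i -> C i.+1}),
       [/\ d_almost_split M d del, C 0%N = L & is_tau_inv E d L (C d.+1)]).
Proof.
move=> /artin_algebra_ranked[hR hLam]; case: d => // n _ hM hE.
have compat r : converse_iso Lam (scalar_map Lam r) = converse_scalar_map Lam r by [].
split=> [N hN iN nN|L hL iL nL].
  exact: (almost_split_ending hE hR compat hLam hM hN iN nN).
exact: (almost_split_starting hE hR compat hLam hM hL iL nL).
Qed.
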